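(* Let $(\mathcal L,\mathcal E,m,n)$ be an LVMB datum satisfying condition $(K)$, and let $N=N(\mathcal L,\mathcal E,m,n)$ be the associated LVMB-manifold. Then $N$ can be obtained as an intermediate generalized GIT-quotient $U/G$, for some choice of a $(\mathbb C^* )^{2m}$-action on $\mathbb P^n$, of an open subset $U\subset\mathbb P^n$ that is good with respect to this action, and of a closed cocompact complex Lie subgroup $G\subset(\mathbb C^* )^{2m}$ isomorphic to $\mathbb C^m$. In particular, any LVMB-manifold can be obtained as a small deformation of such an intermediate generalized GIT-quotient.
   Context: **Data.** Let $m$ and $n\ge 2m$ be positive integers. A datum $(\mathcal L,\mathcal E,m,n)$ consists of an ordered tuple $\mathcal L=(\ell_0,\dots,\ell_n)$ of linear forms on $\mathbb C^m$, regarded as row vectors in $\mathbb C^m$ and also as elements of $\mathbb R^{2m}$ via $\ell_i\mapsto(\mathrm{Re}\,\ell_i,\mathrm{Im}\,\ell_i)$, and a nonempty family $\mathcal E=\{\mathcal E_\alpha\}_\alpha$ of subsets of $\{0,\dots,n\}$, each of cardinality $2m+1$. To it one associates the Zariski open set $U(\mathcal E)=\{[x_0:\dots:x_n]\in\mathbb P^n : \text{there is } \mathcal E_\alpha\in\mathcal E \text{ with } x_i\ne0 \text{ for all } i\in\mathcal E_\alpha\}$, the $\mathbb C^m$-action on it $z\cdot[x_0:\dots:x_n]=[e^{\ell_0(z)}x_0:\dots:e^{\ell_n(z)}x_n]$, and the polytopes $P_\alpha\subset\mathbb R^{2m}$, where $P_\alpha$ is the convex hull of $\{\ell_i : i\in\mathcal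 E_\alpha\}$. **LVMB.** The datum is an LVMB datum if (sep) $\mathring P_\alpha\cap\mathring P_\beta\neq\varnothing$ for all $\alpha,\beta$ (interiors in $\mathbb R^{2m}$); and (comp) for every $\mathcal E_\alpha\in\mathcal E$ and every $i\in\{0,\dots,n\}$ there is $j\in\mathcal E_\alpha$ with $(\mathcal E_\alpha\setminus\{j\})\cup\{i\}\in\mathcal E$. (By a theorem of Bosio this is equivalent to: the $\mathbb C^m$-action on $U(\mathcal E)$ is proper with compact quotient; the action is then also free.) Then $N(\mathcal L,\mathcal E,m,n)=U(\mathcal E)/\mathbb C^m$ is a compact complex manifold of dimension $n-m$, called an LVMB-manifold. **Condition $(K)$.** The datum satisfies $(K)$ if there is a real affine automorphism of $\mathbb R^{2m}$ sending each $\ell_i$ to a vector with integer coordinates. **Good open sets.** For a complex Lie group $H$ acting holomorphically and effectively on $\mathbb P^n$, an $H$-stable open subset $U\subset\mathbb P^n$ is good with respect to the action if the restricted action of $H$ on $U$ is proper and $U/H$ is compact. **Intermediate generalized GIT-quotients.** Let $(\mathbb C^* )^{2m}$ act effectively and linearly on $\mathbb P^n$, by $t\cdot[x_0:\dots:x_n]=[t^{\lambda_0}x_0:\dots:t^{\lambda_n}x_n]$ with $\lambda_i=(\lambda_{i,1},\dots,\lambda_{i,2m})\in\mathbb Z^{2m}$ and $t^{\lambda_i}=t_1^{\lambda_{i,1}}\cdots t_{2m}^{\lambda_{i,2m}}$. Let $U\subset\mathbb P^n$ be good with respect to this action, and let $G$ be a closed cocompact complex Lie subgroup of $(\mathbb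 C^* )^{2m}$ isomorphic to $\mathbb C^m$. Then $G$ acts freely and properly on $U$, and the compact complex manifold $U/G$ is called an intermediate (generalized) GIT-quotient. ''Small deformation'' is meant in the usual sense of deformation theory of compact complex manifolds. *)

(* Defs.v *)
From HB Require Import structures.
From mathcomp Require Import all_boot all_order all_algebra.
From mathcomp Require Import complex.
From mathcomp Require Import all_classical all_reals all_analysis.

Set Implicit Arguments.
Unset Strict Implicit.
Unset Printing Implicit Defensive.

Import Order.TTheory GRing.Theory Num.Theory.
Import numFieldNormedType.Exports.
Local Open Scope classical_set_scope.
Local Open Scope ring_scope.
Local Open Scope complex_scope.
Local Open Scope quotient_scope.

(** [R[i]], typed so that its canonical norm and topology are found. *)
Definition Cx (R : realType) : numClosedFieldType := R[i].

(** A group action is divided out by taking for [f] the map sending a point to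
    its orbit, so that two points are identified when their orbits coincide. *)

Section KernelQuotient.
Context {X : topologicalType} {T : Type} (f : X -> T).

Definition ker_rel (x y : X) : bool := `[< f x = f y >].

Lemma ker_rel_equiv : equiv_class_of ker_rel.
Proof.
split=> [x|x y|y x z].
- exact/asboolP.
- by apply/asboolP/asboolP => ->.
- by move=> /asboolP exy /asboolP eyz; apply/asboolP; rewrite exy.
Qed.

Canonical ker_equiv := EquivRelPack ker_rel_equiv.

Definition ker_quot : topologicalType := quotient_topology {eq_quot ker_equiv}.

Definition ker_pi (x : X) : ker_quot :=
  \pi_(quotient_topology {eq_quot ker_equiv}) x.

Definition ker_repr (y : ker_quot) : X :=
  repr (y : quotient_topology {eq_quot ker_equiv}).

End KernelQuotient.

(** Complex manifolds as topological spaces with their sheaf of holomorphic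
    functions, which determines the complex structure.  The sheaf is given by
    germs: [hol_at x f] says that [f] restricts to a section on a neighbourhood
    of [x]; only the values of [f] near [x] matter. *)
Record fspace (R : realType) := FSpace {
  fspace_car :> topologicalType ;
  hol_at : fspace_car -> (fspace_car -> Cx R) -> Prop
}.

Definition affine (R : realType) (d : nat) : fspace R :=
  @FSpace R 'rV[Cx R]_d
    (fun x f => \forall y \near x, differentiable (f : _ -> (Cx R)^o) y).

(** For [A] open this is the usual restriction; for [A] closed, the functions
    that locally extend to the ambient space: on a closed submanifold, its
    induced complex structure. *)
Definition fsub (R : realType) (X : fspace R) (A : set X) : fspace R :=
  @FSpace R (set_type A)
    (fun x f => exists g : X -> Cx R,
       hol_at (set_val x) g /\ \forall y \near x, f y = g (set_val y)).

(** A function on an open set [V] of the quotient is a section when its pullback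
    is one on the preimage of [V]. *)
Definition fquot (R : realType) (X : fspace R) (T : Type) (f : X -> T) : fspace R :=
  @FSpace R (ker_quot f)
    (fun y g => \forall y' \near y, forall x : X,
       ker_pi f x = y' -> hol_at x (g \o ker_pi f)).

Definition holomorphic (R : realType) (X Y : fspace R) (phi : X -> Y) : Prop :=
  continuous phi /\
  forall (x : X) (g : Y -> Cx R), hol_at (phi x) g -> hol_at x (g \o phi).

Definition biholomorphism (R : realType) (X Y : fspace R)
    (phi : X -> Y) (psi : Y -> X) : Prop :=
  [/\ cancel phi psi, cancel psi phi, holomorphic phi & holomorphic psi].

Definition biholomorphic (R : realType) (X Y : fspace R) : Prop :=
  exists (phi : X -> Y) (psi : Y -> X), biholomorphism phi psi.

(** [phi] is a holomorphic chart with domain [W] and inverse [psi]; the values of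
    [phi] outside [W] and of [psi] outside [phi @` W] are irrelevant. *)
Definition is_chart (R : realType) (X : fspace R) (d : nat) (W : set X)
    (phi : X -> affine R d) (psi : affine R d -> X) : Prop :=
  [/\ open W, open (phi @` W),
      forall x, W x -> psi (phi x) = x,
      forall x, W x -> {for x, continuous phi} /\ {for phi x, continuous psi}
    & forall x (f : X -> Cx R), W x -> hol_at x f <-> hol_at (phi x) (f \o psi)].

Definition complex_manifold (R : realType) (X : fspace R) (d : nat) : Prop :=
  [/\ hausdorff_space X, @second_countable X
    & forall x : X, exists (W : set X) (phi : X -> affine R d)
        (psi : affine R d -> X), W x /\ is_chart W phi psi].

Definition submersion_at (R : realType) (X : fspace R) (d k : nat)
    (p : X -> affine R k) (x : X) : Prop :=
  exists (W : set X) (phi : X -> affine R d) (psi : affine R d -> X),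
    [/\ W x, is_chart W phi psi
      & forall v : 'rV[Cx R]_k, exists u : 'rV[Cx R]_d,
          'd (p \o psi : 'rV[Cx R]_d -> 'rV[Cx R]_k) (phi x) u = v].

(** [p : X -> B] is a proper surjective holomorphic submersion from a complex
    manifold onto a connected open set [B] of [C^k]. *)
Definition complex_family (R : realType) (k : nat) (B : set (affine R k))
    (X : fspace R) (p : X -> affine R k) : Prop :=
  [/\ open B, connected B, range p = B
    & (forall K : set (affine R k), K `<=` B -> compact K -> compact (p @^-1` K)) /\
      holomorphic p /\
      exists d : nat, complex_manifold X d /\
                      forall x : X, submersion_at d p x].

Definition fibre (R : realType) (X : fspace R) (k : nat) (p : X -> affine R k)
    (b : affine R k) : fspace R := fsub (p @^-1` [set b]).

(** [N] is an arbitrarily small deformation of members of the class [P]: [N] is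
    the fibre at [b] of one family whose fibres at parameters arbitrarily close
    to [b] include members of [P].  The family being fixed, closeness cannot be
    achieved by rescaling the base. *)
Definition small_deformation_of (R : realType) (P : fspace R -> Prop)
    (N : fspace R) : Prop :=
  exists (k : nat) (B : set (affine R k)) (X : fspace R) (p : X -> affine R k)
         (b : affine R k),
    [/\ complex_family B p, B b, biholomorphic N (fibre p b)
      & forall V : set (affine R k), nbhs b V ->
          exists b0 : affine R k,
            [/\ B b0, V b0 & exists2 Q, P Q & biholomorphic Q (fibre p b0)]].

(** The group is a subset [H] of an ambient type of parameters. *)

Section Actions.
Context {R : realType} {Par : topologicalType} {X : fspace R}.
Variables (H : set Par) (act : Par -> X -> X).

Definition orbit (x : X) : set X := [set act h x | h in H].

Definition orbit_space (U : set X) : fspace R :=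
  fquot (fun u : fsub U => orbit (set_val u)).

Definition stable (U : set X) : Prop :=
  forall h x, H h -> U x -> U (act h x).

Definition proper_on (U : set X) : Prop :=
  forall K : set (X * X), K `<=` U `*` U -> compact K ->
    compact [set hx : Par * X |
               [/\ H hx.1, U hx.2 & K (hx.2, act hx.1 hx.2)]].

Definition good (U : set X) : Prop :=
  [/\ open U, stable U, proper_on U & compact [set: orbit_space U]].

End Actions.

Definition nonzero (R : realType) (n : nat) : set (affine R n.+1) :=
  [set x : 'rV[Cx R]_n.+1 | x != 0].
Arguments nonzero : clear implicits.

Definition line (R : realType) (n : nat) (x : fsub (nonzero R n)) :
    set 'rV[Cx R]_n.+1 :=
  [set c *: (set_val x : 'rV[Cx R]_n.+1) | c in [set c : Cx R | c != 0]].

Definition projective (R : realType) (n : nat) : fspace R :=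
  fquot (@line R n).

Definition hcoord_ (R : realType) (n : nat) (p : projective R n) :
  set_type (nonzero R n) := ker_repr p.

(** A choice of homogeneous coordinates of [p]. *)
Definition hcoord (R : realType) (n : nat) (p : projective R n) : 'rV[Cx R]_n.+1 :=
  set_val (hcoord_ p).

(** [x_0 : ... : x_n] is sent to [d_0 x_0 : ... : d_n x_n].  Only used when all
    [d i] are nonzero, so that the default value of [insubd] is never taken. *)
Definition diag_act (R : realType) (n : nat) (d : 'I_n.+1 -> Cx R)
    (p : projective R n) : projective R n :=
  let x : set_type (nonzero R n) :=
    insubd (hcoord_ p) (\row_i (d i * hcoord p 0 i)) in
  ker_pi (@line R n) x.

Definition cexp (R : realType) (z : Cx R) : Cx R :=
  (expR (complex.Re z))%:C * (cos (complex.Im z) +i* sin (complex.Im z)).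

Section LVMB.
Context {R : realType} {m n : nat}.
Variables (L : 'I_n.+1 -> 'rV[Cx R]_m) (E : {set {set 'I_n.+1}}).

Definition linform (l z : 'rV[Cx R]_m) : Cx R := \sum_j l 0 j * z 0 j.

Definition realvec (l : 'rV[Cx R]_m) : 'rV[R]_(m + m) :=
  row_mx (map_mx (@complex.Re R) l) (map_mx (@complex.Im R) l).

Definition polytope (A : {set 'I_n.+1}) : set 'rV[R]_(m + m) :=
  [set \sum_(i in A) a i *: realvec (L i) | a in
     [set a : 'I_n.+1 -> R | (forall i, 0 <= a i) /\ \sum_(i in A) a i = 1]].

Definition is_datum : Prop :=
  [/\ (0 < m)%N, (2 * m <= n)%N, exists A, A \in E
    & forall A, A \in E -> #|A| = (2 * m).+1%N].

Definition is_LVMB : Prop :=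
  [/\ is_datum,
      forall A B, A \in E -> B \in E ->
        interior (polytope A) `&` interior (polytope B) !=set0
    & forall A i, A \in E -> exists2 j, j \in A & i |: (A :\ j) \in E].

Definition condition_K : Prop :=
  exists (M : 'M[R]_(m + m)) (b : 'rV[R]_(m + m)), M \in unitmx /\
    forall i j, exists k : int, (realvec (L i) *m M + b) 0 j = k%:~R.

Definition LVMB_open : set (projective R n) :=
  [set p | exists2 A, A \in E & forall i, i \in A -> hcoord p 0 i != 0].

Definition LVMB_act (z : 'rV[Cx R]_m) (p : projective R n) : projective R n :=
  diag_act (fun i => cexp (linform (L i) z)) p.

Definition LVMB_manifold : fspace R := orbit_space setT LVMB_act LVMB_open.

End LVMB.

Definition torus (R : realType) (r : nat) : set (affine R r) :=
  [set t : 'rV[Cx R]_r | forall j, t 0 j != 0].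
Arguments torus : clear implicits.

Definition torus_mul (R : realType) (r : nat) (s t : 'rV[Cx R]_r) : 'rV[Cx R]_r :=
  \row_j (s 0 j * t 0 j).

Definition torus_inv (R : realType) (r : nat) (t : 'rV[Cx R]_r) : 'rV[Cx R]_r :=
  \row_j (t 0 j)^-1.

Definition torus_act (R : realType) (r n : nat) (lam : 'I_n.+1 -> 'rV[int]_r)
    (t : 'rV[Cx R]_r) (p : projective R n) : projective R n :=
  diag_act (fun i => \prod_j (t 0 j) ^ (lam i 0 j)) p.

Definition torus_effective (R : realType) (r n : nat)
    (lam : 'I_n.+1 -> 'rV[int]_r) : Prop :=
  forall t : 'rV[Cx R]_r, torus R r t ->
    (forall p : projective R n, torus_act lam t p = p) -> t = const_mx 1.

Definition torus_subgroup (R : realType) (r : nat) (G : set (affine R r)) : Prop :=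
  [/\ G `<=` torus R r, G (const_mx 1),
      forall s t, G s -> G t -> G (torus_mul s t)
    & forall t, G t -> G (torus_inv t)].

(** The closed cocompact complex Lie subgroups of [(C^* )^r] isomorphic to
    [C^m].  That the group isomorphism is a biholomorphism onto [G] with its
    induced structure contains that [G] is a complex submanifold. *)
Definition cocompact_Cm_subgroup (R : realType) (r m : nat)
    (G : set (affine R r)) : Prop :=
  [/\ torus_subgroup G,
      closed (set_val @^-1` G : set (set_type (torus R r))),
      compact [set: fquot (fun t : fsub (torus R r) =>
                      [set torus_mul (set_val t) g | g in G])]
    & exists (rho : affine R m -> fsub G) (sig : fsub G -> affine R m),
        biholomorphism rho sig /\
        forall z w : 'rV[Cx R]_m,
          set_val (rho (z + w)) = torus_mul (set_val (rho z)) (set_val (rho w))].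

Definition is_intermediate_datum (R : realType) (m n : nat)
    (lam : 'I_n.+1 -> 'rV[int]_(2 * m)) (U : set (projective R n))
    (G : set (affine R (2 * m))) : Prop :=
  [/\ torus_effective R lam,
      good (torus R (2 * m)) (torus_act lam) U
    & cocompact_Cm_subgroup m G].

Definition intermediate_quotient (R : realType) (m n : nat)
    (lam : 'I_n.+1 -> 'rV[int]_(2 * m)) (U : set (projective R n))
    (G : set (affine R (2 * m))) : fspace R :=
  orbit_space G (torus_act lam) U.

Definition is_intermediate_GIT_quotient (R : realType) (m n : nat)
    (Q : fspace R) : Prop :=
  exists (lam : 'I_n.+1 -> 'rV[int]_(2 * m)) (U : set (projective R n))
         (G : set (affine R (2 * m))),
    is_intermediate_datum lam U G /\
    biholomorphic Q (intermediate_quotient lam U G).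

(* Main.v *)
Require Import Defs.
From mathcomp Require Import all_boot all_order all_algebra.
From mathcomp Require Import complex.
From mathcomp Require Import all_classical all_reals all_analysis.
From mathcomp Require Import ring lra.

Set Implicit Arguments.
Unset Strict Implicit.
Unset Printing Implicit Defensive.

Import Order.TTheory GRing.Theory Num.Theory.
Import numFieldNormedType.Exports.
Local Open Scope classical_set_scope.
Local Open Scope ring_scope.
Local Open Scope complex_scope.

(** What the proof uses of an LVMB datum is linear.  Write v_i = (1, l_i), a vector
of R^(1+2m).  For each member A of E the vectors v_i with i in A form a basis;
the open simplicial cones spanned by two members meet; and members can be
exchanged ((comp)).  [geo_config] states the first two properties for the rows
of a matrix, and [lvmb_geo], [geo_lvmb] say that they are equivalent to (sep).
The interest of this form is that it is invariant under right multiplication by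
an invertible matrix ([geo_config_mulr]) and that it persists, with uniform
constants, when the vectors move a little ([near_unif_config]).

Two facts about a group acting diagonally with moduli exp(v_i h), h a real
vector, follow from it, and they yield all the properness and compactness
needed.  If v_i h is bounded above on one member and below on another, then h
is bounded, because a common point of the two cones is a positive combination
of either family ([unif_proper]).  And every x in U(E) can be moved to a point
whose coordinates have modulus at most 1, with modulus 1 on some member of E
([normalize]); such points form a compact set.  The second fact is a statement
of linear programming, [feasible_exists], proved by following a segment and
exchanging one index of A each time a constraint becomes tight.

Under (K), the Smith normal form of the integral configuration shows that an
affine change of coordinates takes the l_i to integral vectors lambda_i with
lambda_0 = 0 that generate Z^2m ([real_frame]).  The torus of rank 2m then acts
effectively with these weights, and U(E) is good for it by the two facts above
([torus_good]).  The change of coordinates also defines an embedding of C^m in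
the torus, the exponential of a linear map W such that z is determined, linearly
over R, by the real part of zW; as this real part is read off from the moduli of
the point of the torus, the image is closed and cocompact
([Cm_torus_cocompact_Cm]).  Through this embedding the torus acts as C^m does on
the LVMB side ([LVMB_act_torus]), so the two orbit spaces coincide
([condition_K_GIT]).

For the deformation, let the linear forms vary in a polydisc B around the given
ones, small enough for the constants above to be uniform.  Dividing the product
of the cone over U(E) with B by the group of scalars times C^m, where C^m acts
over b through the forms with parameter b, gives a family over B whose fibres
are the LVMB manifolds of these forms ([LVMB_fibre]).  It is Hausdorff and proper
by the two facts ([family_hausdorff], [family_proper]), and its charts fix m+1 of
the homogeneous coordinates, those whose forms are affinely independent over the
complex numbers ([family_slice]).  Forms with Gaussian rational coefficients
satisfy (K) and are dense in B, which gives the fibres required near the central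
one ([LVMB_small_deformation]).

The quotients are compared through their presentations ([presents]): open maps
from an open subset of an affine space that induce both the topology and the
holomorphic functions.  Two quotients presented by the same set with the same
identifications are biholomorphic ([biholomorphic_presents]). *)

(** * Convergence and differentiability of matrix-valued maps *)
Section Coordinates.
Context {K : numFieldType}.

Lemma cvg_mx {T : Type} {F : set_system T} {FF : Filter F} m n {U : topologicalType}
    (M : T -> 'M[U]_(m, n)) (l : 'M[U]_(m, n)) :
  (forall i j, (fun t => M t i j) @ F --> l i j) -> M @ F --> l.
Proof.
move=> h A [P lP PA]; apply: (filterS PA).
have /= H : \forall t \near F, forall ij : 'I_m * 'I_n, P ij.1 ij.2 (M t ij.1 ij.2).
  by apply: filter_forall => -[i j]; apply: h.
by apply: filterS H => t Ht i j; exact: (Ht (i, j)).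
Qed.

Lemma cvg_coord {T : Type} {F : set_system T} m n {U : topologicalType}
    (M : T -> 'M[U]_(m, n)) (l : 'M[U]_(m, n)) i j :
  M @ F --> l -> (fun t => M t i j) @ F --> l i j.
Proof.
move=> h A lA; apply: (h [set N | A (N i j)]).
exists (fun i' j' => [set u | (i' = i) -> (j' = j) -> A u]).
  move=> i' j' /=; have [->|ni] := pselect (i' = i); last by apply: nearW => u /ni.
  have [->|nj] := pselect (j' = j); last by apply: nearW => u _ /nj.
  by apply: filterS lA => u ? _ _.
by move=> N; apply.
Qed.

Lemma cvg_bigsum {T I : Type} {F : set_system T} {FF : Filter F} (r : seq I)
    (P : pred I) (f : I -> T -> K) (l : I -> K) :
  (forall i, P i -> f i @ F --> l i) ->
  (fun t => \sum_(i <- r | P i) f i t) @ F --> \sum_(i <- r | P i) l i.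
Proof.
by move=> h; apply: (cvg_big (op := +%R)) => // x; apply: cvgD; [exact: cvg_fst|exact: cvg_snd].
Qed.

Lemma cvg_bigprod {T I : Type} {F : set_system T} {FF : Filter F} (r : seq I)
    (P : pred I) (f : I -> T -> K) (l : I -> K) :
  (forall i, P i -> f i @ F --> l i) ->
  (fun t => \prod_(i <- r | P i) f i t) @ F --> \prod_(i <- r | P i) l i.
Proof.
move=> h; apply: (@cvg_big K I (fun x y : K => x * y) 1 P _ T F r f l) => // x; apply: cvgM; [exact: cvg_fst|exact: cvg_snd].
Qed.

Lemma cvg_mulmx {T : Type} {F : set_system T} {FF : Filter F} m n p
    (A : T -> 'M[K]_(m, n)) (B : T -> 'M[K]_(n, p)) (a : 'M[K]_(m, n)) (b : 'M[K]_(n, p)) :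
  A @ F --> a -> B @ F --> b -> (fun t => A t *m B t) @ F --> a *m b.
Proof.
move=> hA hB; apply: cvg_mx => i j.
rewrite mxE; under eq_fun do rewrite mxE.
by apply: cvg_bigsum => k _; apply: cvgM; apply: cvg_coord.
Qed.

Lemma cvg_det {T : Type} {F : set_system T} {FF : Filter F} n
    (A : T -> 'M[K]_n) (a : 'M[K]_n) : A @ F --> a -> (fun t => \det (A t)) @ F --> \det a.
Proof.
move=> hA; apply: cvg_bigsum => s _; apply: cvgM; first exact: cvg_cst.
by apply: cvg_bigprod => i _; apply: cvg_coord.
Qed.

Lemma cvg_adj {T : Type} {F : set_system T} {FF : Filter F} n
    (A : T -> 'M[K]_n) (a : 'M[K]_n) : A @ F --> a -> (fun t => \adj (A t)) @ F --> \adj a.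
Proof.
move=> hA; apply: cvg_mx => i j.
rewrite mxE; under eq_fun do rewrite mxE.
apply: cvgM; first exact: cvg_cst.
apply: cvg_det; apply: cvg_mx => k l; rewrite !mxE.
by under eq_fun do rewrite !mxE; apply: cvg_coord.
Qed.

Lemma near_unitmx {T : Type} {F : set_system T} {FF : Filter F} n
    (A : T -> 'M[K]_n) (a : 'M[K]_n) : A @ F --> a -> a \in unitmx ->
  \forall t \near F, A t \in unitmx.
Proof.
move=> hA ua; have da : \det a != 0 by rewrite -unitfE -unitmxE.
have /(_ FF FF) := cvgr_neq0 _ (cvg_det hA) da.
by apply: filterS => t /= h; rewrite unitmxE unitfE.
Qed.

Lemma cvg_invmx {T : Type} {F : set_system T} {FF : Filter F} n
    (A : T -> 'M[K]_n) (a : 'M[K]_n) : A @ F --> a -> a \in unitmx ->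
  (fun t => invmx (A t)) @ F --> invmx a.
Proof.
move=> hA ua; have uA := near_unitmx hA ua.
have da : \det a != 0 by rewrite -unitfE -unitmxE.
apply: (@cvg_trans _ ((fun t => (\det (A t))^-1 *: \adj (A t)) @ F)).
  apply: near_eq_cvg; near=> t; rewrite /invmx ifT //; near: t; exact: uA.
rewrite /invmx ua; apply: cvg_mx => i j; rewrite mxE.
under eq_fun do rewrite mxE.
apply: cvgM; first by apply: cvgV => //; exact: cvg_det.
by apply: cvg_coord; exact: cvg_adj.
Unshelve. all: by end_near. Qed.

End Coordinates.

Section DiffCoord.
Context {K : numFieldType} {V : normedModType K}.

(** Characterises the differential by an explicit epsilon estimate, so that it can
    be transported along a local equality of functions. *)
Lemma diff_of_littleo {W : normedModType K} (f : V -> W) (x : V) (df : {linear V -> W}) :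
  continuous df ->
  (forall e : K, 0 < e -> \forall h \near (0 : V), `|f (h + x) - f x - df h| <= e * `|h|) ->
  differentiable f x /\ 'd f x = df :> (V -> W).
Proof.
move=> cdf h.
have fo : f \o shift x = cst (f x) + df +o_ (0 : V) id.
  apply/eqaddoP => e e0; have := h e e0; apply: filterS => y /=.
  by rewrite !fctE /= opprD addrA.
have E := diff_unique cdf fo; split => //.
by apply/diff_locallyP; rewrite E.
Qed.

Lemma differentiable_eps {W : normedModType K} (f : V -> W) (x : V) :
  differentiable f x ->
  forall e : K, 0 < e -> \forall h \near (0 : V), `|f (h + x) - f x - 'd f x h| <= e * `|h|.
Proof.
move=> /diff_locallyP[_ /eqaddoP fo] e e0; have := fo e e0; apply: filterS => y /=.
by rewrite !fctE /= opprD addrA.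
Qed.

Lemma diff_near_eq {W : normedModType K} (f g : V -> W) (x : V) :
  (\forall y \near x, f y = g y) -> differentiable f x ->
  differentiable g x /\ 'd g x = 'd f x :> (V -> W).
Proof.
move=> fg df; have fx := nbhs_singleton fg.
have cdf : continuous ('d f x) by exact: diff_continuous.
apply: diff_of_littleo => // e e0; have := differentiable_eps df e0.
have : \forall h \near (0 : V), f (h + x) = g (h + x).
  by have := fg; rewrite (near_shift 0) /= subr0.
by apply: filterS2 => h <-; rewrite fx.
Qed.

Lemma differentiable_near_eq {W : normedModType K} (f g : V -> W) (x : V) :
  (\forall y \near x, f y = g y) -> differentiable f x -> differentiable g x.
Proof. by move=> fg /(diff_near_eq fg)[]. Qed.

Lemma differentiable_row n (f : V -> 'rV[K]_n) x :
  (forall j, differentiable (fun y => f y 0 j : K^o) x) -> differentiable f x.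
Proof.
move=> h.
have -> : f = fun y => \sum_(j < n) f y 0 j *: (delta_mx 0 j : 'rV[K]_n).
  by apply/funext => y; rewrite {1}(row_sum_delta (f y)).
have -> : (fun y => \sum_(j < n) f y 0 j *: (delta_mx 0 j : 'rV[K]_n)) =
   \sum_(j < n) (fun y => f y 0 j *: (delta_mx 0 j : 'rV[K]_n)).
  by apply/funext => y; rewrite fct_sumE.
by apply: differentiable_sum => j; apply: differentiableZl.
Qed.

End DiffCoord.

Section EntrywiseDiff.
Context {K : numFieldType} {V : normedModType K}.
Implicit Types (x : V).

(** Rectangular matrices are differentiated entry by entry, because products and
    inverses are computed that way. *)
Definition entry_diff m n (A : V -> 'M[K]_(m, n)) x :=
  forall i j, differentiable (fun y => A y i j : K^o) x.

Lemma differentiable_bigsum (I : Type) (r : seq I) (P : pred I) (f : I -> V -> K) x :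
  (forall i, P i -> differentiable (f i : V -> K^o) x) ->
  differentiable ((fun y => \sum_(i <- r | P i) f i y) : V -> K^o) x.
Proof.
move=> h; elim: r => [|i r IH].
  by under eq_fun do rewrite big_nil; exact: differentiable_cst.
under eq_fun do rewrite big_cons; case Pi : (P i) => //.
by apply: (@differentiableD K V K^o (f i)) => //; exact: h.
Qed.

Lemma differentiable_bigprod (I : Type) (r : seq I) (P : pred I) (f : I -> V -> K) x :
  (forall i, P i -> differentiable (f i : V -> K^o) x) ->
  differentiable ((fun y => \prod_(i <- r | P i) f i y) : V -> K^o) x.
Proof.
move=> h; elim: r => [|i r IH].
  by under eq_fun do rewrite big_nil; exact: differentiable_cst.
under eq_fun do rewrite big_cons; case Pi : (P i) => //.
by apply: (@differentiableM K V (f i)) => //; exact: h.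
Qed.

Lemma entry_diff_mul m n p (A : V -> 'M[K]_(m, n)) (B : V -> 'M[K]_(n, p)) x :
  entry_diff A x -> entry_diff B x -> entry_diff (fun y => A y *m B y) x.
Proof.
move=> dA dB i j; under eq_fun do rewrite mxE.
by apply: differentiable_bigsum => k _; apply: (@differentiableM K V (fun y => A y i k)).
Qed.

Lemma differentiable_det n (A : V -> 'M[K]_n) x :
  entry_diff A x -> differentiable ((fun y => \det (A y)) : V -> K^o) x.
Proof.
move=> dA; apply: differentiable_bigsum => s _.
apply: (@differentiableM K V (cst _)); first exact: differentiable_cst.
by apply: differentiable_bigprod => i _; apply: dA.
Qed.

(** Near a point where the matrix is invertible, the inverse is given by Cramer's
    rule. *)
Lemma entry_diff_inv n (A : V -> 'M[K]_n) x :
  {for x, continuous A} -> entry_diff A x -> A x \in unitmx ->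
  entry_diff (fun y => invmx (A y)) x.
Proof.
move=> cA dA uA i j.
have du : \det (A x) != 0 by rewrite -unitfE -unitmxE.
apply: (@differentiable_near_eq _ _ _ (fun y => (\det (A y))^-1 * (\adj (A y)) i j)).
  by apply: filterS (near_unitmx cA uA) => y uy; rewrite /invmx uy [RHS]mxE.
apply: (@differentiableM K V (fun y => (\det (A y))^-1)).
  by apply: (@differentiableV K V (fun y => \det (A y))) => //; apply: differentiable_det.
under eq_fun do rewrite mxE.
apply: (@differentiableM K V (cst _)); first exact: differentiable_cst.
by apply: differentiable_det => k l; under eq_fun do rewrite !mxE; exact: dA.
Qed.

End EntrywiseDiff.

(** * Exchange configurations and feasible interpolants *)
Lemma cvg_translate {K : numFieldType} {V : normedModType K} (a b : V) :
  (fun u => a + u) @ b --> a + b.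
Proof. by apply: cvgD; [exact: cvg_cst|exact: cvg_id]. Qed.

Section Avoid.
Context {R : realType} {n : nat}.
Implicit Types (f : 'rV[R]_n) (x w : 'cV[R]_n).

Lemma continuous_form f : continuous (fun x : 'cV[R]_n => (f *m x) 0 0).
Proof.
move=> x; apply: cvg_coord.
by apply: (@cvg_mulmx R _ (nbhs x) _ _ _ _ (cst f) id); [exact: cvg_cst|exact: cvg_id].
Qed.

(** Finitely many hyperplanes have no interior: one hyperplane is left at a time by
    moving along a coordinate direction on which its form is nonzero, and a small
    displacement does not create new zeros. *)
Lemma avoid_hyperplanes (fs : seq 'rV[R]_n) (P : set 'cV[R]_n) w :
  (forall f, f \in fs -> f != 0) -> nbhs w P ->
  exists2 x, P x & forall f, f \in fs -> (f *m x) 0 0 != 0.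
Proof.
elim: fs P w => [|f fs IH] P w nz Pw; first by exists w => //; exact: nbhs_singleton.
have [||x Px xfs] := IH (P^°) w; first by move=> g gfs; apply: nz; rewrite inE gfs orbT.
  exact: nbhs_interior.
have near_fs : \forall y \near x, forall g, g \in fs -> (g *m y) 0 0 != 0.
  elim: (fs) xfs => [|g s IHs] xs; first by apply: (@filterE _ (nbhs x)) => y g; rewrite in_nil.
  have := IHs (fun h hs => xs h (@mem_behead _ (g :: s) h hs)).
  have : \forall y \near x, (g *m y) 0 0 != 0.
    have gx0 : (g *m x) 0 0 != 0 by apply: xs; rewrite inE eqxx.
    exact: (cvgr_neq0 _ (@continuous_form g x) gx0).
  apply: filterS2 => y gy sy h; rewrite inE => /orP[/eqP->//|]; exact: sy.
have fn0 : f != 0 by apply: nz; rewrite inE eqxx.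
have [j fj] : exists j, f 0 j != 0.
  apply/existsP; apply: contraNT fn0; rewrite negb_exists => /forallP h.
  by apply/eqP/rowP => j; rewrite mxE; have := h j; rewrite negbK => /eqP.
have [fx|fx] := eqVneq ((f *m x) 0 0) 0; last first.
  exists x; first exact: nbhs_singleton.
  by move=> g; rewrite inE => /orP[/eqP->//|/xfs].
have near_x : \forall e \near (0 : R)^',
    P (x + e *: delta_mx j 0) /\
    forall g, g \in fs -> (g *m (x + e *: delta_mx j 0)) 0 0 != 0.
  have realC_mx : (fun e : R => x + e *: delta_mx j 0) @ (0 : R)^' --> x.
    rewrite -[X in _ --> X]addr0 -(scale0r (delta_mx j 0)).
    apply: cvgD; first exact: cvg_cst.
    by apply: cvgZr_tmp; exact: nbhs_dnbhs.
  exact: realC_mx (filterI Px near_fs).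
have [e [e0 [Pe gse]]] := filter_ex (filterI (nbhs_dnbhs_neq (0 : R)) near_x).
exists (x + e *: delta_mx j 0) => // g; rewrite inE => /orP[/eqP->|/gse //].
rewrite mulmxDr mxE fx add0r -scalemxAr mxE mulf_neq0 //.
rewrite mxE (bigD1 j) //= big1 ?addr0 => [|k kj]; first by rewrite mxE !eqxx mulr1.
by rewrite mxE (negbTE kj) mulr0.
Qed.
End Avoid.

Section Configuration.
Context {R : realType} {n N : nat}.
Implicit Types (V : 'M[R]_(n, N)) (E : {set {set 'I_n}}) (A B : {set 'I_n}).

(** The properties of the vectors (rows of [V]) used to follow a segment of right
    hand sides: linear forms can be prescribed on a member, are determined by their
    values there, and two members have proportional positive combinations. *)
Record cone_config V E : Prop := ConeConfig {
  cfg_interp : forall A, A \in E -> exists H : 'M[R]_(N, n),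
    forall (w : 'cV[R]_n) i, i \in A -> (V *m (H *m w)) i 0 = w i 0 ;
  cfg_inj : forall A, A \in E -> forall h : 'cV[R]_N,
    (forall i, i \in A -> (V *m h) i 0 = 0) -> h = 0 ;
  cfg_sep : forall A B, A \in E -> B \in E -> exists a b : 'I_n -> R,
    [/\ forall i, i \in A -> 0 < a i, forall i, i \in B -> 0 < b i
      & forall h : 'cV[R]_N, \sum_(i in A) a i * (V *m h) i 0 =
                             \sum_(i in B) b i * (V *m h) i 0] }.

Section Walk.
Variables (V : 'M[R]_(n, N)) (E : {set {set 'I_n}}) (I : {set 'I_n}).
Hypothesis cfg : cone_config V E.
Hypothesis EI : forall A, A \in E -> A \subset I.
Hypothesis comp : forall A i, A \in E -> i \in I ->
  exists2 j, j \in A & i |: (A :\ j) \in E.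
Variable H : {set 'I_n} -> 'M[R]_(N, n).
Hypothesis HP : forall A, A \in E -> forall (w : 'cV[R]_n) i, i \in A ->
  (V *m (H A *m w)) i 0 = w i 0.

(** How far the linear form that agrees with [w] on [A] exceeds [w] at [i]. *)
Definition slack A (w : 'cV[R]_n) i := (V *m (H A *m w)) i 0 - w i 0.

Lemma slackE A w i : slack A w i = (row i (V *m H A - 1%:M) *m w) 0 0.
Proof.
by rewrite -row_mul mxE mulmxBl mul1mx -mulmxA [RHS]mxE [X in _ = _ + X]mxE.
Qed.

Lemma slackD A (w u : 'cV[R]_n) i : slack A (w + u) i = slack A w i + slack A u i.
Proof. by rewrite !slackE mulmxDr mxE. Qed.

Lemma slackZ A c (w : 'cV[R]_n) i : slack A (c *: w) i = c * slack A w i.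
Proof. by rewrite !slackE -scalemxAr mxE. Qed.

Lemma slack_in A (w : 'cV[R]_n) i : A \in E -> i \in A -> slack A w i = 0.
Proof. by move=> AE iA; rewrite /slack HP // subrr. Qed.

Definition feasible A w := forall i, i \in I -> 0 <= slack A w i.

Lemma interp_eq A B (w : 'cV[R]_n) : B \in E ->
  (forall i, i \in B -> slack A w i = 0) -> H A *m w = H B *m w.
Proof.
move=> BE h; apply/subr0_eq; apply: (cfg_inj cfg BE) => i iB.
rewrite mulmxBr mxE [X in _ + X]mxE (HP BE) //.
by have := h i iB; rewrite /slack.
Qed.

(** The interpolants on [A] and on the exchanged set differ by a form that vanishes
    on their common part.  Evaluating it on the common point of the two open cones
    leaves one term on either side, with positive coefficients, hence the signs. *)
Lemma pivot_slack A i j (u : 'cV[R]_n) : A \in E -> i \notin A -> j \in A ->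
  i |: (A :\ j) \in E -> slack A u i < 0 -> 0 < slack (i |: (A :\ j)) u j.
Proof.
move=> AE iA jA BE si; set B := i |: (A :\ j).
have [a [b [a0 b0 ab]]] := cfg_sep cfg AE BE.
(* The difference of the two interpolants. *)
pose g := H B *m u - H A *m u.
have gE k : (V *m g) k 0 = (V *m (H B *m u)) k 0 - (V *m (H A *m u)) k 0.
  by rewrite mulmxBr mxE [X in _ + X]mxE.
have ij : i != j by apply: contraNneq iA => ->.
have gA k : k \in A -> k != j -> (V *m g) k 0 = 0.
  by move=> kA kj; rewrite gE (HP AE) // (HP BE) ?subrr // !inE kj kA orbT.
have gi : (V *m g) i 0 = - slack A u i.
  by rewrite gE (HP BE) ?inE ?eqxx // /slack opprB.
have gj : (V *m g) j 0 = slack B u j by rewrite gE (HP AE _ jA).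
have := ab g; rewrite (bigD1 j) //= big1 ?addr0; last first.
  by move=> k /andP[kA kj]; rewrite gA ?mulr0.
rewrite (bigD1 i) ?inE ?eqxx //= big1 ?addr0; last first.
  move=> k /andP[]; rewrite !inE => /orP[/eqP->|/andP[kj kA]]; first by rewrite eqxx.
  by rewrite gA ?mulr0.
rewrite gi gj => eq1.
have : 0 < a j * slack B u j.
  by rewrite eq1 mulr_gt0 ?oppr_gt0 // b0 // !inE eqxx.
by rewrite pmulr_rgt0 ?a0.
Qed.

Variables (w0 u : 'cV[R]_n).
Hypothesis generic : forall A i j, A \in E -> i \notin A -> j \notin A -> i != j ->
  slack A w0 i * slack A u j != slack A u i * slack A w0 j.

(** The parameter at which the constraint becomes tight along the segment. *)
Definition root_time (p : {set 'I_n} * 'I_n) := - slack p.1 w0 p.2 / slack p.1 u p.2.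

(** At a time when a constraint is tight and about to be violated, exchange its index
    into [A].  The interpolant does not change at this time, and by [pivot_slack] the
    index that leaves has the right sign; by [generic] no other constraint is tight. *)
Lemma improve t A : A \in E -> feasible A (w0 + t *: u) ->
  exists B, [/\ B \in E, feasible B (w0 + t *: u) &
    forall i, i \in I -> slack B (w0 + t *: u) i = 0 -> 0 <= slack B u i].
Proof.
move=> AE fA.
have [h|] := pselect (forall i, i \in I -> slack A (w0 + t *: u) i = 0 -> 0 <= slack A u i).
  by exists A.
move=> /existsNP[i /not_implyP[iI /not_implyP[ti /negP]]]; rewrite -ltNge => si.
have iA : i \notin A by apply: contraTN si => iA; rewrite slack_in ?ltxx.
have [j jA BE] := comp AE iI; set B := i |: (A :\ j) in BE *.
have jB : j \notin B.
  by rewrite !inE eqxx /= orbF; apply: contraNneq iA => <-.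
have HE : H A *m (w0 + t *: u) = H B *m (w0 + t *: u).
  apply: interp_eq => // k; rewrite !inE => /orP[/eqP->//|/andP[_ kA]].
  exact: slack_in.
have sE k : slack B (w0 + t *: u) k = slack A (w0 + t *: u) k by rewrite /slack HE.
exists B; split => // [k kI|k kI]; first by rewrite sE fA.
have [kB _|kB] := boolP (k \in B); first by rewrite slack_in.
have [->|kj] := eqVneq k j; first by rewrite ltW // pivot_slack.
rewrite sE => tk; exfalso.
have kA : k \notin A by move: kB; rewrite !inE negb_or kj /= => /andP[].
have ik : i != k by apply: contraNneq kB => <-; rewrite !inE eqxx.
have /negP := generic AE iA kA ik; apply; apply/eqP.
move: ti tk; rewrite !slackD !slackZ => /eqP; rewrite addr_eq0 => /eqP-> /eqP.
by rewrite addr_eq0 => /eqP->; ring.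
Qed.

Lemma root_timeP t B i : slack B u i < 0 ->
  (0 <= slack B (w0 + t *: u) i) = (t <= root_time (B, i)).
Proof.
move=> s0; rewrite slackD slackZ /root_time /= ler_ndivlMr //.
by rewrite -[RHS]subr_ge0 opprK addrC.
Qed.

Lemma root_timeP_lt t B i : slack B u i < 0 ->
  (0 < slack B (w0 + t *: u) i) = (t < root_time (B, i)).
Proof.
move=> s0; rewrite slackD slackZ /root_time /= ltr_ndivlMr //.
by rewrite -[RHS]subr_gt0 opprK addrC.
Qed.

Lemma slack_mono t t' B i : t <= t' -> 0 <= slack B u i ->
  0 <= slack B (w0 + t *: u) i -> 0 <= slack B (w0 + t' *: u) i.
Proof.
rewrite !slackD !slackZ => tt' s0 /le_trans; apply.
by rewrite lerD2l ler_wpM2r.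
Qed.

(** Without an obstruction at the current time, feasibility persists up to the
    smallest root time at which a decreasing slack vanishes. *)
Lemma advance t B : feasible B (w0 + t *: u) -> t <= 1 ->
  (forall i, i \in I -> slack B (w0 + t *: u) i = 0 -> 0 <= slack B u i) ->
  feasible B (w0 + u) \/
  exists t' p, [/\ t < t', t' <= 1, t' = root_time p & feasible B (w0 + t' *: u)].
Proof.
move=> fB t1 gB.
pose P := [pred i | [&& i \in I, slack B u i < 0 & root_time (B, i) < 1]].
have [i Pi|P0] := pickP P; last first.
  left => i iI; rewrite -[u]scale1r.
  have [s0|s0] := ltP (slack B u i) 0; last by apply: slack_mono (fB i iI).
  by rewrite root_timeP //; have := P0 i; rewrite /= iI s0 /= leNgt => ->.
right; case: (@arg_minP _ _ _ i P (fun i => root_time (B, i)) Pi) => j /and3P[jI sj rj] minj.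
exists (root_time (B, j)), (B, j).
have tj : t < root_time (B, j).
  rewrite -root_timeP_lt // lt_neqAle fB // andbT eq_sym.
  by apply/eqP => /(gB j jI); rewrite leNgt sj.
split => // [|k kI]; first exact: ltW.
have [s0|s0] := ltP (slack B u k) 0; last by apply: slack_mono (fB k kI) => //; exact: ltW.
rewrite root_timeP //; have [rk|rk] := ltP (root_time (B, k)) 1.
  by apply: minj; rewrite /= kI s0 rk.
by apply: le_trans (ltW rj) rk.
Qed.

Lemma walk t A : A \in E -> feasible A (w0 + t *: u) -> t <= 1 ->
  exists2 B, B \in E & feasible B (w0 + u).
Proof.
(* Each step passes a root time, and there are finitely many of them. *)
have [k] := ubnP #|[pred p | (t < root_time p)%R]|.
elim: k t A => // k IH t A ck AE fA t1.
have [B [BE fB gB]] := improve AE fA.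
have [|[t' [p [tt' t'1 t'p fB']]]] := advance fB t1 gB; first by exists B.
apply: (IH t' B) => //; rewrite ltnS in ck; apply: leq_trans ck.
apply: proper_card; apply/fintype.properP; split.
  by apply/fintype.subsetP => q; rewrite !inE; exact: lt_trans.
by exists p; rewrite inE -t'p ?ltxx.
Qed.
End Walk.

(** Interpolation can be made to ignore the values outside [A], so that [H A] depends
    on [w] through its restriction to [A]. *)
Lemma cfg_interp_supported V E : cone_config V E ->
  exists H : {set 'I_n} -> 'M[R]_(N, n), forall A, A \in E ->
    (forall (w : 'cV[R]_n) i, i \in A -> (V *m (H A *m w)) i 0 = w i 0) /\
    (forall k, k \notin A -> H A *m (delta_mx k 0 : 'cV[R]_n) = 0).
Proof.
move=> cfg.
have /choice[H HP] : forall A, exists H : 'M[R]_(N, n), A \in E ->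
    forall (w : 'cV[R]_n) i, i \in A -> (V *m (H *m w)) i 0 = w i 0.
  move=> A; have [/(cfg_interp cfg)[H HP]|_] := boolP (A \in E); first by exists H.
  by exists 0.
pose D A := \matrix_(i < n, j < n) ((i == j) && (i \in A))%:R : 'M[R]_n.
have DE A (w : 'cV[R]_n) i : (D A *m w) i 0 = (i \in A)%:R * w i 0.
  rewrite mxE (bigD1 i) //= big1 ?addr0 => [|k ki]; first by rewrite mxE eqxx.
  by rewrite mxE eq_sym (negbTE ki) mul0r.
exists (fun A => H A *m D A) => A AE; split => [w i iA|k kA].
  by rewrite -[_ *m _ *m w]mulmxA HP // DE iA mul1r.
rewrite -mulmxA (_ : D A *m _ = 0) ?mulmx0 //; apply/colP => i.
rewrite DE !mxE eqxx andbT; have [->|ik] := eqVneq i k; last by rewrite mulr0.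
by rewrite (negbTE kA) mul0r.
Qed.

(** Start from a right hand side for which some member is feasible and follow the
    segment to [w].  Infeasibility is an open condition, so both ends may be moved
    into general position; then constraints become tight one at a time and [walk]
    reaches the end. *)
Theorem feasible_exists V E (I : {set 'I_n}) (w : 'cV[R]_n) :
  cone_config V E -> (exists A, A \in E) -> (forall A, A \in E -> A \subset I) ->
  (forall A i, A \in E -> i \in I -> exists2 j, j \in A & i |: (A :\ j) \in E) ->
  exists2 A, A \in E & exists h : 'cV[R]_N,
    (forall i, i \in I -> w i 0 <= (V *m h) i 0) /\
    (forall i, i \in A -> (V *m h) i 0 = w i 0).
Proof.
move=> cfg [A0 A0E] EI comp; have [H HP] := cfg_interp_supported cfg.
have HP1 A AE := (HP A AE).1; have HP2 A AE := (HP A AE).2.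
pose S A := V *m H A - 1%:M.
have sE A x i : slack V H A x i = (row i (S A) *m x) 0 0 := slackE _ _ _ _ _.
have sd A k i : A \in E -> k \notin A -> slack V H A (delta_mx k 0) i = - (i == k)%:R.
  by move=> AE kA; rewrite /slack HP2 // mulmx0 !mxE eqxx andbT sub0r.
have cs A i : continuous (fun x : 'cV[R]_n => slack V H A x i).
  by under eq_fun do rewrite sE; exact: continuous_form.
suff [A AE fA] : exists2 A, A \in E & feasible V I H A w.
  exists A => //; exists (H A *m w); split => i iA; last exact: HP1.
  by have := fA i iA; rewrite subr_ge0.
(* If no member is feasible for w, none is feasible for the right hand sides near w. *)
apply: contrapT => nofeas.
have Pw : \forall x \near w, forall A, A \in E -> ~ feasible V I H A x.
  apply: (@filter_forall _ _ (fun A x => A \in E -> ~ feasible V I H A x) (nbhs w)) => A.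
  have [AE|_] := boolP (A \in E); last by apply: (@filterE _ (nbhs w)).
  have /existsNP[i /not_implyP[iI /negP]] : ~ feasible V I H A w.
    by move=> fA; apply: nofeas; exists A.
  rewrite -ltNge => si.
  have : \forall x \near w, slack V H A x i < 0 by exact: (cvgr_lt _ (cs A i w) 0 si).
  apply: filterS => x sx _ /(_ i iI).
  by rewrite leNgt sx.
(* A right hand side for which A0 is feasible with room to spare: 0 on A0, where
   the interpolant agrees with it, and -1 elsewhere, where the interpolant is 0. *)
pose w1 : 'cV[R]_n := \col_i ((i \in A0)%:R - 1).
have fw1 : \forall x \near w1, feasible V I H A0 x.
  apply: (@filter_forall _ _ (fun i x => i \in I -> 0 <= slack V H A0 x i) (nbhs w1)) => i.
  have [iA|iA] := boolP (i \in A0).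
    by apply: (@filterE _ (nbhs w1)) => x _; rewrite (slack_in HP1).
  have Hw1 : H A0 *m w1 = 0.
    rewrite (_ : w1 = \sum_(k | k \notin A0) - delta_mx k 0).
      by rewrite mulmx_sumr big1 // => k kA; rewrite mulmxN HP2 ?oppr0.
    apply/colP => k; rewrite mxE summxE.
    have [kA|kA] := boolP (k \in A0); rewrite ?subrr ?sub0r.
      rewrite big1 // => l lA; rewrite !mxE eqxx andbT; case: eqP => [kl|]; last by rewrite oppr0.
      by rewrite -kl kA in lA.
    rewrite (bigD1 k) //= big1 ?addr0; first by rewrite !mxE !eqxx.
    by move=> l /andP[_ lk]; rewrite !mxE eq_sym (negbTE lk) oppr0.
  have s1 : 0 < slack V H A0 w1 i.
    by rewrite /slack Hw1 mulmx0 !mxE (negbTE iA) !sub0r opprK.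
  have : \forall x \near w1, slack V H A0 x i > 0 by exact: (cvgr_gt _ (cs A0 i w1) 0 s1).
  by apply: filterS => x /ltW.
have Pu : \forall u \near w - w1, (\forall x \near w1 + u,
    forall A, A \in E -> ~ feasible V I H A x).
  have : (fun u => w1 + u) @ (w - w1) --> w.
    by have := @cvg_translate _ _ w1 (w - w1); rewrite subrKC.
  by move=> h; exact: (h _ (nbhs_interior Pw)).
(* Choose the direction u first, so that no slack is constant along it, and then
   the starting point w0, so that no two slacks of one member vanish at the same
   time.  In both cases the forms to avoid are nonzero, as [sd] shows. *)
pose fs1 := [seq f <- [seq row p.2 (S p.1) | p <- enum {: {set 'I_n} * 'I_n}] | f != 0].
have [|u {}Pu gu] := avoid_hyperplanes _ Pu (fs := fs1).
  by move=> f; rewrite mem_filter => /andP[].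
have su A i : A \in E -> i \notin A -> slack V H A u i != 0.
  move=> AE iA; rewrite sE; apply: gu; rewrite mem_filter; apply/andP; split.
    apply/eqP => r0; have := sd A i i AE iA; rewrite sE r0 mul0mx mxE eqxx => /esym/eqP.
    by rewrite oppr_eq0 oner_eq0.
  by apply/mapP; exists (A, i); rewrite ?mem_enum.
pose F (t : {set 'I_n} * ('I_n * 'I_n)) :=
  slack V H t.1 u t.2.2 *: row t.2.1 (S t.1) - slack V H t.1 u t.2.1 *: row t.2.2 (S t.1).
have FE t x : (F t *m x) 0 0 = slack V H t.1 u t.2.2 * slack V H t.1 x t.2.1
                             - slack V H t.1 u t.2.1 * slack V H t.1 x t.2.2.
  by rewrite /F mulmxBl -!scalemxAl mxE [X in X + _]mxE [X in _ + X]mxE [X in _ - X]mxE -!sE.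
pose fs2 := [seq f <- [seq F t | t <- enum {: {set 'I_n} * ('I_n * 'I_n)}] | f != 0].
have Pw1 : \forall x \near w1, feasible V I H A0 x /\
    forall A, A \in E -> ~ feasible V I H A (x + u).
  apply: filterI fw1 _.
  have Pu' : \forall x \near u + w1, forall A, A \in E -> ~ feasible V I H A x.
    by rewrite addrC.
  have Pu2 : \forall x \near w1, forall A, A \in E -> ~ feasible V I H A (u + x).
    exact: (cvg_translate Pu').
  by apply: filterS Pu2 => x; rewrite (addrC u).
have [|w0 [fw0 nfw] gw] := avoid_hyperplanes _ Pw1 (fs := fs2).
  by move=> f; rewrite mem_filter => /andP[].
have gen A i j : A \in E -> i \notin A -> j \notin A -> i != j ->
    slack V H A w0 i * slack V H A u j != slack V H A u i * slack V H A w0 j.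
  move=> AE iA jA ij; rewrite -subr_eq0 [X in X - _]mulrC.
  have := FE (A, (i, j)) w0 => /= <-; apply: gw; rewrite mem_filter; apply/andP; split.
    apply/eqP => r0; have := FE (A, (i, j)) (delta_mx i 0).
    rewrite r0 mul0mx mxE /= !sd // eqxx eq_sym (negbTE ij) oppr0 mulr0 subr0 mulrN1.
    by move=> /esym/eqP; rewrite oppr_eq0; apply/negP; exact: su.
  by apply/mapP; exists (A, (i, j)); rewrite ?mem_enum.
have [||B BE fB] := @walk V E I cfg comp H HP1 w0 u gen 0 A0 A0E.
- by rewrite scale0r addr0.
- exact: ler01.
- exact: (nfw B BE fB).
Qed.

End Configuration.

(** * Configurations with uniform constants *)
Lemma unitmx_of_inj {F : fieldType} N (A : 'M[F]_N) :
  (forall h : 'cV[F]_N, A *m h = 0 -> h = 0) -> A \in unitmx.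
Proof.
move=> inj; rewrite -unitmx_tr -row_free_unit -kermx_eq0.
apply/eqP/row_matrixP => i; rewrite row0; apply: (can_inj trmxK); rewrite trmx0.
by apply: inj; rewrite -[X in X *m _]trmxK -trmx_mul -row_mul mulmx_ker row0 trmx0.
Qed.

(** Turns the rows indexed by a member of the family into a square matrix. *)
Lemma enum_rows {R : realType} n N (B : {set 'I_n}) : #|B| = N ->
  exists f : 'I_N -> 'I_n, [/\ injective f, forall k, f k \in B,
    forall i, i \in B -> exists k, f k = i &
    forall (W : zmodType) (G : 'I_n -> W), \sum_(i in B) G i = \sum_k G (f k)].
Proof.
move=> cB; pose f (k : 'I_N) : 'I_n := enum_val (cast_ord (esym cB) k).
exists f; split => [k l /enum_val_inj/cast_ord_inj //|k|i iB|W G]; first exact: enum_valP.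
  by exists (cast_ord cB (enum_rank_in iB i)); rewrite /f cast_ordK enum_rankK_in.
rewrite big_enum_val.
by rewrite (reindex (cast_ord (esym cB))) //; apply: onW_bij; exists (cast_ord cB) => k; rewrite ?cast_ordK ?cast_ordKV.
Qed.

Section UniformConfig.
Context {R : realType} {n N : nat}.
Implicit Types (V : 'M[R]_(n, N)) (E : {set {set 'I_n}}) (A B : {set 'I_n}).

(** The geometric content of (sep) for vectors given as the rows of [V]: each member
    is a basis, and the open simplicial cones of two members meet. *)
Record geo_config V E : Prop := GeoConfig {
  geo_card : forall A, A \in E -> #|A| = N ;
  geo_inj : forall A, A \in E -> forall h : 'cV[R]_N,
    (forall i, i \in A -> (V *m h) i 0 = 0) -> h = 0 ;
  geo_sep : forall A B, A \in E -> B \in E -> exists a b : 'I_n -> R,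
    [/\ forall i, i \in A -> 0 < a i, forall i, i \in B -> 0 < b i
      & \sum_(i in A) a i *: row i V = \sum_(i in B) b i *: row i V] }.

(** The constant [K] bounds the inverses of the square submatrices and the
    coefficients of the common points of the cones. *)
Record unif_config (K : R) V E : Prop := UnifConfig {
  unif_cfg : geo_config V E ;
  unif_bound : forall A, A \in E -> forall (h : 'cV[R]_N) (c : R), 0 <= c ->
    (forall i, i \in A -> `|(V *m h) i 0| <= c) -> forall j, `|h j 0| <= K * c ;
  unif_sep : forall A B, A \in E -> B \in E -> exists a b : 'I_n -> R,
    [/\ forall i, i \in A -> K^-1 <= a i <= K, forall i, i \in B -> K^-1 <= b i <= K
      & \sum_(i in A) a i *: row i V = \sum_(i in B) b i *: row i V] }.

Lemma row_sum_apply V (A : {set 'I_n}) (a : 'I_n -> R) (h : 'cV[R]_N) :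
  ((\sum_(i in A) a i *: row i V) *m h) 0 0 = \sum_(i in A) a i * (V *m h) i 0.
Proof.
rewrite mulmx_suml summxE; apply: eq_bigr => i _.
by rewrite -scalemxAl mxE -row_mul mxE.
Qed.

Lemma rowsub_mul_apply P (V : 'M[R]_(n, P)) M (f : 'I_M -> 'I_n) (h : 'cV[R]_P) k :
  (rowsub f V *m h) k 0 = (V *m h) (f k) 0.
Proof. by rewrite !mxE; apply: eq_bigr => j _; rewrite mxE. Qed.

Lemma geo_unit V E A (f : 'I_N -> 'I_n) : geo_config V E -> A \in E ->
  (forall i, i \in A -> exists k, f k = i) -> rowsub f V \in unitmx.
Proof.
move=> g AE fA; apply: unitmx_of_inj => h h0; apply: (geo_inj g AE) => i /fA[k <-].
by rewrite -rowsub_mul_apply h0 mxE.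
Qed.

Lemma geo_cone V E : geo_config V E -> cone_config V E.
Proof.
move=> g; split => [A AE|A AE|A B AE BE]; last 1 first.
- have [a [b [a0 b0 ab]]] := geo_sep g AE BE; exists a, b; split => // h.
  by rewrite -!row_sum_apply ab.
- have [f [fi fA Af _]] := @enum_rows R _ _ _ (geo_card g AE).
  have u := geo_unit g AE Af.
  exists (invmx (rowsub f V) *m rowsub f 1%:M) => w i /Af[k <-].
  rewrite -rowsub_mul_apply !mulmxA mulmxV // mul1mx rowsub_mul_apply.
  by rewrite mul1mx.
- exact: (geo_inj g AE).
Qed.

(** On the common point of the two cones the form is at once a positive combination of
    its values on [A] and on [B].  The upper bounds on [A] together with the lower
    bounds on [B] therefore bound each value on [A] from below, and the values on the
    basis [A] determine [h]. *)
Lemma unif_proper (K : R) V E (c : R) A B (h : 'cV[R]_N) : 0 < K -> 0 <= c -> unif_config K V E ->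
  A \in E -> B \in E ->
  (forall i, i \in A -> (V *m h) i 0 <= c) ->
  (forall i, i \in B -> - c <= (V *m h) i 0) ->
  forall j, `|h j 0| <= K * (c + K * (n%:R * (K * c) + n%:R * (K * c))).
Proof.
move=> K0 c0 g AE BE hA hB.
have Kc0 : 0 <= K * c by rewrite mulr_ge0 // ltW.
have nK0 : 0 <= n%:R * (K * c) by rewrite mulr_ge0.
apply: (unif_bound g AE) => [|i iA].
  by rewrite addr_ge0 // mulr_ge0 ?addr_ge0 // ltW.
have [a [b [aK bK /(congr1 (fun v => (v *m h) 0 0))]]] := unif_sep g AE BE.
rewrite !row_sum_apply (bigD1 i) //= => /(canRL (addrK _)) e.
have sumbd (P : pred 'I_n) (G : 'I_n -> R) : (forall k, P k -> - (K * c) <= G k) ->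
    - (n%:R * (K * c)) <= \sum_(k | P k) G k.
  move=> PG; apply: (@le_trans _ _ (\sum_(k | P k) - (K * c))); last exact: ler_sum.
  rewrite (eq_bigl (fun k => k \in P)) // sumr_const -[leRHS]mulr_natl mulrN lerN2 ler_wpM2r // ler_nat.
  by rewrite -[leqRHS]card_ord max_card.
have lo : - (n%:R * (K * c) + n%:R * (K * c)) <= a i * (V *m h) i 0.
  rewrite e opprD lerB //.
    apply: sumbd => k kB; have /andP[b1 b2] := bK k kB.
    have b0 : 0 <= b k by apply: le_trans b1; rewrite invr_ge0 ltW.
    apply: (@le_trans _ _ (b k * - c)); last by rewrite ler_wpM2l ?hB.
    by rewrite mulrN lerN2 ler_wpM2r.
  rewrite -lerN2 -sumrN; apply: sumbd => k /andP[kA _].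
  have /andP[a1 a2] := aK k kA.
  have a0 : 0 <= a k by apply: le_trans a1; rewrite invr_ge0 ltW.
  rewrite lerN2; apply: (@le_trans _ _ (a k * c)); first by rewrite ler_wpM2l ?hA.
  by rewrite ler_wpM2r.
have /andP[a1 a2] := aK i iA.
rewrite ler_norml; apply/andP; split; last first.
  by apply: le_trans (hA i iA) _; rewrite lerDl mulr_ge0 ?addr_ge0 // ltW.
have [s0|s0] := ltP ((V *m h) i 0) 0; last first.
  by apply: le_trans s0; rewrite oppr_le0 addr_ge0 // mulr_ge0 ?addr_ge0 // ltW.
apply: (@le_trans _ _ (- (K * (n%:R * (K * c) + n%:R * (K * c))))).
  by rewrite lerN2 lerDr.
have := le_trans lo (ler_wnM2r (ltW s0) a1).
by rewrite ler_pdivlMl // mulrN.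
Qed.

Lemma near_uniform_bound {T : Type} {F : set_system T} {FF : Filter F} (I : finType)
    (P : I -> R -> T -> Prop) :
  (forall i K K' t, K <= K' -> P i K t -> P i K' t) ->
  (forall i, exists K, \forall t \near F, P i K t) ->
  exists2 K, 0 < K & \forall t \near F, forall i, P i K t.
Proof.
move=> mono /choice[k kP].
exists (1 + \sum_i `|k i|); first by rewrite ltr_wpDr ?sumr_ge0.
apply: filter_forall => i; apply: filterS (kP i) => t; apply: mono.
rewrite (bigD1 i) //= addrCA; apply: le_trans (ler_norm _) _.
by rewrite lerDl addr_ge0 ?sumr_ge0.
Qed.

(** Inverses of the square submatrices depend continuously on the entries.  For a
    common point of two cones, keep the coefficients on [A] fixed: the coefficients on
    [B] are then continuous, and stay positive. *)
Lemma near_unif_config {T : Type} {F : set_system T} {FF : Filter F}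
    (V : T -> 'M[R]_(n, N)) (V0 : 'M[R]_(n, N)) E :
  V @ F --> V0 -> geo_config V0 E ->
  exists2 K, 0 < K & \forall t \near F, unif_config K (V t) E.
Proof.
move=> cV g.
have crow (f : 'I_N -> 'I_n) : (fun t => rowsub f (V t)) @ F --> rowsub f V0.
  apply: cvg_mx => i j; rewrite mxE; under eq_fun do rewrite mxE.
  exact: cvg_coord.
have cinv A (f : 'I_N -> 'I_n) : A \in E -> (forall i, i \in A -> exists k, f k = i) ->
    (fun t => invmx (rowsub f (V t))) @ F --> invmx (rowsub f V0).
  by move=> AE Af; apply: cvg_invmx => //; exact: (geo_unit g AE Af).
(* [Q1] and [Q2] are the two bounds of [unif_config] for given members. *)
pose Q1 A (K : R) t := A \in E -> forall (h : 'cV[R]_N) (c : R), 0 <= c ->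
    (forall i, i \in A -> `|(V t *m h) i 0| <= c) -> forall j, `|h j 0| <= K * c.
have [A K K' t KK' h AE x c c0 hx j||K1 K10 H1] := @near_uniform_bound T F FF _ Q1.
- by apply: le_trans (h AE x c c0 hx j) _; rewrite ler_wpM2r.
- move=> A; have [AE|AE] := boolP (A \in E); last first.
    by exists 0; apply: filterE => t; rewrite /Q1 (negbTE AE).
  have [f [fi fA Af _]] := @enum_rows R _ _ _ (geo_card g AE).
  pose M t := invmx (rowsub f (V t)); pose M0 := invmx (rowsub f V0).
  exists (\sum_j \sum_k (`|M0 j k| + 1)).
  have uM : \forall t \near F, rowsub f (V t) \in unitmx.
    by apply: near_unitmx (crow f) _; exact: (geo_unit g AE Af).
  have bM : \forall t \near F, forall jk : 'I_N * 'I_N, `|M t jk.1 jk.2| <= `|M0 jk.1 jk.2| + 1.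
    apply: filter_forall => -[j k] /=.
    have : (fun t => `|M t j k|) @ F --> `|M0 j k|.
      by apply: cvg_norm; apply: cvg_coord; exact: (cinv A).
    by move=> /cvgr_le; apply; rewrite ltrDl.
  apply: filterS2 uM bM => t ut bt _ h c c0 hc j.
  have -> : h = M t *m (rowsub f (V t) *m h) by rewrite mulmxA mulVmx // mul1mx.
  rewrite mxE; apply: le_trans (ler_norm_sum _ _ _) _.
  rewrite [in leRHS](bigD1 j) //= mulrDl ler_wpDr //.
    by rewrite mulr_ge0 // sumr_ge0 // => ? _; rewrite sumr_ge0.
  rewrite mulr_suml; apply: ler_sum => k _; rewrite normrM rowsub_mul_apply.
  by apply: ler_pM => //; [exact: (bt (j, k))|exact: hc].
pose Q2 (AB : {set 'I_n} * {set 'I_n}) (K : R) t := AB.1 \in E -> AB.2 \in E -> 0 < K /\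
   exists a b : 'I_n -> R,
    [/\ forall i, i \in AB.1 -> K^-1 <= a i <= K, forall i, i \in AB.2 -> K^-1 <= b i <= K
      & \sum_(i in AB.1) a i *: row i (V t) = \sum_(i in AB.2) b i *: row i (V t)].
have [[A B] K K' t KK' h /= AE BE||K2 K20 H2] := @near_uniform_bound T F FF _ Q2.
- have [/= K0 [a [b [aK bK ab]]]] := h AE BE.
  have K'0 := lt_le_trans K0 KK'; split => //; exists a, b.
  have KK : K'^-1 <= K^-1 by rewrite lef_pV2.
  split=> // i; [move=> /aK|move=> /bK] => /andP[x1 x2]; apply/andP; split.
  + exact: le_trans x1.
  + exact: le_trans KK'.
  + exact: le_trans x1.
  + exact: le_trans KK'.
- move=> [A B] /=; have [AE|AE] := boolP (A \in E); last first.
    by exists 0; apply: filterE => t; rewrite /Q2 /= (negbTE AE).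
  have [BE|BE] := boolP (B \in E); last first.
    by exists 0; apply: filterE => t; rewrite /Q2 /= (negbTE BE).
  have [f [fi fB Bf fsum]] := @enum_rows R _ _ _ (geo_card g BE).
  have [a [b [a0 b0 ab]]] := geo_sep g AE BE.
  (* The point with constant coefficients a on A, and its coefficients beta on B. *)
  pose p (W : 'M[R]_(n, N)) := \sum_(i in A) a i *: row i W.
  pose beta t := p (V t) *m invmx (rowsub f (V t)).
  have uM : \forall t \near F, rowsub f (V t) \in unitmx.
    by apply: near_unitmx (crow f) _; exact: (geo_unit g BE Bf).
  have cbeta k : (fun t => beta t 0 k) @ F --> b (f k).
    have -> : b (f k) = (p V0 *m invmx (rowsub f V0)) 0 k.
      rewrite /p ab fsum (_ : \sum_k _ = (\row_k b (f k)) *m rowsub f V0).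
        by rewrite mulmxK ?mxE //; exact: (geo_unit g BE Bf).
      apply/rowP => j; rewrite summxE mxE; apply: eq_bigr => l _; by rewrite !mxE.
    apply: cvg_coord; apply: cvg_mulmx; last exact: (cinv B).
    apply: cvg_mx => i j; rewrite summxE; under eq_fun do rewrite summxE.
    apply: cvg_bigsum => l _; rewrite !mxE; under eq_fun do rewrite !mxE.
    by apply: cvgM; [exact: cvg_cst|exact: cvg_coord].
  pose K := 1 + \sum_i (`|a i| + `|a i|^-1 + (2 * `|b i| + 2 * `|b i|^-1)).
  have S0 (i : 'I_n) : 0 <= `|a i| + `|a i|^-1 + (2 * `|b i| + 2 * `|b i|^-1).
    by rewrite !addr_ge0 ?mulr_ge0 ?invr_ge0.
  have K0 : 0 < K by rewrite ltr_wpDr ?sumr_ge0.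
  have Kge i : `|a i| + `|a i|^-1 + (2 * `|b i| + 2 * `|b i|^-1) <= K.
    by rewrite /K (bigD1 i) //= [leRHS]addrCA lerDl addr_ge0 ?sumr_ge0.
  exists K.
  have bb : \forall t \near F, forall k, b (f k) / 2 <= beta t 0 k <= 2 * b (f k).
    apply: filter_forall => k.
    have bk := b0 _ (fB k).
    have h1 : \forall t \near F, b (f k) / 2 <= beta t 0 k.
      by apply: (cvgr_ge _ (cbeta k)); rewrite ltr_pdivrMr // ltr_pMr // ltrDl.
    have h2 : \forall t \near F, beta t 0 k <= 2 * b (f k).
      by apply: (cvgr_le _ (cbeta k)); rewrite ltr_pMl // ltrDl.
    by apply: filterS2 h1 h2 => t -> ->.
  apply: filterS2 uM bb => t ut bt _ _ /=; split => //.
  exists a, (fun i => \sum_(k | f k == i) beta t 0 k).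
  have bf k : \sum_(l | f l == f k) beta t 0 l = beta t 0 k.
    by rewrite (big_pred1 k) // => l /=; rewrite (inj_eq fi).
  split => [i iA|i /Bf[k <-]|].
  + have ai := a0 i iA; have := Kge i; rewrite (gtr0_norm ai) => Ki.
    have ai' : 0 < (a i)^-1 by rewrite invr_gt0.
    have bi' : 0 <= `|b i|^-1 by rewrite invr_ge0.
    have bi := normr_ge0 (b i).
    by rewrite invf_ple ?posrE //; apply/andP; split; apply: le_trans Ki; lra.
  + have bk := b0 _ (fB k); have := Kge (f k); rewrite (gtr0_norm bk) bf => Ki.
    have bk' : 0 < (b (f k))^-1 by rewrite invr_gt0.
    have ak' : 0 <= `|a (f k)|^-1 by rewrite invr_ge0.
    have ak := normr_ge0 (a (f k)).
    have /andP[lo hi] := bt k; apply/andP; split.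
      apply: le_trans lo; rewrite invf_ple ?posrE ?divr_gt0 // invf_div; apply: le_trans Ki.
      lra.
    apply: (le_trans hi); apply: le_trans Ki; lra.
  + rewrite fsum; transitivity (beta t *m rowsub f (V t)); first by rewrite mulmxKV.
    apply/rowP => j; rewrite mxE summxE; apply: eq_bigr => k _.
    by rewrite bf !mxE.
exists (K1 + K2); first by rewrite addr_gt0.
apply: filterS2 H1 H2 => t h1 h2.
have H1 A : A \in E -> forall (h : 'cV[R]_N) (c : R), 0 <= c ->
    (forall i, i \in A -> `|(V t *m h) i 0| <= c) -> forall j, `|h j 0| <= (K1 + K2) * c.
  move=> AE h c c0 hc j; apply: le_trans (h1 A AE h c c0 hc j) _.
  by rewrite ler_wpM2r // lerDl ltW.
have H2 A B : A \in E -> B \in E -> exists a b : 'I_n -> R,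
    [/\ forall i, i \in A -> (K1 + K2)^-1 <= a i <= K1 + K2,
        forall i, i \in B -> (K1 + K2)^-1 <= b i <= K1 + K2
      & \sum_(i in A) a i *: row i (V t) = \sum_(i in B) b i *: row i (V t)].
  move=> AE BE; have [_ [a [b [aK bK ab]]]] := h2 (A, B) AE BE.
  have KK : (K1 + K2)^-1 <= K2^-1 by rewrite lef_pV2 ?posrE ?addr_gt0 // lerDr ltW.
  have KK' : K2 <= K1 + K2 by rewrite lerDr ltW.
  exists a, b; split=> // i; [move=> /aK|move=> /bK] => /andP[x1 x2]; apply/andP; split.
  + exact: le_trans x1.
  + exact: le_trans KK'.
  + exact: le_trans x1.
  + exact: le_trans KK'.
have K0 : 0 < (K1 + K2)^-1 by rewrite invr_gt0 addr_gt0.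
split => //; split; first exact: (geo_card g).
- move=> A AE h h0; apply/colP => j; rewrite mxE; apply/normr0_eq0/eqP.
  rewrite eq_le normr_ge0 andbT -(mulr0 (K1 + K2)); apply: (H1 A AE) => // i iA.
  by rewrite h0 // normr0.
- move=> A B AE BE; have [a [b [aK bK ab]]] := H2 A B AE BE; exists a, b; split => //.
  + by move=> i /aK/andP[+ _]; apply: lt_le_trans.
  + by move=> i /bK/andP[+ _]; apply: lt_le_trans.
Qed.
End UniformConfig.

(** * LVMB data as configurations *)
Lemma nbhs_ray {R : realType} {d : nat} (P : set 'rV[R]_d) (p u : 'rV[R]_d) :
  nbhs p P -> exists2 e : R, 0 < e & P (p + e *: u).
Proof.
move=> Pp.
have c : (fun e : R => p + e *: u) @ (0 : R)^'+ --> p.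
  rewrite -[X in _ --> X]addr0 -(scale0r u).
  apply: cvgD; first exact: cvg_cst.
  by apply: cvgZr_tmp; exact: cvg_within.
have h1 : \forall e \near (0 : R)^'+, P (p + e *: u) by exact: (c _ Pp).
have h2 : \forall e \near (0 : R)^'+, 0 < e by exact: nbhs_right_gt.
by have [e [? ?]] := filter_ex (filterI h1 h2); exists e.
Qed.

Section Geometry.
Context {R : realType} {m n : nat}.
Implicit Types (L : 'I_n.+1 -> 'rV[Cx R]_m) (E : {set {set 'I_n.+1}}).

(** Affine functions of the [l_i] become linear forms in the vectors (1, [l_i]). *)
Definition aff_pt (p : 'rV[R]_(m + m)) : 'rV[R]_(1 + (m + m)) := row_mx 1%:M p.

Definition aff_rows L : 'M[R]_(n.+1, 1 + (m + m)) :=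
  \matrix_(i < n.+1) aff_pt (realvec (L i)).

Lemma row_aff_rows L i : row i (aff_rows L) = aff_pt (realvec (L i)).
Proof. by rewrite rowK. Qed.

Lemma aff_pt_affine (p q : 'rV[R]_(m + m)) e :
  aff_pt (p + e *: (p - q)) = (1 + e) *: aff_pt p - e *: aff_pt q.
Proof.
rewrite /aff_pt !scale_row_mx opp_row_mx add_row_mx -scalerBl addrK scale1r.
by rewrite scalerDl scale1r scalerBr addrA.
Qed.

Lemma aff_pt_sum L (A : {set 'I_n.+1}) (a : 'I_n.+1 -> R) :
  \sum_(i in A) a i *: row i (aff_rows L) =
  row_mx (\sum_(i in A) a i)%:M (\sum_(i in A) a i *: realvec (L i)).
Proof.
under eq_bigr do rewrite row_aff_rows scale_row_mx.
elim/big_rec3: _ => [|i x y z _ ->]; first by rewrite raddf0 row_mx0.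
by rewrite add_row_mx scale_scalar_mx mulr1 raddfD.
Qed.

(** An affine function that vanishes at the vertices vanishes on the polytope, which
    has an interior point. *)
Lemma lvmb_inj L E A (h : 'cV[R]_(1 + (m + m))) : is_LVMB L E -> A \in E ->
  (forall i, i \in A -> (aff_rows L *m h) i 0 = 0) -> h = 0.
Proof.
move=> [_ sep _] AE hA; have [p [pA _]] := sep A A AE AE.
pose F q := (aff_pt q *m h) 0 0.
have Fpoly q : polytope L A q -> F q = 0.
  move=> [a [a0 a1] <-]; rewrite /F /aff_pt.
  have := aff_pt_sum L A a; rewrite a1 => <-.
  by rewrite row_sum_apply big1 // => i iA; rewrite hA ?mulr0.
have FE q : F q = usubmx h 0 0 + (q *m dsubmx h) 0 0.
  by rewrite /F /aff_pt -{1}[h]vsubmxK mul_row_col mul1mx mxE.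
have p0 : polytope L A p by exact: (interior_subset pA).
have d0 : dsubmx h = 0.
  apply/colP => j; rewrite [RHS]mxE.
  have [e e0 /Fpoly] := nbhs_ray (delta_mx 0 j) pA.
  rewrite FE mulmxDl [X in _ + X]mxE addrA -FE Fpoly // add0r -scalemxAl mxE -rowE mxE.
  by move=> /eqP; rewrite mulf_eq0 gt_eqF //= => /eqP.
have u0 : usubmx h = 0.
  apply/matrixP => i j; rewrite !ord1 [RHS]mxE.
  by have := Fpoly p p0; rewrite FE d0 mulmx0 [X in _ + X]mxE addr0.
by rewrite -[h]vsubmxK d0 u0 col_mx0.
Qed.

Lemma lvmb_card L E A : is_LVMB L E -> A \in E -> #|A| = (1 + (m + m))%N.
Proof. by move=> [[_ _ _ c] _ _] AE; rewrite c // add1n mul2n addnn. Qed.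

(** Barycentric coordinates are nonnegative on the polytope; one that vanished at an
    interior point would be negative slightly further away from the opposite vertex. *)
Lemma interior_weights L E A p : is_LVMB L E -> A \in E -> interior (polytope L A) p ->
  exists a : 'I_n.+1 -> R, (forall i, i \in A -> 0 < a i) /\
    \sum_(i in A) a i *: row i (aff_rows L) = aff_pt p.
Proof.
move=> lv AE pA.
have [f [fi fA Af fsum]] := @enum_rows R _ _ _ (lvmb_card lv AE).
have u : rowsub f (aff_rows L) \in unitmx.
  apply: unitmx_of_inj => h h0; apply: (lvmb_inj lv AE) => i /Af[k <-].
  by rewrite -rowsub_mul_apply h0 mxE.
pose c q := aff_pt q *m invmx (rowsub f (aff_rows L)).
have cP (a : 'I_n.+1 -> R) : \sum_(i in A) a i *: row i (aff_rows L)
    = (\row_k a (f k)) *m rowsub f (aff_rows L).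
  rewrite fsum; apply/rowP => j; rewrite summxE mxE; apply: eq_bigr => k _.
  by rewrite !mxE.
have cpoly q : polytope L A q -> forall k, 0 <= c q 0 k.
  move=> [a [a0 a1] <-] k; rewrite /c /aff_pt.
  have := aff_pt_sum L A a; rewrite a1 => <-.
  by rewrite cP mulmxK // mxE.
have cpos k : 0 < c p 0 k.
  have p0 : polytope L A p by exact: (interior_subset pA).
  rewrite lt_neqAle cpoly // andbT; apply/negP => /eqP ck.
  have [e e0 /cpoly/(_ k)] := nbhs_ray (p - realvec (L (f k))) pA.
  rewrite /c (_ : aff_pt _ = (1 + e) *: aff_pt p - e *: row (f k) (aff_rows L)); last first.
    by rewrite row_aff_rows aff_pt_affine.
  have lin (a b : R) (X Y : 'rV[R]_(1 + (m + m))) : (a *: X - b *: Y) 0 k = a * X 0 k - b * Y 0 k.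
    by rewrite !mxE.
  rewrite mulmxBl -!scalemxAl lin -/(c p) -ck mulr0 sub0r.
  rewrite (_ : row (f k) _ = row k (rowsub f (aff_rows L))); last first.
    by apply/rowP => j; rewrite !mxE.
  by rewrite -row_mul mulmxV // !mxE eqxx mulr1 oppr_ge0 leNgt e0.
have cf k : \sum_(l | f l == f k) c p 0 l = c p 0 k.
  by rewrite (big_pred1 k) // => l /=; rewrite (inj_eq fi).
exists (fun i => \sum_(k | f k == i) c p 0 k); split => [i /Af[k <-]|].
  by rewrite cf.
rewrite cP (_ : \row_k _ = c p); first by rewrite mulmxKV.
by apply/rowP => k; rewrite mxE cf.
Qed.

Lemma lvmb_geo L E : is_LVMB L E -> geo_config (aff_rows L) E.
Proof.
move=> lv; split => [A AE|A AE h hA|A B AE BE].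
- exact: (lvmb_card lv AE).
- exact: (lvmb_inj lv AE hA).
- have [_ sep _] := lv; have [p [pA pB]] := sep A B AE BE.
  have [a [a0 ap]] := interior_weights lv AE pA.
  have [b [b0 bp]] := interior_weights lv BE pB.
  by exists a, b; rewrite ap bp.
Qed.

(** Barycentric coordinates are continuous, so they stay positive near a point where
    they are positive. *)
Lemma weights_interior L E A (a : 'I_n.+1 -> R) : geo_config (aff_rows L) E -> A \in E ->
  (forall i, i \in A -> 0 < a i) -> \sum_(i in A) a i = 1 ->
  interior (polytope L A) (\sum_(i in A) a i *: realvec (L i)).
Proof.
move=> g AE a0 a1; set p := \sum_(i in A) _.
have [f [fi fA Af fsum]] := @enum_rows R _ _ _ (geo_card g AE).
have u := geo_unit g AE Af.
have cP (b : 'I_n.+1 -> R) : \sum_(i in A) b i *: row i (aff_rows L)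
    = (\row_k b (f k)) *m rowsub f (aff_rows L).
  rewrite fsum; apply/rowP => j; rewrite summxE mxE; apply: eq_bigr => k _.
  by rewrite !mxE.
pose c (q : 'rV[R]_(m + m)) := aff_pt q *m invmx (rowsub f (aff_rows L)).
have cp : c p = \row_k a (f k).
  by rewrite /c /aff_pt; have := aff_pt_sum L A a; rewrite a1 => <-; rewrite cP mulmxK.
have near_pos : \forall q \near p, forall k, 0 < c q 0 k.
  apply: (@filter_forall _ _ (fun k q => 0 < c q 0 k) (nbhs p)) => k.
  have ck : (fun q => c q 0 k) @ p --> c p 0 k.
    apply: cvg_coord; apply: (@cvg_mulmx R _ (nbhs p) _ _ _ _ aff_pt (cst _)); last exact: cvg_cst.
    apply: cvg_mx => i j; rewrite mxE; under eq_fun do rewrite mxE.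
    by case: (fintype.split j) => j'; [exact: cvg_cst|exact: coord_continuous].
  by apply: (cvgr_gt _ ck); rewrite cp mxE a0.
apply: filterS near_pos => q cq.
have cf k : \sum_(l | f l == f k) c q 0 l = c q 0 k.
  by rewrite (big_pred1 k) // => l /=; rewrite (inj_eq fi).
pose b i := \sum_(k | f k == i) c q 0 k.
have := aff_pt_sum L A b; rewrite cP (_ : \row_k _ = c q); last first.
  by apply/rowP => k; rewrite mxE /b cf.
rewrite mulmxKV // => /eq_row_mx[s1 e].
exists b; last exact: esym.
split => [i|]; first by apply: sumr_ge0 => k _; exact: ltW.
by move/matrixP: s1 => /(_ 0 0); rewrite !mxE eqxx !mulr1n => ->.
Qed.

(** A common point of two cones, rescaled to have total weight 1, is a common interior
    point of the polytopes. *)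
Lemma geo_lvmb L E : @is_datum m n E ->
  (forall A i, A \in E -> exists2 j, j \in A & i |: (A :\ j) \in E) ->
  geo_config (aff_rows L) E -> is_LVMB L E.
Proof.
move=> dat comp g; split => // A B AE BE.
have [a [b [a0 b0 ab]]] := geo_sep g AE BE.
have := ab; rewrite !aff_pt_sum => /eq_row_mx[s1 e].
have {s1} s1 : \sum_(i in A) a i = \sum_(i in B) b i.
  by move/matrixP: s1 => /(_ 0 0); rewrite !mxE eqxx !mulr1n.
have [|[i iA]] := set_0Vmem A.
  by move=> A0; have := geo_card g AE; rewrite A0 cards0.
have S0 : 0 < \sum_(i in A) a i.
  rewrite (bigD1 i) //= ltr_pwDl ?a0 // sumr_ge0 // => k /andP[kA _].
  by rewrite ltW ?a0.
set S := \sum_(i in A) a i in s1 S0.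
have SI : 0 < S^-1 by rewrite invr_gt0.
exists (S^-1 *: \sum_(i in A) a i *: realvec (L i)); split.
  rewrite scaler_sumr; under eq_bigr do rewrite scalerA.
  apply: (weights_interior g AE) => [k kA|]; first by rewrite mulr_gt0 ?a0.
  by rewrite -mulr_sumr mulVf ?gt_eqF.
rewrite e scaler_sumr; under eq_bigr do rewrite scalerA.
apply: (weights_interior g BE) => [k kB|]; first by rewrite mulr_gt0 ?b0.
by rewrite -mulr_sumr -s1 mulVf ?gt_eqF.
Qed.

End Geometry.

(** * Complex modulus, exponential and logarithm *)
Lemma cvg_minus_lim {K : numFieldType} {V : normedModType K} {T : Type}
    {F : set_system T} {FF : Filter F} (f : T -> V) (l : V) :
  f @ F --> l -> (fun t => f t - l) @ F --> (0 : V).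
Proof. by move=> fl; rewrite -[X in _ --> X](subrr l); apply: cvgB => //; exact: cvg_cst. Qed.

Section ComplexNumbers.
Context {R : realType}.
Local Notation C := (Cx R).
Implicit Types (z w : C).

(** The modulus with values in [R]; the norm of [Cx R] has values in [Cx R]. *)
Definition cmod z : R := complex.Re `|z|.

Lemma norm_cmod z : `|z| = (cmod z)%:C.
Proof. by rewrite /cmod normc_def. Qed.

Lemma cmodE z : cmod z = Num.sqrt (complex.Re z ^+ 2 + complex.Im z ^+ 2).
Proof. by rewrite /cmod normc_def. Qed.

Lemma cmod_ge0 z : 0 <= cmod z.
Proof. by rewrite cmodE sqrtr_ge0. Qed.

Lemma cmodM z w : cmod (z * w) = cmod z * cmod w.
Proof. by apply: complexI; rewrite -norm_cmod normrM rmorphM /= -!norm_cmod. Qed.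

Lemma cmodD z w : cmod (z + w) <= cmod z + cmod w.
Proof. by rewrite -lecR rmorphD /= -!norm_cmod ler_normD. Qed.

Lemma cmodN z : cmod (- z) = cmod z.
Proof. by apply: complexI; rewrite -!norm_cmod normrN. Qed.

Lemma cmod0 : cmod 0 = 0.
Proof. by apply: complexI; rewrite -norm_cmod normr0. Qed.

Lemma cmod1 : cmod 1 = 1.
Proof. by apply: complexI; rewrite -norm_cmod normr1. Qed.

Lemma cmod_eq0 z : (cmod z == 0) = (z == 0).
Proof.
apply/eqP/eqP => [h|->]; last exact: cmod0.
by apply/normr0_eq0; rewrite norm_cmod h.
Qed.

Lemma cmod_gt0 z : (0 < cmod z) = (z != 0).
Proof. by rewrite lt_neqAle cmod_ge0 andbT eq_sym cmod_eq0. Qed.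

Lemma cmodV z : cmod z^-1 = (cmod z)^-1.
Proof. by apply: complexI; rewrite -norm_cmod normfV norm_cmod fmorphV. Qed.

Lemma cmod_real (x : R) : cmod x%:C = `|x|.
Proof. by rewrite cmodE /= expr0n addr0 sqrtr_sqr. Qed.

Lemma cmod_prod (I : Type) (r : seq I) (P : pred I) (f : I -> C) :
  cmod (\prod_(i <- r | P i) f i) = \prod_(i <- r | P i) cmod (f i).
Proof. by apply: big_morph; [exact: cmodM|exact: cmod1]. Qed.

Lemma Re_le_cmod z : `|complex.Re z| <= cmod z.
Proof.
rewrite cmodE -sqrtr_sqr ler_sqrt ?addr_ge0 ?sqr_ge0 //.
by rewrite lerDl sqr_ge0.
Qed.

Lemma Im_le_cmod z : `|complex.Im z| <= cmod z.
Proof.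
rewrite cmodE -sqrtr_sqr ler_sqrt ?addr_ge0 ?sqr_ge0 //.
by rewrite lerDr sqr_ge0.
Qed.

Lemma cmod_le_sum z : cmod z <= `|complex.Re z| + `|complex.Im z|.
Proof.
rewrite {1}[z]complexE; apply: le_trans (cmodD _ _) _.
rewrite cmodM !cmod_real [cmod 'i%C]cmodE /=.
by rewrite expr0n add0r expr1n sqrtr1 mul1r.
Qed.

Lemma posC (e : C) : 0 < e -> exists2 r : R, 0 < r & e = r%:C.
Proof.
case: e => a b; rewrite ltcE /= => /andP[/eqP b0 a0]; exists a => //.
by rewrite b0.
Qed.

Lemma nbhs_cmod z (A : set C) :
  nbhs z A <-> exists2 e : R, 0 < e & forall w, cmod (w - z) < e -> A w.
Proof.
split=> [/nbhs_ballP[e /= /posC[r r0 ->] zA]|[r r0 zA]].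
  exists r => // w wz; apply: zA; rewrite -ball_normE /= distrC norm_cmod.
  by rewrite ltcR.
apply/nbhs_ballP; exists r%:C => /=; first by rewrite ltcR.
by move=> w; rewrite -ball_normE /= distrC norm_cmod ltcR; exact: zA.
Qed.

Lemma continuous_Re : continuous (@complex.Re R : C -> R).
Proof.
move=> z A /nbhs_ballP[e /= e0 zA]; apply/nbhs_cmod; exists e => // w wz.
apply: zA; rewrite /ball /= distrC; apply: le_lt_trans wz.
by apply: le_trans (Re_le_cmod _); case: (w) (z) => ? ? [? ?].
Qed.

Lemma continuous_Im : continuous (@complex.Im R : C -> R).
Proof.
move=> z A /nbhs_ballP[e /= e0 zA]; apply/nbhs_cmod; exists e => // w wz.
apply: zA; rewrite /ball /= distrC; apply: le_lt_trans wz.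
by apply: le_trans (Im_le_cmod _); case: (w) (z) => ? ? [? ?].
Qed.

Lemma continuous_cmod : continuous cmod.
Proof.
move=> z; apply: (@continuous_comp _ _ _ (fun z : C => `|z|) (@complex.Re R)).
  exact: norm_continuous.
exact: continuous_Re.
Qed.

Lemma cvg_Complex {T : Type} {F : set_system T} {FF : Filter F} (f g : T -> R) (a b : R) :
  f @ F --> a -> g @ F --> b -> (fun t => f t +i* g t : C) @ F --> (a +i* b : C).
Proof.
move=> fa gb A /nbhs_cmod[e e0 zA].
have e2 : 0 < e / 2 by rewrite divr_gt0.
have h1 : \forall t \near F, `|f t - a| < e / 2.
  by have /cvgrPdistC_lt := fa; apply.
have h2 : \forall t \near F, `|g t - b| < e / 2.
  by have /cvgrPdistC_lt := gb; apply.
apply: filterS2 h1 h2 => t t1 t2; apply: zA; apply: le_lt_trans (cmod_le_sum _) _ => /=.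
by rewrite (splitr e) ltrD.
Qed.

Lemma continuous_realC : continuous (fun x : R => x%:C : C).
Proof. by move=> x; apply: cvg_Complex; [exact: cvg_id|exact: cvg_cst]. Qed.

Definition cbox (r : R) : set C := [set z | `|complex.Re z| <= r /\ `|complex.Im z| <= r].

Lemma compact_cbox r : compact (cbox r).
Proof.
have -> : cbox r = (fun p : R * R => p.1 +i* p.2 : C) @` (`[- r, r] `*` `[- r, r]).
  apply/seteqP; split=> [[a b] /= []|_ /= [[a b] [/= ha hb] <-]].
    by rewrite !ler_norml => ha hb; exists (a, b) => //=; rewrite !in_itv.
  by move: ha hb; rewrite !in_itv /= /cbox /= !ler_norml.
apply: continuous_compact.
  apply: continuous_subspaceT => p; apply: cvg_Complex; [exact: cvg_fst|exact: cvg_snd].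
by apply: compact_setX; exact: segment_compact.
Qed.

Lemma cbox_cmod r z : cmod z <= r -> cbox r z.
Proof. by move=> h; split; apply: le_trans h; [exact: Re_le_cmod|exact: Im_le_cmod]. Qed.

Lemma cexpD z w : cexp (z + w) = cexp z * cexp w.
Proof.
case: z w => [a b] [c d]; rewrite /cexp /= expRD cosD sinD rmorphM /=.
rewrite mulrACA; congr (_ * _); congr Complex; ring.
Qed.

Lemma cexp0 : cexp 0 = 1 :> C.
Proof. by rewrite /cexp /= expR0 cos0 sin0 mul1r. Qed.

Lemma cexp_neq0 z : cexp z != 0.
Proof.
apply/eqP => h; have := cexpD z (- z); rewrite h mul0r subrr cexp0 => /eqP.
by rewrite oner_eq0.
Qed.

Lemma cexpN z : cexp (- z) = (cexp z)^-1.
Proof.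
by apply: (mulIf (cexp_neq0 z)); rewrite mulVf ?cexp_neq0 // -cexpD addNr cexp0.
Qed.

Lemma cexp_sum (I : Type) (r : seq I) (P : pred I) (f : I -> C) :
  cexp (\sum_(i <- r | P i) f i) = \prod_(i <- r | P i) cexp (f i).
Proof. by apply: big_morph; [exact: cexpD|exact: cexp0]. Qed.

Lemma cmod_cexp z : cmod (cexp z) = expR (complex.Re z).
Proof.
rewrite /cexp cmodM cmod_real ger0_norm ?expR_ge0 // [X in _ * X]cmodE /=.
by rewrite cos2Dsin2 sqrtr1 mulr1.
Qed.

Lemma continuous_cexp : continuous (@cexp R : C -> C).
Proof.
move=> z.
have h1 : (fun w : C => (expR (complex.Re w))%:C : C) @ z --> ((expR (complex.Re z))%:C : C).
  apply: (@cvg_Complex _ (nbhs z)); last exact: cvg_cst.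
  by apply: continuous_comp; [exact: continuous_Re|exact: continuous_expR].
have h2 : (fun w : C => cos (complex.Im w) +i* sin (complex.Im w) : C) @ z -->
    (cos (complex.Im z) +i* sin (complex.Im z) : C).
  apply: (@cvg_Complex _ (nbhs z)).
    by apply: continuous_comp; [exact: continuous_Im|exact: continuous_cos].
  by apply: continuous_comp; [exact: continuous_Im|exact: continuous_sin].
exact: (cvgM h1 h2).
Qed.

Lemma is_derive_little (f : R -> R) (d e : R) : is_derive (0 : R) (1 : R) f d -> 0 < e ->
  \forall h \near (0 : R), `|f h - f 0 - d * h| <= e * `|h|.
Proof.
move=> [df <-] e0; have := df; rewrite /derivable => /cvg_ex[l hl].
have -> : 'D_1 f 0 = l by apply/cvg_lim.
have := hl _ (nbhsx_ballx l _ e0).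
rewrite /= !near_simpl /= /dnbhs /within /= => H.
have : \forall h \near (0 : R), h != 0 -> ball l e (h^-1 *: (f (h *: 1 + 0) - f 0)) by exact: H.
apply: filterS => h; have [->|h0] := eqVneq h 0.
  by rewrite subrr mulr0 subrr !normr0 mulr0.
move=> /(_ isT); rewrite /ball /= addr0 /GRing.scale /= mulr1 => /ltW.
have hn : 0 < `|h| by rewrite normr_gt0.
by rewrite -(ler_pM2r hn) -normrM mulrBl mulrAC mulVf // mul1r distrC.
Qed.

(** Follows from the first order expansions of the real exponential, cosine and sine. *)
Lemma cexp_little (e : R) : 0 < e ->
  \forall h \near (0 : C), cmod (cexp h - 1 - h) <= e * cmod h.
Proof.
move=> e0.
pose d := Num.min (e / 6) 1.
have d0 : 0 < d by rewrite lt_min divr_gt0 /=.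
have nearR (P : R -> Prop) : (\forall x \near (0 : R), P x) ->
    nbhs (0 : C) (fun h : C => P (complex.Re h)) by move=> /(@continuous_Re 0).
have nearI (P : R -> Prop) : (\forall x \near (0 : R), P x) ->
    nbhs (0 : C) (fun h : C => P (complex.Im h)) by move=> /(@continuous_Im 0).
have hexp : \forall x \near (0 : R), `|expR x - 1 - x| <= d * `|x|.
  have := @is_derive_little expR (expR 0) d (is_derive_expR 0) d0.
  by rewrite expR0; apply: filterS => x; rewrite mul1r.
have hcos : \forall x \near (0 : R), `|cos x - 1| <= d * `|x|.
  have := @is_derive_little cos (- sin 0) d (is_derive_cos 0) d0.
  by rewrite cos0 sin0; apply: filterS => x; rewrite oppr0 mul0r subr0.
have hsin : \forall x \near (0 : R), `|sin x - x| <= d * `|x|.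
  have := @is_derive_little sin (cos 0) d (is_derive_sin 0) d0.
  by rewrite cos0 sin0; apply: filterS => x; rewrite subr0 mul1r.
have hsmall : \forall x \near (0 : R), `|x| <= d / 2.
  have d2 : 0 < d / 2 by rewrite divr_gt0.
  by apply: filterS (nbhsx_ballx (0:R) _ d2) => x; rewrite /ball /= sub0r normrN => /ltW.
apply: filterS2 (nearR _ (filterI hexp hsmall)) (nearI _ (filterI hcos hsin)).
move=> -[a b] /= [H1 H4] [H2 H3].
have d1 : d <= 1 by rewrite ge_min lexx orbT.
have d6 : 6 * d <= e by rewrite mulrC -ler_pdivlMr // ge_min lexx.
have ha : `|expR a - 1| <= d.
  rewrite -[expR a - 1](subrK a); apply: le_trans (ler_normD _ _) _.
  apply: (@le_trans _ _ (d * `|a| + `|a|)); first by rewrite lerD2r.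
  have : d * `|a| <= `|a| by rewrite ler_piMl.
  lra.
have ha2 : `|expR a| <= 2.
  rewrite -[expR a](subrK 1); apply: le_trans (ler_normD _ _) _; rewrite normr1.
  lra.
have nb := normr_ge0 b.
have R1 : `|expR a * cos b - 1 - a| <= 2 * (d * `|b|) + d * `|a|.
  have -> : expR a * cos b - 1 - a = expR a * (cos b - 1) + (expR a - 1 - a) by ring.
  by apply: le_trans (ler_normD _ _) _; rewrite normrM lerD // ler_pM.
have I1 : `|expR a * sin b - b| <= 2 * (d * `|b|) + d * `|b|.
  have -> : expR a * sin b - b = expR a * (sin b - b) + (expR a - 1) * b by ring.
  by apply: le_trans (ler_normD _ _) _; rewrite !normrM lerD // ler_pM.
apply: le_trans (cmod_le_sum _) _.
have -> : complex.Re (cexp (a +i* b : C) - 1 - (a +i* b : C)) = expR a * cos b - 1 - a.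
  by rewrite /cexp /= mul0r subr0.
have -> : complex.Im (cexp (a +i* b : C) - 1 - (a +i* b : C)) = expR a * sin b - b.
  by rewrite /cexp /= mul0r addr0 oppr0 addr0.
have A := Re_le_cmod (a +i* b); have B := Im_le_cmod (a +i* b); rewrite /= in A B.
apply: le_trans (lerD R1 I1) _.
apply: (@le_trans _ _ (6 * d * cmod (a +i* b))); last by rewrite ler_wpM2r ?cmod_ge0.
have A' : d * `|a| <= d * cmod (a +i* b) by rewrite ler_wpM2l // ltW.
have B' : d * `|b| <= d * cmod (a +i* b) by rewrite ler_wpM2l // ltW.
lra.
Qed.

Lemma cexp_quot : (fun h : C => h^-1 * (cexp h - 1)) @ (0 : C)^' --> (1 : C).
Proof.
move=> A /nbhs_cmod[e e0 eA].
have e2 : 0 < e / 2 by rewrite divr_gt0.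
have H : \forall h \near (0 : C)^', cmod (cexp h - 1 - h) <= e / 2 * cmod h.
  by apply: nbhs_dnbhs; exact: cexp_little.
have N : \forall h \near (0 : C)^', h != 0 by exact: nbhs_dnbhs_neq.
apply: filterS2 H N => h Hh h0; apply: eA.
have -> : h^-1 * (cexp h - 1) - 1 = h^-1 * (cexp h - 1 - h).
  by rewrite [RHS]mulrBr mulVf.
rewrite cmodM cmodV ltr_pdivrMl ?cmod_gt0 // [ltRHS]mulrC.
apply: le_lt_trans Hh _; rewrite ltr_pM2r ?cmod_gt0 //.
by rewrite ltr_pdivrMr // ltr_pMr // ltrDl.
Qed.

Lemma cexp_quot_at z : (fun h : C => h^-1 * (cexp (h + z) - cexp z)) @ (0 : C)^' --> cexp z.
Proof.
have -> : (fun h : C => h^-1 * (cexp (h + z) - cexp z)) =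
          (fun h : C => h^-1 * (cexp h - 1) * cexp z).
  by apply/funext => h; rewrite cexpD; ring.
rewrite -[X in _ --> X]mul1r; apply: cvgM; [exact: cexp_quot|exact: cvg_cst].
Qed.

Lemma differentiable_of_quot (f : C -> C) (x l : C) :
  (fun h : C => h^-1 * (f (h + x) - f x)) @ (0 : C)^' --> l ->
  differentiable (f : C -> C^o) x.
Proof.
move=> fl; apply/derivable1_diffP; apply/cvg_ex; exists l.
have -> : (fun h : C => h^-1 *: (((f : C -> C^o) \o shift x) (h *: 1) - f x)) =
          (fun h : C => h^-1 * (f (h + x) - f x)).
  by apply/funext => h; rewrite /= /GRing.scale /= mulr1.
exact: fl.
Qed.

Lemma cexp_differentiable z : differentiable (@cexp R : C -> C^o) z.
Proof. exact: differentiable_of_quot (@cexp_quot_at z). Qed.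

(** The principal branch on the half plane of positive real part. *)
Definition clog w : C := ln (cmod w) +i* atan (complex.Im w / complex.Re w).

Lemma clogK w : 0 < complex.Re w -> cexp (clog w) = w.
Proof.
move=> w0; set t := complex.Im w / complex.Re w.
have cw : 0 < cmod w by apply: lt_le_trans w0 _; apply: le_trans (ler_norm _) (Re_le_cmod _).
have cmw : cmod w = complex.Re w * Num.sqrt (1 + t ^+ 2).
  rewrite cmodE -[X in X * _]ger0_norm ?ltW // -sqrtr_sqr -sqrtrM ?sqr_ge0 //.
  by congr Num.sqrt; rewrite /t; field; rewrite gt_eqF.
have s0 : Num.sqrt (1 + t ^+ 2) != 0.
  by rewrite gt_eqF // sqrtr_gt0 ltr_pwDl ?sqr_ge0.
have ct : cos (atan t) = (Num.sqrt (1 + t ^+ 2))^-1 by exact: cos_atan.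
have st : sin (atan t) = t / Num.sqrt (1 + t ^+ 2).
  by apply: (mulIf s0); rewrite divfK //; have := atanK t; rewrite /tan ct invrK.
rewrite /cexp /clog /= lnK ?posrE // -/t ct st cmw.
case: w @t w0 {cw cmw ct st} s0 => a b /= a0 s0.
apply/eqP; rewrite eq_complex /=; apply/andP; split; apply/eqP.
  by rewrite mul0r subr0 mulfK.
rewrite mul0r addr0; set S := Num.sqrt _ in s0 *.
by rewrite mulrACA divff // mulr1 mulrC divfK // gt_eqF.
Qed.

Lemma cexpK z : `|complex.Im z| < 1 -> clog (cexp z) = z.
Proof.
case: z => a b /= hb.
have hb2 : - (pi / 2) < b < pi / 2.
  by rewrite -ltr_norml; apply: lt_le_trans hb (pihalf_ge1 _).
have cb : 0 < cos b by exact: cos_gt0_pihalf.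
rewrite /clog cmod_cexp expRK /=.
congr Complex; rewrite !mul0r subr0 addr0.
rewrite -mulf_div divff ?gt_eqF ?expR_gt0 // mul1r -/(tan b) tanK //.
Qed.

Lemma continuous_clog w : 0 < complex.Re w -> {for w, continuous (clog : C -> C)}.
Proof.
move=> w0; have cw : 0 < cmod w.
  by apply: lt_le_trans w0 _; apply: le_trans (ler_norm _) (Re_le_cmod _).
apply: (@cvg_Complex _ (nbhs w)).
  by apply: continuous_comp; [exact: continuous_cmod|exact: continuous_ln].
apply: continuous_comp; last exact: continuous_atan.
apply: (@cvgM R _ (nbhs w)); first exact: continuous_Im.
apply: (@cvgV R _ (nbhs w)); [by rewrite gt_eqF|exact: continuous_Re].
Qed.

(** The difference quotient of a continuous local inverse is the inverse of the
    difference quotient. *)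
Lemma inverse_quot (f g : C -> C) (w d : C) : d != 0 ->
  {for w, continuous g} -> (\forall y \near w, f (g y) = y) ->
  (fun h : C => h^-1 * (f (h + g w) - f (g w))) @ (0 : C)^' --> d ->
  (fun h : C => h^-1 * (g (h + w) - g w)) @ (0 : C)^' --> d^-1.
Proof.
move=> d0 cg fg Q; pose k (h : C) := g (h + w) - g w.
have c0 : (fun h : C => h + w) @ (0 : C)^' --> w.
  rewrite -[X in _ --> X]add0r; apply: cvgD; last exact: cvg_cst.
  exact: nbhs_dnbhs.
have ck : k @ (0 : C)^' --> (0 : C).
  have c1 : (fun h : C => g (h + w)) @ (0 : C)^' --> g w by exact: (cvg_comp _ _ c0 cg).
  exact: (cvg_minus_lim c1).
have ek : \forall h \near (0 : C)^', h = f (k h + g w) - f (g w).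
  have H : \forall h \near (0 : C)^', f (g (h + w)) = h + w by exact: (c0 _ fg).
  by apply: filterS H => h hw; rewrite /k subrK hw (nbhs_singleton fg) addrK.
have N : \forall h \near (0 : C)^', h != 0 by exact: nbhs_dnbhs_neq.
have k0 : \forall h \near (0 : C)^', k h != 0.
  apply: filterS2 ek N => h eh; apply: contra_neq => kh.
  by rewrite eh kh add0r subrr.
have ck' : k @ (0 : C)^' --> (0 : C)^'.
  by move=> A; rewrite /dnbhs /within /= => /ck; apply: filterS2 k0 => h h0; apply; exact: h0.
have Q2 : (fun h : C => (k h)^-1 * (f (k h + g w) - f (g w))) @ (0 : C)^' --> d.
  exact: (cvg_comp _ _ ck' Q).
have Q3 : (fun h : C => ((k h)^-1 * (f (k h + g w) - f (g w)))^-1) @ (0 : C)^' --> d^-1.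
  exact: (cvgV d0 Q2).
apply: cvg_trans Q3; apply: near_eq_cvg.
apply: filterS2 ek k0 => h eh kh.
by rewrite -eh invfM invrK mulrC.
Qed.

Lemma clog_differentiable w : 0 < complex.Re w -> differentiable (clog : C -> C^o) w.
Proof.
move=> w0; apply: (@differentiable_of_quot _ _ w^-1).
have e := clogK w0.
have cq z v : cexp z = v ->
    (fun h : C => h^-1 * (cexp (h + z) - cexp z)) @ (0 : C)^' --> v.
  by move=> <-; exact: cexp_quot_at.
apply: (@inverse_quot (@cexp R)).
- by apply: contraTneq w0 => ->; rewrite ltxx.
- exact: continuous_clog.
- have Rpos : \forall y \near w, 0 < complex.Re (y : C).
    exact: (cvgr_gt _ (@continuous_Re w) 0 w0).
  by apply: filterS Rpos => y; exact: clogK.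
- exact: (cq _ _ e).
Qed.

(** The bound 1 is less than pi, and suffices for exponents that can be made small. *)
Lemma cexp_small_inj z : cexp z = 1 -> `|complex.Im z| < 1 -> z = 0.
Proof. by move=> z1 zs; rewrite -(cexpK zs) z1 -cexp0 cexpK // normr0 ltr01. Qed.

End ComplexNumbers.

(** * Polydiscs and Gaussian rational points *)
Section Polyboxes.
Context {R : realType} {d : nat}.
Local Notation C := (Cx R).
Implicit Types (x y : 'rV[C]_d).

Definition polybox x (e : R) : set 'rV[C]_d := [set y | forall j, cmod (y 0 j - x 0 j) < e].

(** In terms of the real modulus, rather than of the norm of the product. *)
Lemma nbhs_polybox x (A : set 'rV[C]_d) :
  nbhs x A <-> exists2 e : R, 0 < e & polybox x e `<=` A.
Proof.
split=> [/nbhs_ballP[e /= /posC[r r0 ->] xA]|[r r0 xA]].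
  exists r => // y xy; apply: xA; split; first by rewrite ltcR.
  move=> i j; rewrite ord1 -ball_normE /= distrC norm_cmod ltcR; exact: xy.
apply/nbhs_ballP; exists r%:C => /=; first by rewrite ltcR.
move=> y [_ xy]; apply: xA => j; have := xy 0 j.
by rewrite -ball_normE /= distrC norm_cmod ltcR.
Qed.

Lemma open_polybox x e : open (polybox x e).
Proof.
rewrite openE => y xy; rewrite /interior.
have H : \forall z \near y, forall j, cmod ((z : 'rV[C]_d) 0 j - x 0 j) < e.
  apply: (@filter_forall _ _ (fun j (z : 'rV[C]_d) => cmod (z 0 j - x 0 j) < e) (nbhs y)) => j.
  have c : (fun z : 'rV[C]_d => cmod (z 0 j - x 0 j)) @ y --> cmod (y 0 j - x 0 j).
    apply: (continuous_comp (f := fun z : 'rV[C]_d => z 0 j - x 0 j)); last exact: continuous_cmod.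
    by apply: (@cvgB C C _ (nbhs y)); [exact: coord_continuous|exact: cvg_cst].
  exact: (cvgr_lt _ c).
exact: H.
Qed.

Lemma polybox_center x (e : R) : 0 < e -> polybox x e x.
Proof. by move=> e0 j; rewrite subrr cmod0. Qed.

(** A polydisc is star-shaped about its centre. *)
Lemma connected_polybox x e : connected (polybox x e).
Proof.
pose seg y : set 'rV[C]_d := (fun t : R => x + t%:C *: (y - x)) @` `[0, 1].
have -> : polybox x e = \bigcup_(y in polybox x e) seg y.
  apply/seteqP; split=> [y xy|z [y xy [t /= t01 <-]] j].
    exists y => //; exists 1 => /=; first by rewrite in_itv /= ler01 lexx.
    by rewrite scale1r subrKC.
  rewrite !mxE addrAC subrr add0r cmodM cmod_real; move: t01; rewrite in_itv /= => /andP[t0 t1].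
  rewrite ger0_norm //; apply: le_lt_trans (xy j).
  by rewrite ler_piMl ?cmod_ge0.
apply: bigcup_connected => [|y xy].
  exists x => y xy; exists 0 => /=; first by rewrite in_itv /= lexx ler01.
  by rewrite scale0r addr0.
apply: connected_continuous_connected; first exact: segment_connected.
apply: continuous_subspaceT => t; apply: cvg_mx => i j; rewrite !mxE.
under eq_fun do rewrite !mxE.
apply: cvgD; first exact: cvg_cst.
by apply: cvgM; [exact: continuous_realC|exact: cvg_cst].
Qed.

Definition gauss (q : 'rV[rat * rat]_d) : 'rV[C]_d :=
  \row_j (ratr (q 0 j).1 +i* ratr (q 0 j).2).

Lemma rat_approx (a e : R) : 0 < e -> exists q : rat, `|a - ratr q| < e.
Proof.
move=> e0; have /rat_in_itvoo[q] : a - e < a + e by lra.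
rewrite in_itv /= => /andP[h1 h2]; exists q; rewrite ltr_norml; apply/andP; split; lra.
Qed.

Lemma gauss_dense x (e : R) : 0 < e -> exists q, polybox x e (gauss q).
Proof.
move=> e0; have e2 : 0 < e / 2 by rewrite divr_gt0.
have /choice[f fP] : forall j, exists q : rat * rat,
    `|complex.Re (x 0 j) - ratr q.1| < e / 2 /\ `|complex.Im (x 0 j) - ratr q.2| < e / 2.
  move=> j; have [a ha] := rat_approx (complex.Re (x 0 j)) e2.
  by have [b hb] := rat_approx (complex.Im (x 0 j)) e2; exists (a, b).
exists (\row_j f j) => j; rewrite !mxE; have [h1 h2] := fP j.
apply: le_lt_trans (cmod_le_sum _) _; rewrite (splitr e) ltrD //.
  by case: (x 0 j) h1 => a b /=; rewrite distrC.
by case: (x 0 j) h2 => a b /=; rewrite distrC.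
Qed.

Lemma second_countable_rV : @second_countable 'rV[C]_d.
Proof.
pose B (p : 'rV[rat * rat]_d * nat) := polybox (gauss p.1) p.2.+1%:R^-1.
exists (range B).
  exact: (@card_le_trans _ _ _ [set: 'rV[rat * rat]_d * nat] _ _ (card_image_le _ _) (countableP _)).
split=> [_ [p _ <-]|x A /nbhs_polybox[e e0 xA]]; first exact: open_polybox.
have e2 : 0 < e / 2 by rewrite divr_gt0.
pose k := Num.truncn (e / 2)^-1.
have ke : k.+1%:R^-1 < e / 2.
  rewrite invf_plt ?posrE //; exact: truncnS_gt.
have k0 : 0 < k.+1%:R^-1 :> R by rewrite invr_gt0.
have [q xq] := gauss_dense x k0.
exists (B (q, k)); last first.
  move=> y yq; apply: xA => j.
  rewrite (_ : y 0 j - x 0 j = (y 0 j - gauss q 0 j) + (gauss q 0 j - x 0 j)); last by ring.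
  apply: le_lt_trans (cmodD _ _) _; rewrite (splitr e) ltrD //.
    exact: lt_trans (yq j) ke.
  exact: lt_trans (xq j) ke.
split; first by exists (q, k).
by move=> j /=; rewrite -cmodN opprB; exact: xq.
Qed.

Lemma compact_polycbox (r : R) : compact [set x : 'rV[C]_d | forall j, cbox r (x 0 j)].
Proof.
exact: (@rV_compact _ _ (fun=> cbox r) (fun=> @compact_cbox R r)).
Qed.

End Polyboxes.

(** * Quotients presented by open subsets of affine space *)
Lemma nbhs_set_type {X : topologicalType} (A : set X) (x : set_type A) (V : set (set_type A)) :
  nbhs x V <-> exists2 W, nbhs (set_val x) W & set_val @^-1` W `<=` V.
Proof.
split=> [[_ /= [] [W oW <- /= Wx WV]]|[W Wx WV]].
  by exists W => //; exact: open_nbhs_nbhs.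
move: Wx; rewrite nbhsE => -[ O [oO Ox] OW].
exists (set_val @^-1` O); split => //=; first by exists O.
by move=> y /OW /WV.
Qed.

Lemma near_cont {X Y : topologicalType} (f : X -> Y) (x : X) (W : set Y) :
  {for x, continuous f} -> nbhs (f x) W -> \forall y \near x, W (f y).
Proof. by move=> cf; exact: cf. Qed.

Lemma near_all {X : topologicalType} (x : X) (P : X -> Prop) :
  (forall y, P y) -> \forall y \near x, P y.
Proof. by move=> h; exact: nearW. Qed.

Lemma open_in2 {X : topologicalType} (x : X) (V W : set X) : nbhs x V -> nbhs x W ->
  exists B, [/\ open B, B x, B `<=` V & B `<=` W].
Proof.
move=> xV xW; have : nbhs x (V `&` W) by exact: filterI.
by rewrite nbhsE => -[B [oB Bx] BV]; exists B; split=> // z /BV[].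
Qed.

Lemma near_image {X Y : topologicalType} (f : X -> Y) (y : Y) (V : set X) (W : set Y) :
  nbhs y (f @` V) -> (forall z, V z -> W (f z)) -> nbhs y W.
Proof. by move=> h VW; apply: filterS h => _ [z Vz <-]; exact: VW. Qed.

Lemma contP {X Y : topologicalType} (f : X -> Y) (x : X) :
  (forall W, nbhs (f x) W -> \forall y \near x, W (f y)) -> {for x, continuous f}.
Proof. by []. Qed.

Lemma set_val_continuous {X : topologicalType} (A : set X) :
  continuous (set_val : set_type A -> X).
Proof. by move=> x V xV; apply/nbhs_set_type; exists V. Qed.

Lemma set_val_insubd {X : Type} (A : set X) (a0 : set_type A) x :
  A x -> set_val (insubd a0 x) = x.
Proof. by move=> Ax; rewrite set_valE insubdK //; exact: mem_set. Qed.

Lemma insubd_set_val {X : Type} (A : set X) (a0 x : set_type A) : insubd a0 (set_val x) = x.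
Proof. by rewrite set_valE valKd. Qed.

Section KerQuot.
Context {X : topologicalType} {T : Type} (f : X -> T).

Lemma ker_piP (x y : X) : ker_pi f x = ker_pi f y <-> f x = f y.
Proof.
split=> [/eqmodP /= /asboolP//|fxy].
by apply/eqmodP => /=; apply/asboolP.
Qed.

Lemma ker_reprK (y : ker_quot f) : ker_pi f (ker_repr y) = y.
Proof. exact: reprK. Qed.

Lemma f_ker_repr (x : X) : f (ker_repr (ker_pi f x)) = f x.
Proof. by apply/ker_piP; rewrite ker_reprK. Qed.

Lemma ker_pi_continuous : continuous (ker_pi f).
Proof. exact: pi_continuous. Qed.

Lemma ker_open (W : set (ker_quot f)) : open (ker_pi f @^-1` W) -> open W.
Proof. by []. Qed.

End KerQuot.

Section Presentation.
Context {R : realType}.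
Local Notation C := (Cx R).

Lemma hol_affine_eq d (x : affine R d) (f g : affine R d -> C) :
  (\forall y \near x, f y = g y) -> hol_at x f -> hol_at x g.
Proof.
move=> fg; rewrite /hol_at /=; move/nbhs_interior: fg => fg.
by apply: filterS2 fg => y; exact: differentiable_near_eq.
Qed.

Lemma hol_affine_interior d (x : affine R d) (f : affine R d -> C) :
  hol_at x f -> \forall y \near x, hol_at y f.
Proof. by move=> h; exact: (nbhs_interior h). Qed.

Lemma near_differentiable_comp d e (x : 'rV[C]_d) (h : 'rV[C]_d -> 'rV[C]_e)
    (f : 'rV[C]_e -> C^o) :
  (\forall y \near x, differentiable h y) -> (\forall y \near h x, differentiable f y) ->
  \forall y \near x, differentiable (f \o h) y.
Proof.
move=> dh hf.
have ch : {for x, continuous h} := differentiable_continuous (nbhs_singleton dh).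
have hf' : \forall y \near x, differentiable f (h y) by exact: (ch _ hf).
by apply: filterS2 dh hf' => y dy dfy; exact: differentiable_comp.
Qed.

Lemma hol_affine_comp d e (x : affine R d) (h : affine R d -> affine R e) (f : affine R e -> C) :
  (\forall y \near x, differentiable (h : 'rV[C]_d -> 'rV[C]_e) y) ->
  hol_at (h x) f -> hol_at x (f \o h).
Proof. by move=> dh hf; exact: (near_differentiable_comp dh hf). Qed.

(** An open map onto [P] from an open subset [A] of an affine space, for which a
    function on [P] is holomorphic exactly when its pullback is. *)
Record presents (P : fspace R) (D : nat) (A : set (affine R D)) (q : affine R D -> P) : Prop :=
 Presents {
  pres_open : open A ;
  pres_cont : forall x, A x -> {for x, continuous q} ;
  pres_nbhs : forall x V, A x -> nbhs x V -> nbhs (q x) (q @` V) ;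
  pres_surj : forall y, exists2 x, A x & q x = y ;
  pres_hol : forall x g, A x -> hol_at (q x) g <-> hol_at x (g \o q) }.

Lemma presents_affine D : @presents (affine R D) D setT id.
Proof.
split; first exact: openT.
- by move=> x _; exact: cvg_id.
- by move=> x V _; rewrite image_id.
- by move=> y; exists y.
- by move=> x g _.
Qed.

Lemma pres_near_dom (P : fspace R) D (A : set (affine R D)) (q : affine R D -> P) x :
  presents A q -> A x -> \forall y \near x, A y.
Proof. by move=> pr Ax; apply: open_nbhs_nbhs; split=> //; exact: pres_open pr. Qed.

Lemma presents_open_sub (P : fspace R) D (A : set (affine R D)) (q : affine R D -> P) (U : set P)
    (u0 : set_type U) : presents A q -> open U ->
  @presents (fsub U) D (A `&` q @^-1` U) (fun x => insubd u0 (q x)).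
Proof.
move=> pr oU.
have near_U x : A x -> U (q x) -> \forall y \near x, U (q y).
  by move=> Ax Ux; apply: (pres_cont pr Ax); exact: open_nbhs_nbhs.
split=> [|x [Ax Ux]|x V [Ax Ux] xV|y|x g [Ax Ux]].
- rewrite openE => x [Ax Ux]; apply: filterI (near_U x Ax Ux).
  exact: (pres_near_dom pr).
- apply: contP => V /nbhs_set_type[W]; rewrite set_val_insubd // => Wx WV.
  apply: filterS2 (near_cont (pres_cont pr Ax) Wx) (near_U x Ax Ux) => y Wy Uy.
  by apply: WV; rewrite /= set_val_insubd.
- apply/nbhs_set_type; rewrite set_val_insubd //.
  exists (q @` V); first exact: (pres_nbhs pr Ax xV).
  by move=> u /= [y Vy yu]; exists y => //; rewrite yu insubd_set_val.
- have [x Ax xy] := pres_surj pr (set_val y).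
  exists x; last by rewrite xy insubd_set_val.
  by split=> //; rewrite /= xy; exact: set_valP.
- split=> [[g' [hg' gg']]|hg].
    rewrite set_val_insubd // in hg'; have : hol_at x (g' \o q) by apply/(pres_hol pr).
    apply: hol_affine_eq; move/nbhs_set_type: gg' => [W]; rewrite set_val_insubd // => Wx WV.
    apply: filterS2 (near_cont (pres_cont pr Ax) Wx) (near_U x Ax Ux) => y Wy Uy /=.
    have /= := WV (insubd u0 (q y)); rewrite set_val_insubd // => -> //.
  exists (g \o insubd u0); split; last first.
    by apply: near_all => y; rewrite /= insubd_set_val.
  by rewrite set_val_insubd //; apply/(pres_hol pr).
Qed.

(** Identifications given by maps that are locally holomorphic and compatible with
    [f]: then the quotient map is open, since saturations of open sets are open, and
    holomorphy at one point of a fibre is transported to the others. *)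
Lemma presents_quot (P : fspace R) D (A : set (affine R D)) (q : affine R D -> P) (T : Type) (f : P -> T) :
  presents A q ->
  (forall x x', A x -> A x' -> f (q x) = f (q x') ->
     exists gam : affine R D -> affine R D, gam x = x' /\
       \forall y \near x, [/\ A (gam y), f (q (gam y)) = f (q y)
                           & differentiable (gam : 'rV[C]_D -> 'rV[C]_D) y]) ->
  @presents (fquot f) D A (ker_pi f \o q).
Proof.
move=> pr loc.
have opn x V : A x -> nbhs x V -> nbhs (ker_pi f (q x)) ((ker_pi f \o q) @` V).
  move=> Ax xV.
  have [B [oB Bx BV BA]] := open_in2 xV (pres_near_dom pr Ax).
  have oW : open ((ker_pi f \o q) @` B).
    apply: ker_open; rewrite openE => p /= [y By /= fyp].
    have [x' Ax' ex'] := pres_surj pr p.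
    have Ay : A y by exact: BA.
    have efy : f (q x') = f (q y) by apply/(ker_piP f); rewrite ex' fyp.
    have [gam [gx' Hg]] := loc x' y Ax' Ay efy.
    have cg : {for x', continuous gam}.
      by have [_ _] := nbhs_singleton Hg; exact: differentiable_continuous.
    have NO : \forall z \near x', B (gam z).
      by apply: (near_cont cg); rewrite gx'; exact: open_nbhs_nbhs.
    have [B' [oB' Bx' B'1 B'2]] := open_in2 NO Hg; rewrite -ex' /interior.
    apply: (near_image (pres_nbhs pr Ax' (open_nbhs_nbhs (conj oB' Bx')))) => z B'z.
    have [_ efz _] := B'2 _ B'z.
    by exists (gam z); [exact: B'1|apply/ker_piP].
  have W : nbhs (ker_pi f (q x)) ((ker_pi f \o q) @` B).
    by apply: open_nbhs_nbhs; split=> //; exists x.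
  by apply: (near_image W) => y By; exists y => //; exact: BV.
split=> //.
- exact: pres_open pr.
- move=> x Ax; apply: continuous_comp; first exact: pres_cont pr _ Ax.
  exact: ker_pi_continuous.
- move=> y; have [x Ax xy] := pres_surj pr (ker_repr y).
  by exists x => //=; rewrite xy ker_reprK.
- move=> x g Ax; split=> [/nbhs_singleton /(_ _ erefl)|hg].
    by move/(pres_hol pr); apply.
  have [B [oB Bx Bh BA]] := open_in2 (hol_affine_interior hg) (pres_near_dom pr Ax).
  apply: (near_image (opn x B Ax (open_nbhs_nbhs (conj oB Bx)))) => x1 Bx1 v ev.
  have Ax1 := BA _ Bx1; have h1 := Bh _ Bx1.
  have [x' Ax' ex'] := pres_surj pr v; rewrite -ex'; apply: (proj2 (pres_hol pr _ Ax')).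
  have efy : f (q x') = f (q x1) by apply/(ker_piP f); rewrite ex' ev.
  have [gam [gx' Hg]] := loc x' x1 Ax' Ax1 efy.
  have h2 : hol_at x' ((g \o (ker_pi f \o q)) \o gam).
    apply: hol_affine_comp; last by rewrite gx'.
    by apply: filterS Hg => z [].
  apply: hol_affine_eq h2; apply: filterS Hg => z [_ efz _] /=.
  by congr g; apply/ker_piP.
Qed.

Section Consequences.
Context {P : fspace R} {D : nat} (A : set (affine R D)) (q : affine R D -> P).
Hypothesis pr : presents A q.

Lemma pres_continuous (Z : topologicalType) (h : P -> Z) :
  (forall x, A x -> {for x, continuous (h \o q)}) -> continuous h.
Proof.
move=> ch y; have [x Ax <-] := pres_surj pr y => V hV.
by apply: (near_image (pres_nbhs pr Ax (near_cont (ch x Ax) hV))).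
Qed.

(** As the map is open, it suffices to separate non-identified points upstairs by
    neighbourhoods without identifications between them. *)
Lemma pres_hausdorff :
  (forall x y, A x -> A y -> q x <> q y -> exists V W,
     [/\ nbhs x V, nbhs y W & forall x' y', A x' -> A y' -> V x' -> W y' -> q x' <> q y']) ->
  hausdorff_space P.
Proof.
move=> sep p p' cl; apply: contrapT => npp'.
have [x Ax ex] := pres_surj pr p; have [y Ay ey] := pres_surj pr p'.
have [|V [W [xV yW VW]]] := sep x y Ax Ay; first by rewrite ex ey.
have [B [oB Bx BV BA]] := open_in2 xV (pres_near_dom pr Ax).
have [B' [oB' By BW BA']] := open_in2 yW (pres_near_dom pr Ay).
have N1 : nbhs p (q @` B) by rewrite -ex; apply: (pres_nbhs pr Ax); exact: open_nbhs_nbhs.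
have N2 : nbhs p' (q @` B') by rewrite -ey; apply: (pres_nbhs pr Ay); exact: open_nbhs_nbhs.
have [_ [[x' Bx' <-] [y' By' e]]] := cl _ _ N1 N2.
exact: (VW x' y' (BA _ Bx') (BA' _ By') (BV _ Bx') (BW _ By') (esym e)).
Qed.

(** Images of the basic open sets contained in [A]. *)
Lemma pres_second_countable : @second_countable P.
Proof.
have [Bs cB [oBs bB]] := @second_countable_rV R D.
exists ((fun V => q @` V) @` (Bs `&` [set V | V `<=` A])).
  apply: card_le_trans (card_image_le _ _) _.
  by apply: sub_countable cB; apply: subset_card_le => V [].
split=> [_ [V [BV VA] <-]|p].
  rewrite openE => _ [x Vx <-]; apply: (pres_nbhs pr (VA _ Vx)).
  by apply: open_nbhs_nbhs; split=> //; exact: oBs.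
have [x Ax <-] := pres_surj pr p => W hW.
have N := near_cont (pres_cont pr Ax) hW.
have [B [oB Bx BW BA]] := open_in2 N (pres_near_dom pr Ax).
have [V [BV Vx] VB] := bB x B (open_nbhs_nbhs (conj oB Bx)).
exists (q @` V); last by move=> _ [z Vz <-]; exact/BW/VB.
split; last by exists x.
by exists V => //; split=> // z /VB/BA.
Qed.

Lemma pres_compact (K : set (affine R D)) : compact K -> K `<=` A -> compact (q @` K).
Proof.
move=> cK KA; apply: continuous_compact => //.
by apply: continuous_in_subspaceT => x /set_mem Kx; apply: (pres_cont pr); exact: KA.
Qed.

(** A slice [s] that meets each class at most once, together with local holomorphic
    maps [sig] that push nearby points onto it along their classes, parametrises an
    open set of the quotient. *)
Lemma chart_of_slice d (Dm : set (affine R d)) (s : affine R d -> affine R D)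
    (sig : forall e : affine R d, affine R D -> affine R d) (phi0 : affine R d) :
  open Dm -> (forall e, Dm e -> A (s e)) ->
  (forall e, Dm e -> differentiable (s : 'rV[C]_d -> 'rV[C]_D) e) ->
  (forall e, Dm e -> sig e (s e) = e /\ \forall x \near s e,
     differentiable (sig e : 'rV[C]_D -> 'rV[C]_d) x /\ q (s (sig e x)) = q x) ->
  (forall e e', Dm e -> Dm e' -> q (s e) = q (s e') -> e = e') ->
  exists phi : P -> affine R d,
    is_chart ((q \o s) @` Dm) phi (q \o s) /\ (forall e, Dm e -> phi (q (s e)) = e).
Proof.
move=> oD sA ds sigP inj.
(* The inverse of the parametrisation; [phi0] is its value off the image. *)
pose phi y := xget phi0 [set e | Dm e /\ q (s e) = y].
have phiP e : Dm e -> phi (q (s e)) = e.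
  move=> De; rewrite /phi; case: xgetP => [e' _ [De' /= qe]|/(_ e)]; last by case.
  exact: inj.
have cs e : Dm e -> {for e, continuous s} by move=> De; exact: differentiable_continuous (ds e De).
have csig e : Dm e -> {for s e, continuous (sig e)}.
  by move=> De; have [_ /nbhs_singleton[+ _]] := sigP e De; exact: differentiable_continuous.
have nD e : Dm e -> \forall x \near s e, Dm (sig e x).
  move=> De; apply: (near_cont (csig e De)); rewrite (sigP e De).1.
  exact: open_nbhs_nbhs.
exists phi; split => //; split.
- rewrite openE => _ [e De <-] /=; rewrite /interior.
  have [B [oB Bx B1 B2]] := open_in2 (nD e De) (sigP e De).2.
  have N := pres_nbhs pr (sA e De) (open_nbhs_nbhs (conj oB Bx)).
  apply: (near_image N) => x Bx'; exists (sig e x); first exact: B1.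
  by have [_] := B2 x Bx'.
- rewrite (_ : phi @` _ = Dm) //; apply/seteqP; split=> [_ [_ [e De <-] <-] /=|e De].
    by rewrite phiP.
  by exists (q (s e)); [exists e|rewrite phiP].
- by move=> _ [e De <-] /=; rewrite phiP.
- move=> _ [e De <-] /=; split.
    apply: contP => V; rewrite phiP // => eV.
    have N0 : nbhs (s e) (fun x => V (sig e x)).
      by apply: (near_cont (csig e De)); rewrite (sigP e De).1.
    have [B [oB Bx B1 B2]] := open_in2 N0 (nD e De).
    have [B' [oB' Bx' B1' B2']] := open_in2 (open_nbhs_nbhs (conj oB Bx)) (sigP e De).2.
    have N := pres_nbhs pr (sA e De) (open_nbhs_nbhs (conj oB' Bx')).
    apply: (near_image N) => x B'x; have [_ <-] := B2' _ B'x.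
    by rewrite phiP; [apply: B1; exact: B1'|apply: B2; exact: B1'].
  rewrite phiP //; apply: continuous_comp; first exact: cs.
  exact: (pres_cont pr (sA e De)).
- move=> _ f [e De <-] /=; rewrite phiP //.
  have Ae := sA e De; split.
    move/(proj1 (pres_hol pr f Ae)) => h.
    apply: (@hol_affine_comp _ _ e s (f \o q)); last exact: h.
    have N : \forall z \near e, Dm z by apply: open_nbhs_nbhs.
    by apply: filterS N => z /ds.
  move=> h; apply: (proj2 (pres_hol pr f Ae)).
  have h1 : hol_at (s e) ((f \o (q \o s)) \o sig e).
    apply: hol_affine_comp; last by rewrite (sigP e De).1.
    by apply: filterS (sigP e De).2 => x [].
  apply: hol_affine_eq h1; apply: filterS (sigP e De).2 => x [_ qe] /=.
  by rewrite qe.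
Qed.

End Consequences.

(** Each map sends the class of a point on one side to its class on the other side. *)
Lemma biholomorphic_presents (P P' : fspace R) D (A : set (affine R D))
    (q : affine R D -> P) (q' : affine R D -> P') :
  presents A q -> presents A q' ->
  (forall x y, A x -> A y -> q x = q y <-> q' x = q' y) -> biholomorphic P P'.
Proof.
have key (P1 P2 : fspace R) (q1 : affine R D -> P1) (q2 : affine R D -> P2)
    (h : P1 -> P2) : presents A q1 -> presents A q2 ->
    (forall x, A x -> h (q1 x) = q2 x) -> holomorphic h.
  move=> p1 p2 hq; split.
    apply: (pres_continuous p1) => x Ax; apply: contP => V; rewrite /= hq // => xV.
    have [B [oB Bx B1 B2]] := open_in2 (near_cont (pres_cont p2 Ax) xV) (pres_near_dom p1 Ax).
    apply: filterS (open_nbhs_nbhs (conj oB Bx)) => y By.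
    by rewrite /= hq; [exact: B1|exact: B2].
  move=> y g; have [x Ax <-] := pres_surj p1 y; rewrite hq // => /(proj1 (pres_hol p2 g Ax)) h1.
  apply: (proj2 (pres_hol p1 _ Ax)); apply: hol_affine_eq h1.
  by apply: filterS (pres_near_dom p1 Ax) => z Az /=; rewrite hq.
move=> p1 p2 ker.
have /choice[s1 s1P] : forall y : P, exists x, A x /\ q x = y.
  by move=> y; have [x Ax <-] := pres_surj p1 y; exists x.
have /choice[s2 s2P] : forall y : P', exists x, A x /\ q' x = y.
  by move=> y; have [x Ax <-] := pres_surj p2 y; exists x.
have e1 x : A x -> q' (s1 (q x)) = q' x.
  by move=> Ax; have [As es] := s1P (q x); apply/(ker _ _ As Ax).
have e2 x : A x -> q (s2 (q' x)) = q x.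
  by move=> Ax; have [As es] := s2P (q' x); apply/(ker _ _ As Ax).
exists (fun y => q' (s1 y)), (fun y => q (s2 y)); split.
- by move=> y; have [As <-] := s1P y; rewrite e1 // e2.
- by move=> y; have [As <-] := s2P y; rewrite e2 // e1.
- by apply: (key _ _ q q').
- by apply: (key _ _ q' q).
Qed.

End Presentation.

(** * Projective space *)
Lemma differentiable_mulmxr {K : numFieldType} p q (M : 'M[K]_(p, q)) (x : 'rV[K]_p) :
  differentiable (fun y : 'rV[K]_p => y *m M) x.
Proof.
apply: (@differentiable_row K 'rV[K]_p) => j; under eq_fun do rewrite mxE.
apply: (@differentiable_bigsum K 'rV[K]_p) => i _.
apply: (@differentiableM K 'rV[K]_p (fun y => y 0 i)); first exact: differentiable_coord.
exact: differentiable_cst.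
Qed.

Section Projective.
Context {R : realType} {n : nat}.
Local Notation C := (Cx R).
Implicit Types (x y : 'rV[C]_n.+1) (d : 'I_n.+1 -> C).

Definition pscale d x : 'rV[C]_n.+1 := \row_i (d i * x 0 i).

Lemma pscaleE d x i : pscale d x 0 i = d i * x 0 i.
Proof. by rewrite mxE. Qed.

Lemma pscale_differentiable d x : differentiable (pscale d) x.
Proof.
apply: (@differentiable_row C 'rV[C]_n.+1) => j; under eq_fun do rewrite mxE.
apply: (@differentiableM C 'rV[C]_n.+1 (cst (d j))); first exact: differentiable_cst.
exact: differentiable_coord.
Qed.

Lemma pscale_neq0 d x : (forall i, d i != 0) -> x != 0 -> pscale d x != 0.
Proof.
move=> d0; apply: contra_neq => h; apply/rowP => i; rewrite mxE.
by move/rowP: h => /(_ i); rewrite !mxE => /eqP; rewrite mulf_eq0 (negbTE (d0 i)) => /eqP.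
Qed.

Lemma open_coord_neq0 i : open [set x : 'rV[C]_n.+1 | x 0 i != 0].
Proof.
rewrite openE => x /= xi; rewrite /interior.
exact: (cvgr_neq0 _ (@coord_continuous C 1 n.+1 0 i x) xi).
Qed.

Lemma nonzero_ex x : x != 0 <-> exists i, x 0 i != 0.
Proof.
split=> [x0|[i xi]]; last by apply: contraNneq xi => ->; rewrite mxE.
apply/existsP; apply: contraNT x0; rewrite negb_exists => /forallP h.
by apply/eqP/rowP => i; rewrite mxE; apply/eqP; have := h i; rewrite negbK.
Qed.

Lemma open_nonzero : open (nonzero R n).
Proof.
have -> : nonzero R n = \bigcup_i [set x : affine R n.+1 | (x : 'rV[C]_n.+1) 0 i != 0].
  apply/seteqP; split=> x; first by move/nonzero_ex => [i xi]; exists i.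
  by move=> [i _ xi]; apply/nonzero_ex; exists i.
by apply: bigcup_open => i _; exact: open_coord_neq0.
Qed.

Lemma ones_nonzero : nonzero R n (const_mx 1 : 'rV[C]_n.+1).
Proof. by apply/nonzero_ex; exists ord0; rewrite mxE oner_eq0. Qed.

Definition ones_pt : set_type (nonzero R n) := exist (fun x => x \in nonzero R n) _ (mem_set ones_nonzero).

(** Homogeneous coordinates as a map from the affine space.  The zero vector is sent
    to the point with all coordinates equal to 1. *)
Definition qP : affine R n.+1 -> projective R n :=
  ker_pi (@line R n) \o insubd ones_pt.

Lemma lineP (u v : fsub (nonzero R n)) : line u = line v <->
  exists2 c : C, c != 0 & (set_val v : 'rV[C]_n.+1) = c *: (set_val u : 'rV[C]_n.+1).
Proof.
split=> [luv|[c c0 vu]].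
  have : line v (set_val v) by exists 1 => /=; rewrite ?oner_eq0 ?scale1r.
  by rewrite -luv => -[c /= c0 <-]; exists c.
apply/seteqP; split=> _ [b /= b0 <-].
  by exists (b / c); rewrite /= ?mulf_neq0 ?invr_eq0 // vu scalerA divfK.
by exists (b * c); rewrite /= ?mulf_neq0 // vu scalerA.
Qed.

Lemma line_insubd x y : x != 0 -> y != 0 ->
  line (insubd ones_pt x : fsub (nonzero R n)) = line (insubd ones_pt y : fsub (nonzero R n))
  <-> exists2 c : C, c != 0 & y = c *: x.
Proof.
move=> x0 y0; have ex := @set_val_insubd _ (nonzero R n) ones_pt x x0.
have ey := @set_val_insubd _ (nonzero R n) ones_pt y y0.
split=> [/lineP[c c0 e]|[c c0 e]].
  by exists c => //; rewrite -ex -ey.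
by apply/lineP; exists c => //; rewrite ex ey.
Qed.

Lemma presents_projective : presents (nonzero R n) qP.
Proof.
have := presents_open_sub ones_pt (presents_affine (R := R) (n.+1)) open_nonzero.
have -> : [set: affine R n.+1] `&` id @^-1` nonzero R n = nonzero R n by rewrite setTI.
move=> pr; apply: (presents_quot (f := @line R n) pr) => x x' Ax Ax'.
move/(line_insubd Ax Ax') => [c c0 e]; exists (fun y : 'rV[C]_n.+1 => c *: y).
split; first by rewrite e.
have N : \forall y \near (x : affine R n.+1), nonzero R n y.
  by apply: open_nbhs_nbhs; split=> //; exact: open_nonzero.
apply: filterS N => y y0.
have cy0 : nonzero R n (c *: (y : 'rV[C]_n.+1)) by rewrite /nonzero /= scaler_eq0 negb_or c0.
split => //.
by apply/line_insubd => //; exists c^-1; rewrite ?invr_eq0 // scalerA mulVf // scale1r.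
Qed.

Lemma qP_eq x y : x != 0 -> y != 0 ->
  qP x = qP y <-> exists2 c : C, c != 0 & y = c *: x.
Proof.
by move=> x0 y0; rewrite -(line_insubd x0 y0); exact: ker_piP.
Qed.

Lemma hcoord_neq0 (p : projective R n) : hcoord p != 0.
Proof. exact: (set_valP (hcoord_ p)). Qed.

Lemma qP_hcoord (p : projective R n) : qP (hcoord p) = p.
Proof. by rewrite /qP /= /hcoord insubd_set_val /hcoord_ ker_reprK. Qed.

Lemma hcoord_qP x : x != 0 -> exists2 c : C, c != 0 & hcoord (qP x) = c *: x.
Proof. by move=> x0; apply/qP_eq; rewrite ?hcoord_neq0 ?qP_hcoord. Qed.

Lemma diag_act_qP d x : (forall i, d i != 0) -> x != 0 ->
  diag_act d (qP x) = qP (pscale d x).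
Proof.
move=> d0 x0; have [c c0 hx] := hcoord_qP x0.
have E : pscale d (hcoord (qP x)) = c *: pscale d x.
  by apply/rowP => i; rewrite hx !mxE mulrCA.
have n0 := pscale_neq0 d0 x0.
have n1 : pscale d (hcoord (qP x)) != 0 by rewrite pscale_neq0 // hcoord_neq0.
apply: (proj2 (ker_piP (@line R n) _ _)); apply: (proj2 (lineP _ _)).
have e1 := @set_val_insubd _ (nonzero R n) (hcoord_ (qP x)) _ n1.
have e2 := @set_val_insubd _ (nonzero R n) ones_pt _ n0.
by exists c^-1; rewrite ?invr_eq0 // e1 e2 E scalerA mulVf // scale1r.
Qed.

Lemma diag_act_scale (s : C) d p : s != 0 -> (forall i, d i != 0) ->
  diag_act (fun i => s * d i) p = diag_act d p.
Proof.
move=> s0 d0; rewrite -(qP_hcoord p) !diag_act_qP ?hcoord_neq0 //; last first.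
  by move=> i; rewrite mulf_neq0.
have sd0 i : s * d i != 0 by rewrite mulf_neq0.
apply/qP_eq; rewrite ?pscale_neq0 ?hcoord_neq0 //.
exists s^-1; first by rewrite invr_eq0.
by apply/rowP => i; rewrite !mxE !mulrA mulVf // mul1r.
Qed.

(** Distinct lines are separated by a nonzero 2 by 2 minor, a condition that is open
    and invariant under scaling. *)
Lemma projective_hausdorff : hausdorff_space (projective R n).
Proof.
apply: (pres_hausdorff presents_projective) => x y x0 y0 nxy.
have [i [j ij]] : exists i j, (x : 'rV[C]_n.+1) 0 i * (y : 'rV[C]_n.+1) 0 j !=
    (x : 'rV[C]_n.+1) 0 j * (y : 'rV[C]_n.+1) 0 i.
  apply: contrapT => h; apply: nxy; apply/qP_eq => //.
  have [i xi] : exists i, (x : 'rV[C]_n.+1) 0 i != 0 by apply/nonzero_ex.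
  have E j : (y : 'rV[C]_n.+1) 0 j = (y : 'rV[C]_n.+1) 0 i / (x : 'rV[C]_n.+1) 0 i
       * (x : 'rV[C]_n.+1) 0 j.
    apply: (mulfI xi); rewrite [RHS]mulrA [X in _ = X * _]mulrC divfK // [RHS]mulrC.
    by apply/eqP; apply: contrapT => /negP nij; apply: h; exists i, j.
  exists ((y : 'rV[C]_n.+1) 0 i / (x : 'rV[C]_n.+1) 0 i).
    apply: contraNneq y0 => e; apply/eqP/rowP => j; by rewrite E e mul0r mxE.
  by apply/rowP => j; rewrite E mxE.
pose G (p : 'rV[C]_n.+1 * 'rV[C]_n.+1) := p.1 0 i * p.2 0 j - p.1 0 j * p.2 0 i.
have cG : G z @[z --> ((x : 'rV[C]_n.+1), (y : 'rV[C]_n.+1))] --> G (x, y).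
  apply: (@cvgB C C _ (nbhs ((x : 'rV[C]_n.+1), (y : 'rV[C]_n.+1)))).
    apply: (@cvgM C _ (nbhs ((x : 'rV[C]_n.+1), (y : 'rV[C]_n.+1)))); apply: cvg_coord.
      exact: cvg_fst.
    exact: cvg_snd.
  apply: (@cvgM C _ (nbhs ((x : 'rV[C]_n.+1), (y : 'rV[C]_n.+1)))); apply: cvg_coord.
    exact: cvg_fst.
  exact: cvg_snd.
have G0 : G (x, y) != 0 by rewrite subr_eq0.
have [[V W] /= [xV yW] VW] : nbhs ((x : 'rV[C]_n.+1), (y : 'rV[C]_n.+1)) (fun z => G z != 0).
  exact: (cvgr_neq0 _ cG G0).
exists V, W; split => // x' y' Ax' Ay' Vx' Wy' e.
have := VW (x', y') (conj Vx' Wy').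
have /qP_eq := e; move=> /(_ Ax' Ay') [c _ ->]; rewrite /G /= !mxE.
by rewrite mulrCA subr_eq0 [X in _ != X]mulrCA [X in c * X]mulrC eqxx.
Qed.

End Projective.

(** * The LVMB action *)
Section DiagonalActions.
Context {R : realType} {n : nat}.
Local Notation C := (Cx R).

Lemma diag_act1 (p : projective R n) : diag_act (fun=> 1) p = p.
Proof.
have d1 (i : 'I_n.+1) : (1 : C) != 0 by exact: oner_neq0.
rewrite -(qP_hcoord p) diag_act_qP ?hcoord_neq0 //.
by congr qP; apply/rowP => i; rewrite mxE mul1r.
Qed.

Lemma diag_act_ext (d e : 'I_n.+1 -> C) (p : projective R n) :
  (forall i, d i = e i) -> diag_act d p = diag_act e p.
Proof. by move=> de; rewrite (_ : d = e) //; exact/funext. Qed.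

Lemma diag_act_id (d : 'I_n.+1 -> C) (p : projective R n) :
  (forall i, d i = 1) -> diag_act d p = p.
Proof. by move=> d1; rewrite (diag_act_ext (e := fun=> 1)) ?diag_act1. Qed.

Lemma diag_act_comp (d e : 'I_n.+1 -> C) (p : projective R n) :
  (forall i, d i != 0) -> (forall i, e i != 0) ->
  diag_act d (diag_act e p) = diag_act (fun i => d i * e i) p.
Proof.
move=> d0 e0; have de0 i : d i * e i != 0 by rewrite mulf_neq0.
rewrite -(qP_hcoord p) !diag_act_qP ?hcoord_neq0 ?pscale_neq0 ?hcoord_neq0 //.
by congr qP; apply/rowP => i; rewrite !mxE mulrA.
Qed.

(** The operations are given on the ambient type of parameters, and only their
    restriction to [H] needs to be a group. *)
Lemma orbit_eqP {Par : topologicalType} (H : set Par) (act : Par -> projective R n -> projective R n)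
    (one : Par) (mul : Par -> Par -> Par) (inv : Par -> Par) :
  H one -> (forall g h, H g -> H h -> H (mul g h)) -> (forall g, H g -> H (inv g)) ->
  (forall p, act one p = p) ->
  (forall g h p, H g -> H h -> act (mul g h) p = act g (act h p)) ->
  (forall g p, H g -> act (inv g) (act g p) = p) ->
  forall p p', Defs.orbit H act p = Defs.orbit H act p' <-> exists2 h, H h & p' = act h p.
Proof.
move=> H1 HM HV a1 aM aV p p'; split=> [e|[h Hh ->]].
  have : Defs.orbit H act p' p' by exists one.
  by rewrite -e => -[h Hh <-]; exists h.
apply/seteqP; split=> _ [g Hg <-].
  exists (mul g (inv h)); first by apply: HM => //; exact: HV.
  by rewrite aM ?aV //; exact: HV.
by exists (mul g h); [exact: HM|rewrite aM].
Qed.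

End DiagonalActions.

Section LVMBPresentation.
Context {R : realType} {m n : nat}.
Local Notation C := (Cx R).
Variables (L : 'I_n.+1 -> 'rV[C]_m) (E : {set {set 'I_n.+1}}).
Hypothesis E_ne : exists A, A \in E.
Hypothesis E_set : forall A, A \in E -> exists i, i \in A.

(** The cone over the LVMB open set. *)
Definition supp_open : set (affine R n.+1) :=
  [set x : 'rV[C]_n.+1 | exists2 A, A \in E & forall i, i \in A -> x 0 i != 0].

Lemma supp_open_neq0 (x : 'rV[C]_n.+1) : supp_open x -> x != 0.
Proof.
by move=> [A AE xA]; have [i iA] := E_set AE; apply/nonzero_ex; exists i; exact: xA.
Qed.

Lemma LVMB_open_qP (x : 'rV[C]_n.+1) : x != 0 -> LVMB_open E (qP x) <-> supp_open x.
Proof.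
move=> x0; have [c c0 hx] := hcoord_qP x0.
by split=> -[A AE xA]; exists A => // i /xA; rewrite hx mxE mulf_eq0 (negbTE c0).
Qed.

Lemma supp_open_scale d (x : 'rV[C]_n.+1) : (forall i, d i != 0) -> supp_open x ->
  supp_open (pscale d x).
Proof. by move=> d0 [A AE xA]; exists A => // i iA; rewrite mxE mulf_neq0 ?xA. Qed.

Lemma open_supp_open : open supp_open.
Proof.
rewrite openE => x [A AE xA]; rewrite /interior.
have N : \forall y \near (x : 'rV[C]_n.+1), forall i, i \in A -> (y : 'rV[C]_n.+1) 0 i != 0.
  apply: (@filter_forall _ _ (fun i (y : 'rV[C]_n.+1) => i \in A -> y 0 i != 0) (nbhs (x : 'rV[C]_n.+1))) => i.
  have [iA|/negP iA] := boolP (i \in A).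
    have : nbhs (x : 'rV[C]_n.+1) [set y : 'rV[C]_n.+1 | y 0 i != 0].
      by apply: open_nbhs_nbhs; split; [exact: open_coord_neq0|exact: xA].
    by apply: filterS => y ? _.
  by apply: (@filterE _ (nbhs (x : 'rV[C]_n.+1))).
by apply: filterS N => y yA; exists A.
Qed.

Lemma open_LVMB_open : open (LVMB_open E : set (projective R n)).
Proof.
rewrite openE => p; rewrite -(qP_hcoord p) /interior => /(LVMB_open_qP (hcoord_neq0 p)) Up.
have N := pres_nbhs presents_projective (hcoord_neq0 p)
  (open_nbhs_nbhs (conj open_supp_open Up)).
by apply: (near_image N) => x Ux; apply/LVMB_open_qP; rewrite // supp_open_neq0.
Qed.

(** The action of the product of the scalars and C^m on homogeneous coordinates. *)
Definition lvmb_char (c : C) (z : 'rV[C]_m) (i : 'I_n.+1) : C := c * cexp (linform (L i) z).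

Lemma lvmb_char_neq0 c z i : c != 0 -> lvmb_char c z i != 0.
Proof. by move=> c0; rewrite mulf_neq0 ?cexp_neq0. Qed.

Lemma linformD l (z w : 'rV[C]_m) : linform l (z + w) = linform l z + linform l w.
Proof. by rewrite -big_split; apply: eq_bigr => j _; rewrite mxE mulrDr. Qed.

Lemma linform0 (l : 'rV[C]_m) : linform l 0 = 0.
Proof. by rewrite /linform big1 // => j _; rewrite mxE mulr0. Qed.

Lemma linformN l (z : 'rV[C]_m) : linform l (- z) = - linform l z.
Proof. by rewrite -sumrN; apply: eq_bigr => j _; rewrite mxE mulrN. Qed.

Lemma LVMB_orbitP (p p' : projective R n) :
  Defs.orbit setT (LVMB_act L) p = Defs.orbit setT (LVMB_act L) p' <->
  exists z, p' = LVMB_act L z p.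
Proof.
have D z (i : 'I_n.+1) : cexp (linform (L i) z) != 0 by exact: cexp_neq0.
rewrite (@orbit_eqP R n _ setT (LVMB_act L) 0 +%R -%R) //.
- by split=> [[z _ ->]|[z ->]]; exists z.
- by move=> q; apply: diag_act_id => i; rewrite linform0 cexp0.
- move=> z w q _ _; rewrite /LVMB_act diag_act_comp //; apply: diag_act_ext => i.
  by rewrite linformD cexpD.
- move=> z q _; rewrite /LVMB_act diag_act_comp //; apply: diag_act_id => i.
  by rewrite linformN cexpN mulVf.
Qed.

Lemma presents_LVMB : exists q : affine R n.+1 -> LVMB_manifold L E,
  presents supp_open q /\
  forall x y : 'rV[C]_n.+1, supp_open x -> supp_open y ->
    q x = q y <-> exists c z, c != 0 /\ y = pscale (lvmb_char c z) x.
Proof.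
have Uones : LVMB_open E (qP (const_mx 1) : projective R n).
  apply/LVMB_open_qP; first exact: ones_nonzero.
  have [A AE] := E_ne; exists A => // i _; by rewrite mxE oner_neq0.
pose u0 : set_type (LVMB_open E : set (projective R n)) :=
  exist (fun p => p \in LVMB_open E) _ (mem_set Uones).
have := presents_open_sub u0 presents_projective open_LVMB_open.
have -> : nonzero R n `&` qP @^-1` LVMB_open E = supp_open.
  apply/seteqP; split=> x; first by move=> [x0 /LVMB_open_qP]; exact.
  by move=> Ux; have x0 := supp_open_neq0 Ux; split=> //; apply/LVMB_open_qP.
move=> pr.
pose orb (u : fsub (LVMB_open E)) := Defs.orbit [set: 'rV[C]_m] (LVMB_act L) (set_val u).
have valq (x : 'rV[C]_n.+1) : supp_open x ->
    set_val (insubd u0 (qP x) : fsub (LVMB_open E : set (projective R n))) = qP x.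
  move=> Ux; apply: (@set_val_insubd _ (LVMB_open E : set (projective R n)) u0 (qP x)).
  by apply/LVMB_open_qP => //; exact: supp_open_neq0.
have orbq (x y : 'rV[C]_n.+1) : supp_open x -> supp_open y ->
    orb (insubd u0 (qP x)) = orb (insubd u0 (qP y)) <->
    exists c z, c != 0 /\ y = pscale (lvmb_char c z) x.
  move=> Ux Uy; rewrite /orb !valq // LVMB_orbitP.
  have x0 := supp_open_neq0 Ux; have y0 := supp_open_neq0 Uy.
  have D z (i : 'I_n.+1) : cexp (linform (L i) z) != 0 by exact: cexp_neq0.
  split=> [[z]|[c [z [c0 ->]]]].
    rewrite /LVMB_act diag_act_qP // => /esym/(qP_eq (pscale_neq0 (D z) x0) y0)[c c0 ->].
    exists c, z; split=> //; apply/rowP => i; by rewrite !mxE mulrA.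
  exists z; rewrite /LVMB_act diag_act_qP //; apply/esym/qP_eq; rewrite ?pscale_neq0 //.
    by move=> i; exact: lvmb_char_neq0.
  by exists c => //; apply/rowP => i; rewrite !mxE mulrA.
have pq := presents_quot (f := orb) pr.
exists (ker_pi orb \o (fun x => insubd u0 (qP x))); split; last first.
  move=> x y Ux Uy; rewrite -orbq //; exact: ker_piP.
apply: pq => x y Ux Uy /(orbq _ _ Ux Uy)[c [z [c0 e]]].
exists (pscale (lvmb_char c z)); split; first by rewrite e.
have N : \forall y \near (x : affine R n.+1), supp_open y.
  by apply: open_nbhs_nbhs; split=> //; exact: open_supp_open.
apply: filterS N => w Uw.
have Uw' : supp_open (pscale (lvmb_char c z) w).
  by apply: supp_open_scale => // i; exact: lvmb_char_neq0.
split=> //; last exact: pscale_differentiable.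
apply/esym/orbq => //; by exists c, z.
Qed.

End LVMBPresentation.

(** * The compact fundamental set and the characters of the torus *)
Section FundamentalSet.
Context {R : realType} {n : nat}.
Local Notation C := (Cx R).
Variable (E : {set {set 'I_n.+1}}).

(** A compact set of homogeneous coordinates that meets all orbits considered here. *)
Definition fundamental : set 'rV[C]_n.+1 :=
  [set x | (forall i, cmod (x 0 i) <= 1) /\
           exists2 A, A \in E & forall i, i \in A -> cmod (x 0 i) = 1].

Lemma continuous_cmod_coord i : continuous (fun x : 'rV[C]_n.+1 => cmod (x 0 i)).
Proof.
move=> x; apply: (@continuous_comp _ _ _ (fun x : 'rV[C]_n.+1 => x 0 i) cmod).
  exact: coord_continuous.
exact: continuous_cmod.
Qed.

Lemma closed_fundamental : closed fundamental.
Proof.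
have c1 : closed [set x : 'rV[C]_n.+1 | forall i, cmod (x 0 i) <= 1].
  rewrite (_ : [set _ | _] = \bigcap_i (fun x : 'rV[C]_n.+1 => cmod (x 0 i)) @^-1` [set y | y <= 1]).
    apply: closed_bigI => i _; apply: closed_comp; last exact: closed_le.
    by move=> x _; exact: continuous_cmod_coord.
  by apply/seteqP; split=> x h i; [move=> _; exact: h|exact: (h i)].
have c2 : closed (\bigcup_(A in [set A | A \in E]) [set x : 'rV[C]_n.+1 |
    forall i, i \in A -> cmod (x 0 i) = 1]).
  apply: closed_bigcup => [|A _]; first exact: finite_finset.
  rewrite (_ : [set _ | _] = \bigcap_(i in [set i | i \in A])
      (fun x : 'rV[C]_n.+1 => cmod (x 0 i)) @^-1` [set 1]).
    apply: closed_bigI => i _; apply: closed_comp; last exact: closed_eq.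
    by move=> x _; exact: continuous_cmod_coord.
  by apply/seteqP; split=> x h i iA; exact: (h i iA).
rewrite (_ : fundamental = [set x : 'rV[C]_n.+1 | forall i, cmod (x 0 i) <= 1] `&`
  \bigcup_(A in [set A | A \in E]) [set x : 'rV[C]_n.+1 | forall i, i \in A -> cmod (x 0 i) = 1]).
  exact: closedI.
by apply/seteqP; split=> x [h1 [A AE h]]; split=> //; exists A.
Qed.

Lemma compact_fundamental : compact fundamental.
Proof.
apply: (subclosed_compact closed_fundamental (@compact_polycbox R n.+1 1)).
by move=> x [h _] j; exact: cbox_cmod.
Qed.

Lemma fundamental_supp : fundamental `<=` supp_open E.
Proof.
move=> x [_ [A AE h]]; exists A => // i iA.
by rewrite -cmod_gt0 h.
Qed.

(** Taking logarithms of the moduli turns the claim into [feasible_exists], for the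
    right hand side [w] and for the members contained in the support of [x]. *)
Lemma normalize N (V : 'M[R]_(n.+1, N)) (x : 'rV[C]_n.+1) :
  cone_config V E ->
  (forall A i, A \in E -> exists2 j, j \in A & i |: (A :\ j) \in E) ->
  supp_open E x -> exists h : 'cV[R]_N,
    (forall i, cmod (x 0 i) * expR (- (V *m h) i 0) <= 1) /\
    exists2 A, A \in E & forall i, i \in A -> cmod (x 0 i) * expR (- (V *m h) i 0) = 1.
Proof.
move=> cfg comp [A0 A0E xA0].
pose I := [set i | x 0 i != 0]%SET.
pose E' := [set A in E | A \subset I]%SET.
pose w : 'cV[R]_n.+1 := \col_i ln (cmod (x 0 i)).
have cfg' : cone_config V E'.
  split=> [A|A|A B]; rewrite !inE => /andP[AE _]; first exact: (cfg_interp cfg AE).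
    exact: (cfg_inj cfg AE).
  by move=> /andP[BE _]; exact: (cfg_sep cfg AE BE).
have [|||A + [h [hI hA]]] := feasible_exists (I := I) w cfg'.
- by exists A0; rewrite inE A0E; apply/fintype.subsetP => i /xA0; rewrite inE.
- by move=> A; rewrite inE => /andP[].
- move=> A i; rewrite !inE => /andP[AE /fintype.subsetP AI] xi; have [j jA jE] := comp A i AE.
  exists j => //; rewrite inE jE; apply/fintype.subsetP => k; rewrite !inE.
  by move=> /orP[/eqP-> //|/andP[_ /AI]]; rewrite inE.
rewrite inE => /andP[AE /fintype.subsetP AI].
have wE k : w k 0 = ln (cmod (x 0 k)) by rewrite mxE.
have E1 i : x 0 i != 0 -> cmod (x 0 i) * expR (- (V *m h) i 0) = expR (w i 0 - (V *m h) i 0).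
  by move=> xi; rewrite expRD wE lnK // posrE cmod_gt0.
exists h; split => [i|].
  have [->|xi] := eqVneq (x 0 i) 0; first by rewrite cmod0 mul0r ler01.
  by rewrite E1 // expR_le1 subr_le0 hI // inE.
exists A => // i iA; have := AI i iA; rewrite inE => xi.
by rewrite E1 // hA // subrr expR0.
Qed.

End FundamentalSet.

Section Torus.
Context {R : realType} {n r : nat}.
Local Notation C := (Cx R).
Variable (lam : 'I_n.+1 -> 'rV[int]_r) (E : {set {set 'I_n.+1}}).

Definition tchar (t : 'rV[C]_r) (i : 'I_n.+1) : C := \prod_j (t 0 j) ^ (lam i 0 j).

(** The configuration of the vectors (1, [lam i]); its first column accounts for the
    scalars. *)
Definition lam_rows : 'M[R]_(n.+1, 1 + r) :=
  \matrix_(i < n.+1) row_mx 1%:M (map_mx intr (lam i)).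

Lemma lam_rowsE i (h : 'cV[R]_(1 + r)) :
  (lam_rows *m h) i 0 = usubmx h 0 0 + \sum_j (lam i 0 j)%:~R * dsubmx h j 0.
Proof.
have -> : (lam_rows *m h) i 0 = (row i lam_rows *m h) 0 0 by rewrite -row_mul [RHS]mxE.
rewrite rowK -{1}[h]vsubmxK mul_row_col mul1mx [LHS]mxE; congr (_ + _).
by rewrite mxE; apply: eq_bigr => j _; rewrite mxE.
Qed.

Lemma cmod_exprz (z : C) (k : int) : z != 0 -> cmod (z ^ k) = expR (k%:~R * ln (cmod z)).
Proof.
move=> z0; have p : 0 < cmod z by rewrite cmod_gt0.
have cX q : cmod (z ^+ q) = expR (q%:R * ln (cmod z)).
  elim: q => [|q IH]; first by rewrite expr0 cmod1 mul0r expR0.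
  by rewrite exprS cmodM IH -{1}(lnK p) -expRD -{1}[ln _]mul1r -mulrDl -natr1 addrC.
case: k => q; first by rewrite -exprnP cX.
by rewrite NegzE -exprnN cmodV cX -expRN mulrNz mulNr.
Qed.

Lemma exprz_neq0 (z : C) (k : int) : z != 0 -> z ^ k != 0.
Proof. by move=> z0; rewrite -cmod_gt0 cmod_exprz // expR_gt0. Qed.

Lemma tchar_neq0 t i : torus R r t -> tchar t i != 0.
Proof. by move=> tT; apply/prodf_neq0 => j _; exact: exprz_neq0. Qed.

Lemma cmod_tchar t i : torus R r t ->
  cmod (tchar t i) = expR (\sum_j (lam i 0 j)%:~R * ln (cmod (t 0 j))).
Proof.
move=> tT; rewrite cmod_prod expR_sum; apply: eq_bigr => j _.
by rewrite cmod_exprz.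
Qed.

Lemma cvg_exprz (z : C) (k : int) : z != 0 -> {for z, continuous (fun w : C => w ^ k)}.
Proof.
move=> z0; have cX q : {for z, continuous (fun w : C => w ^+ q)}.
  elim: q => [|q IH]; first by apply: (@cvg_cst _ _ _ (nbhs z)).
  rewrite /prop_for /continuous_at; under eq_fun do rewrite exprS.
  by rewrite exprS; apply: (@cvgM C _ (nbhs z)); [exact: cvg_id|exact: IH].
case: k => q; first exact: cX.
by apply: (@cvgV C _ (nbhs z)); [rewrite expf_neq0|exact: cX].
Qed.

Lemma continuous_tchar (t : 'rV[C]_r) i : torus R r t ->
  {for t, continuous (fun s : 'rV[C]_r => tchar s i)}.
Proof.
move=> tT; apply: (@cvg_bigprod C _ _ (nbhs t)) => j _.
apply: (@continuous_comp _ _ _ (fun s : 'rV[C]_r => s 0 j) (fun w : C => w ^ lam i 0 j)).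
  exact: coord_continuous.
exact: cvg_exprz.
Qed.

Lemma open_torus : open (torus R r).
Proof.
rewrite openE => t tT; rewrite /interior.
have N : \forall s \near (t : 'rV[C]_r), forall j, (s : 'rV[C]_r) 0 j != 0.
  apply: (@filter_forall _ _ (fun j (s : 'rV[C]_r) => s 0 j != 0) (nbhs (t : 'rV[C]_r))) => j.
  exact: (cvgr_neq0 _ (@coord_continuous C 1 r 0 j t) (tT j)).
exact: N.
Qed.

(** Joint continuity in the torus and in projective space, by openness of [qP]. *)
Lemma torus_act_continuous (t : 'rV[C]_r) (p : projective R n) : torus R r t ->
  {for (t, p), continuous (fun tp : affine R r * projective R n => torus_act lam tp.1 tp.2)}.
Proof.
move=> tT; rewrite -(qP_hcoord p); set x := hcoord p.
have x0 : x != 0 := hcoord_neq0 p.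
have c0 i := tchar_neq0 i tT.
have act_qP s y : torus R r s -> y != 0 -> torus_act lam s (qP y) = qP (pscale (tchar s) y).
  by move=> sT y0; apply: diag_act_qP => // i; exact: tchar_neq0.
apply: contP => W /=; rewrite act_qP // => hW.
have cq : {for pscale (tchar t) x, continuous (qP : affine R n.+1 -> projective R n)}.
  by apply: (pres_cont presents_projective); exact: pscale_neq0.
pose G (sy : 'rV[C]_r * 'rV[C]_n.+1) := pscale (tchar sy.1) sy.2.
have cG : {for (t, x), continuous G}.
  rewrite /prop_for /continuous_at; apply: cvg_mx => i j.
  rewrite mxE; under eq_fun do rewrite mxE.
  apply: (@cvgM C _ (nbhs (t, x))).
    apply: (@continuous_comp _ _ _ (fun sy : 'rV[C]_r * 'rV[C]_n.+1 => sy.1) (fun s => tchar s j)).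
      exact: cvg_fst.
    exact: continuous_tchar.
  apply: (@continuous_comp _ _ _ (fun sy : 'rV[C]_r * 'rV[C]_n.+1 => sy.2) (fun y : 'rV[C]_n.+1 => y 0 j)).
    exact: cvg_snd.
  exact: coord_continuous.
have N := near_cont cG (near_cont cq hW).
have [[T1 X1] /= [tT1 xX1] TX] := N.
have [T2 [oT2 T2t T21 T2T]]
  := @open_in2 (affine R r) t T1 (torus R r) tT1 (open_nbhs_nbhs (conj open_torus tT)).
have [X2 [oX2 X2x X21 X20]]
  := @open_in2 (affine R n.+1) x X1 (nonzero R n) xX1 (open_nbhs_nbhs (conj open_nonzero x0)).
exists (T2, qP @` X2).
  split; first exact: (@open_nbhs_nbhs (affine R r) t T2 (conj oT2 T2t)).
  apply: (pres_nbhs presents_projective x0).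
  exact: (@open_nbhs_nbhs (affine R n.+1) x X2 (conj oX2 X2x)).
move=> [s p'] [/= T2s [y X2y <-]]; rewrite act_qP; [|exact: T2T|exact: X20].
by apply: (TX (s, y)); split; [exact: T21|exact: X21].
Qed.

End Torus.

(** * The torus action on the LVMB open set is good *)
Lemma compact_preimage {T T' : topologicalType} (Q : set T) (F : T -> T') (K : set T') :
  compact Q -> closed K -> (forall x, Q x -> {for x, continuous F}) ->
  compact (Q `&` F @^-1` K).
Proof.
move=> cQ cK cF G PG GS.
have GQ : G Q by apply: filterS GS => x [].
have [x [Qx clx]] := cQ G PG GQ; exists x; split => //; split => //.
apply: cK => W FW; have [y [[_ Ky] Wy]] := clx _ _ GS (near_cont (cF x Qx) FW).
by exists (F y).
Qed.

Lemma geo_unif {R : realType} {n N : nat} (V : 'M[R]_(n, N)) E :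
  geo_config V E -> exists2 K, 0 < K & unif_config K V E.
Proof.
move=> g; have c : (fun _ : R => V) @ (0 : R) --> V by exact: cvg_cst.
by have [K K0 /nbhs_singleton u] := near_unif_config c g; exists K.
Qed.

Lemma hausdorff_pair {T T' : topologicalType} :
  hausdorff_space T -> hausdorff_space T' -> hausdorff_space (T * T')%type.
Proof.
move=> hT hT' [p p'] [q q'] cl; congr pair.
  apply: hT => A B pA qB.
  have [||[z z'] [[/= Az _] [Bz _]]] := cl (A `*` setT) (B `*` setT).
  - by exists (A, setT) => //; split=> //; exact: filterT.
  - by exists (B, setT) => //; split=> //; exact: filterT.
  - by exists z.
apply: hT' => A B pA qB.
have [||[z z'] [[/= _ Az] [_ Bz]]] := cl (setT `*` A) (setT `*` B).
- by exists (setT, A) => //; split=> //; exact: filterT.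
- by exists (setT, B) => //; split=> //; exact: filterT.
- by exists z'.
Qed.

Lemma cont_pair {X Y Z : topologicalType} (f : X -> Y) (g : X -> Z) (x : X) :
  {for x, continuous f} -> {for x, continuous g} -> {for x, continuous (fun z => (f z, g z))}.
Proof.
move=> cf cg; apply: contP => W [[A B] [/= fA gB] AB].
apply: filterS2 (near_cont cf fA) (near_cont cg gB) => z Az Bz.
exact: (AB (f z, g z)).
Qed.

Section ProperTorus.
Context {R : realType} {n r : nat}.
Local Notation C := (Cx R).

Definition polyannulus (c : R) : set (affine R r) :=
  [set t : 'rV[C]_r | forall j, expR (- c) <= cmod (t 0 j) <= expR c].

Lemma compact_polyannulus c : compact (polyannulus c).
Proof.
have cl : closed (polyannulus c).
  rewrite (_ : polyannulus c = \bigcap_j (fun t : 'rV[C]_r => cmod (t 0 j)) @^-1`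
     ([set y | expR (- c) <= y] `&` [set y | y <= expR c])); last first.
    apply/seteqP; split=> t h j; first by move=> _; apply/andP; exact: h.
    by have [//|h1 h2] := h j; apply/andP.
  apply: closed_bigI => j _; apply: (@closed_comp 'rV[C]_r); last first.
    by apply: closedI; [exact: closed_ge|exact: closed_le].
  move=> t _; apply: (@continuous_comp _ _ _ (fun x : 'rV[C]_r => x 0 j) cmod).
    exact: coord_continuous.
  exact: continuous_cmod.
apply: (subclosed_compact cl (@compact_polycbox R r (expR c))).
by move=> t h j; apply: cbox_cmod; have /andP[] := h j.
Qed.

Lemma polyannulus_torus c : polyannulus c `<=` torus R r.
Proof.
move=> t h j; have /andP[h1 _] := h j.
by rewrite -cmod_gt0; apply: lt_le_trans h1; exact: expR_gt0.
Qed.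

Variable (E : {set {set 'I_n.+1}}).
Hypothesis E_ne : exists A, A \in E.
Hypothesis E_set : forall A, A \in E -> exists i, i \in A.

(** Locally, homogeneous coordinates can be chosen of modulus at most 1, and bounded
    below on a fixed member of the family; compactness makes the bound uniform. *)
Lemma bounded_representatives (K : set (projective R n)) : compact K -> K `<=` LVMB_open E ->
  exists2 d : R, 0 < d & forall p, K p -> exists x : 'rV[C]_n.+1,
   [/\ qP x = p, x != 0, forall i, cmod (x 0 i) <= 1
     & exists2 A, A \in E & forall i, i \in A -> d <= cmod (x 0 i)].
Proof.
move=> /compact_near_coveringP cK KU.
pose P (d : R) (p : projective R n) := exists x : 'rV[C]_n.+1,
   [/\ qP x = p, x != 0, forall i, cmod (x 0 i) <= 1
     & exists2 A, A \in E & forall i, i \in A -> d <= cmod (x 0 i)].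
have : \forall d \near (0 : R)^'+, K `<=` P d.
  apply: cK => p Kp.
  have [y [A AE yA] yp] : exists2 y : 'rV[C]_n.+1, supp_open E y & qP y = p.
    exists (hcoord p); last exact: qP_hcoord.
    by have := KU p Kp; rewrite -{1}(qP_hcoord p) => /(LVMB_open_qP E (hcoord_neq0 p)).
  pose M := 1 + \sum_i cmod (y 0 i).
  have M0 : 0 < M by rewrite ltr_pwDl // sumr_ge0 // => i _; exact: cmod_ge0.
  have yM i : cmod (y 0 i) < M.
    rewrite /M (bigD1 i) //= [ltRHS]addrCA ltrDl ltr_pwDl // sumr_ge0 // => k _.
    exact: cmod_ge0.
  pose s : C := M^-1%:C; have s0 : s != 0 by rewrite -cmod_gt0 cmod_real normr_gt0 invr_neq0 // gt_eqF.
  pose x := s *: y.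
  have realC_mx i : cmod (x 0 i) = M^-1 * cmod (y 0 i).
    by rewrite mxE cmodM cmod_real ger0_norm // invr_ge0 ltW.
  have y0 : y != 0 by exact: (supp_open_neq0 E_set (ex_intro2 _ _ A AE yA)).
  have x0 : x != 0 by rewrite scaler_eq0 negb_or s0.
  have xp : qP x = p.
    by rewrite -yp; apply/qP_eq => //; exists s^-1; rewrite ?invr_eq0 // scalerA mulVf // scale1r.
  have x1 i : cmod (x 0 i) < 1 by rewrite realC_mx ltr_pdivrMl // mulr1.
  have xA i : i \in A -> 0 < cmod (x 0 i).
    by move=> iA; rewrite realC_mx mulr_gt0 ?invr_gt0 // cmod_gt0 yA.
  have [d d0 dA] : exists2 d : R, 0 < d & forall i, i \in A -> d < cmod (x 0 i).
    have N : \forall d \near (0 : R)^'+, forall i, i \in A -> d < cmod (x 0 i).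
      apply: filter_forall => i; have [iA|_] := boolP (i \in A); last by apply: filterE.
      by apply: filterS (nbhs_right_lt (xA i iA)) => d ? _.
    have N2 : \forall d \near (0 : R)^'+, 0 < d by exact: nbhs_right_gt.
    by have [d [h1 h2]] := filter_ex (filterI N N2); exists d.
  pose V : set (affine R n.+1) := [set z : 'rV[C]_n.+1 | [/\ z != 0, forall i, cmod (z 0 i) < 1 &
    forall i, i \in A -> d < cmod (z 0 i)]].
  have xV : nbhs (x : affine R n.+1) V.
    have h1 : nbhs (x : 'rV[C]_n.+1) [set z : 'rV[C]_n.+1 | z != 0].
      exact: (@open_nbhs_nbhs (affine R n.+1) x _ (conj open_nonzero x0)).
    have h2 : \forall z \near (x : 'rV[C]_n.+1), forall i, cmod ((z : 'rV[C]_n.+1) 0 i) < 1.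
      apply: (@filter_forall _ _ (fun i (z : 'rV[C]_n.+1) => cmod (z 0 i) < 1) (nbhs (x : 'rV[C]_n.+1))) => i.
      exact: (cvgr_lt _ (@continuous_cmod_coord R n i x) 1 (x1 i)).
    have h3 : \forall z \near (x : 'rV[C]_n.+1), forall i, i \in A -> d < cmod ((z : 'rV[C]_n.+1) 0 i).
      apply: (@filter_forall _ _ (fun i (z : 'rV[C]_n.+1) => i \in A -> d < cmod (z 0 i)) (nbhs (x : 'rV[C]_n.+1))) => i.
      have [iA|_] := boolP (i \in A); last by apply: (@filterE _ (nbhs (x : 'rV[C]_n.+1))).
      have h : \forall z \near (x : 'rV[C]_n.+1), d < cmod ((z : 'rV[C]_n.+1) 0 i).
        exact: (cvgr_gt _ (@continuous_cmod_coord R n i x) d (dA i iA)).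
      by apply: filterS h => z ? _.
    by apply: filterS3 h1 h2 h3 => z ? ? ?; split.
  have W : \forall e \near (0 : R)^'+, e < d by exact: nbhs_right_lt.
  exists (qP @` V, [set e | e < d]).
    split; last exact: W.
    by rewrite -xp; exact: (pres_nbhs presents_projective x0 xV).
  move=> [_ e] [/= [z [z0 z1 zA] <-] ed]; exists z; split=> // [i|]; first exact: ltW.
  by exists A => // i /zA zi; rewrite ltW // (lt_trans ed).
have N2 : \forall d \near (0 : R)^'+, 0 < d by exact: nbhs_right_gt.
move=> N; have [d [h1 h2]] : exists d, K `<=` P d /\ 0 < d.
  by apply: (@filter_ex R (0 : R)^'+); exact: (filterI N N2).
by exists d.
Qed.

Variable lam : 'I_n.+1 -> 'rV[int]_r.
Hypothesis comp : forall A i, A \in E -> exists2 j, j \in A & i |: (A :\ j) \in E.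
Hypothesis geo : geo_config (lam_rows lam : 'M[R]_(n.+1, 1 + r)) E.

Lemma torus_stable : stable (torus R r) (torus_act lam) (LVMB_open E : set (projective R n)).
Proof.
move=> t p tT; rewrite -(qP_hcoord p); set x := hcoord p.
have x0 : x != 0 := hcoord_neq0 p.
move=> /(LVMB_open_qP E x0) Ux.
rewrite /torus_act diag_act_qP //; last by move=> i; exact: tchar_neq0.
apply/LVMB_open_qP; first by apply: pscale_neq0 => // i; exact: tchar_neq0.
by apply: supp_open_scale => // i; exact: tchar_neq0.
Qed.

(** If both a point and its translate lie in a compact set, comparing the moduli of
    their representatives bounds the logarithms of the characters above on one member
    and below on another; [unif_proper] confines the element of the torus to a compact
    polyannulus. *)
Lemma torus_proper : proper_on (torus R r) (torus_act lam) (LVMB_open E : set (projective R n)).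
Proof.
move=> K KU cK.
pose K1 : set (projective R n) := fst @` K; pose K2 : set (projective R n) := snd @` K.
have cK1 : compact K1.
  by apply: continuous_compact => //; apply: continuous_subspaceT => x; exact: cvg_fst.
have cK2 : compact K2.
  by apply: continuous_compact => //; apply: continuous_subspaceT => x; exact: cvg_snd.
have [d1 d10 h1] := bounded_representatives cK1 (fun p '(ex_intro2 z Kz e) => eq_ind _ _ (KU z Kz).1 _ e).
have [d2 d20 h2] := bounded_representatives cK2 (fun p '(ex_intro2 z Kz e) => eq_ind _ _ (KU z Kz).2 _ e).
have [k k0 uni] := geo_unif geo.
pose c := `|ln d1| + `|ln d2|.
have c0 : 0 <= c by rewrite addr_ge0.
pose c' := k * (c + k * (n.+1%:R * (k * c) + n.+1%:R * (k * c))).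
pose F (tp : affine R r * projective R n) : projective R n * projective R n :=
  (tp.2, torus_act lam tp.1 tp.2).
rewrite (_ : [set _ | _] = (polyannulus c' `*` K1) `&` F @^-1` K).
  apply: compact_preimage.
  - by apply: compact_setX => //; exact: compact_polyannulus.
  - apply: compact_closed => //; apply: hausdorff_pair; exact: projective_hausdorff.
  - move=> [t p] [/polyannulus_torus /= tT K1p].
    apply: (@cont_pair _ _ _ (fun tp : affine R r * projective R n => tp.2)
      (fun tp => torus_act lam tp.1 tp.2) (t, p)); first exact: cvg_snd.
    exact: torus_act_continuous.
apply/seteqP; split=> -[t p] /=; last first.
  move=> [[tT K1p] Kp]; split=> //; first exact: (polyannulus_torus tT).
  by have [] := KU _ Kp.
move=> [tT Up Kp]; split=> //; split=> /=; last by exists (p, torus_act lam t p).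
have [x [xp x0 x1 [A AE xA]]] := h1 p (ex_intro2 _ _ _ Kp erefl).
have [y [yp y0 y1 [B BE yB]]] := h2 _ (ex_intro2 _ _ _ Kp erefl).
have c1 i := tchar_neq0 lam i tT.
have /(qP_eq (pscale_neq0 c1 x0) y0)[s s0 ys] : qP (pscale (tchar lam t) x) = qP y.
  by rewrite yp /= -xp /torus_act diag_act_qP.
pose h : 'cV[R]_(1 + r) := col_mx (ln (cmod s))%:M (\col_j ln (cmod (t 0 j))).
have hE i : expR ((lam_rows lam *m h) i 0) = cmod s * cmod (tchar lam t i).
  rewrite lam_rowsE expRD /h col_mxKu col_mxKd mxE eqxx mulr1n lnK ?posrE ?cmod_gt0 //.
  congr (_ * _); rewrite cmod_tchar //; congr expR; apply: eq_bigr => j _.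
  by rewrite mxE.
have yE i : cmod (y 0 i) = expR ((lam_rows lam *m h) i 0) * cmod (x 0 i).
  by rewrite hE ys !mxE !cmodM mulrA.
have hA i : i \in A -> (lam_rows lam *m h) i 0 <= c.
  move=> iA; rewrite -ler_expR; apply: (@le_trans _ _ d1^-1).
    rewrite -[d1^-1]mul1r ler_pdivlMr //; apply: le_trans (y1 i).
    by rewrite yE ler_wpM2l ?expR_ge0 // xA.
  rewrite -[d1^-1](@lnK R) ?posrE ?invr_gt0 // ler_expR lnV ?posrE //.
  by apply: le_trans (ler_norm _) _; rewrite normrN lerDl.
have hB i : i \in B -> - c <= (lam_rows lam *m h) i 0.
  move=> iB; rewrite -ler_expR; apply: (@le_trans _ _ d2).
    rewrite -[leRHS](@lnK R) ?posrE // ler_expR lerNl /c.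
    by apply: le_trans (ler_norm _) _; rewrite normrN lerDr.
  apply: le_trans (yB i iB) _; rewrite yE ler_piMr ?expR_ge0 //.
have bd j := unif_proper k0 c0 uni AE BE hA hB (rshift 1 j).
move=> j; have := bd j; rewrite /h col_mxEd mxE ler_norml => /andP[b1 b2].
rewrite -(@lnK R (cmod (t 0 j))) ?posrE ?cmod_gt0 ?tT // !ler_expR.
by apply/andP.
Qed.

Lemma torus_act_mul (s t : 'rV[C]_r) (p : projective R n) : torus R r s -> torus R r t ->
  torus_act lam (torus_mul s t) p = torus_act lam s (torus_act lam t p).
Proof.
move=> sT tT; rewrite /torus_act diag_act_comp; last 2 first.
- by move=> i; exact: tchar_neq0.
- by move=> i; exact: tchar_neq0.
apply: diag_act_ext => i; rewrite -big_split; apply: eq_bigr => j _ /=.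
by rewrite mxE exprzMl // unitfE ?sT ?tT.
Qed.

Lemma torus_act1 (p : projective R n) : torus_act lam (const_mx 1) p = p.
Proof. by apply: diag_act_id => i; rewrite big1 // => j _; rewrite mxE exp1rz. Qed.

Lemma torus_subgroup_orbitP (G : set (affine R r)) (p p' : projective R n) :
  torus_subgroup G ->
  Defs.orbit G (torus_act lam) p = Defs.orbit G (torus_act lam) p' <->
  exists2 t, G t & p' = torus_act lam t p.
Proof.
move=> [GT G1 GM GV].
apply: (@orbit_eqP R n _ G (torus_act lam) (const_mx 1) (@torus_mul R r) (@torus_inv R r)) => //.
- exact: torus_act1.
- by move=> g h q /GT gT /GT hT; exact: torus_act_mul.
move=> g q Gg; rewrite -torus_act_mul; [|exact/GT/GV|exact: GT].
rewrite (_ : torus_mul _ _ = const_mx 1) ?torus_act1 //.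
by apply/rowP => j; rewrite !mxE mulVf // GT.
Qed.

Lemma torus_orbitP (p p' : projective R n) :
  Defs.orbit (torus R r) (torus_act lam) p = Defs.orbit (torus R r) (torus_act lam) p' <->
  exists2 t, torus R r t & p' = torus_act lam t p.
Proof.
apply: torus_subgroup_orbitP; split=> //.
- by move=> j; rewrite mxE oner_neq0.
- by move=> s t sT tT j; rewrite mxE mulf_neq0.
- by move=> t tT j; rewrite mxE invr_eq0.
Qed.

(** By [normalize], each orbit meets the image of the compact set [fundamental]: the
    real vector found there is the logarithm of an element of the torus. *)
Lemma torus_compact_quotient :
  compact [set: orbit_space (torus R r) (torus_act lam) (LVMB_open E : set (projective R n))].
Proof.
have Uones : LVMB_open E (qP (const_mx 1) : projective R n).
  apply/LVMB_open_qP; first exact: ones_nonzero.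
  have [A AE] := E_ne; exists A => // i _; by rewrite mxE oner_neq0.
pose u0 : set_type (LVMB_open E : set (projective R n)) :=
  exist (fun p => p \in LVMB_open E) _ (mem_set Uones).
have pr := presents_open_sub u0 presents_projective (open_LVMB_open E_set).
have FA : fundamental E `<=` nonzero R n `&` qP @^-1` LVMB_open E.
  move=> x /fundamental_supp Ux; have x0 := supp_open_neq0 E_set Ux.
  by split => //; apply/LVMB_open_qP.
have cF := pres_compact pr (@compact_fundamental R n E) FA.
pose orb (u : fsub (LVMB_open E : set (projective R n))) :=
  Defs.orbit (torus R r) (torus_act lam) (set_val u).
have cQ : compact (ker_pi orb @` ((fun x => insubd u0 (qP x)) @` fundamental E)).
  apply: (@continuous_compact (fsub (LVMB_open E : set (projective R n))) (ker_quot orb)) => //.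
  apply: continuous_subspaceT; exact: ker_pi_continuous.
rewrite (_ : [set: _] = ker_pi orb @` ((fun x => insubd u0 (qP x)) @` fundamental E)) //.
apply/seteqP; split=> // z _.
pose u := ker_repr z; pose x := hcoord (set_val u).
have x0 : x != 0 := hcoord_neq0 _.
have ux : set_val u = qP x by rewrite /x qP_hcoord.
have Ux : supp_open E x by apply/(LVMB_open_qP E x0); rewrite -ux; exact: set_valP.
have [h [hle [A AE hA]]] := normalize (geo_cone geo) comp Ux.
pose t : 'rV[C]_r := \row_j (expR (- dsubmx h j 0))%:C.
have tpos j : t 0 j = (expR (- dsubmx h j 0))%:C by rewrite mxE.
have tT : torus R r t by move=> j; rewrite -cmod_gt0 tpos cmod_real gtr0_norm expR_gt0.
have c1 i := tchar_neq0 lam i tT.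
pose s : C := (expR (- usubmx h 0 0))%:C.
have s0 : s != 0 by rewrite -cmod_gt0 cmod_real gtr0_norm expR_gt0.
pose y := s *: pscale (tchar lam t) x.
have yE i : cmod (y 0 i) = cmod (x 0 i) * expR (- (lam_rows lam *m h) i 0).
  have -> : y 0 i = s * (tchar lam t i * x 0 i) by rewrite !mxE.
  rewrite lam_rowsE !cmodM cmod_real gtr0_norm ?expR_gt0 // cmod_tchar //.
  rewrite mulrA -expRD mulrC; congr (_ * expR _).
  rewrite opprD -sumrN; congr (_ + _); apply: eq_bigr => j _.
  by rewrite tpos cmod_real gtr0_norm ?expR_gt0 // expRK mulrN.
have Fy : fundamental E y.
  by split=> [i|]; [rewrite yE|exists A => // i iA; rewrite yE hA].
have yz : qP y = torus_act lam t (set_val u).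
  rewrite ux /torus_act diag_act_qP //; apply/qP_eq.
  - by rewrite scaler_eq0 negb_or s0 pscale_neq0.
  - exact: pscale_neq0.
  by exists s^-1; rewrite ?invr_eq0 // scalerA mulVf // scale1r.
have Uy : LVMB_open E (qP y : projective R n) by rewrite yz; apply: torus_stable => //; exact: set_valP.
exists (insubd u0 (qP y)); first by exists y.
rewrite -[RHS]ker_reprK -/u; apply/ker_piP.
rewrite /orb (set_val_insubd u0 Uy); apply/esym/torus_orbitP.
by exists t.
Qed.

Lemma torus_good : good (torus R r) (torus_act lam) (LVMB_open E : set (projective R n)).
Proof.
split; [exact: open_LVMB_open|exact: torus_stable|exact: torus_proper|exact: torus_compact_quotient].
Qed.

End ProperTorus.

(** * Integral weights generating the character lattice *)
(** A full-rank integral matrix is the product of one whose rows generate the lattice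
    with an invertible rational one.  The Smith normal form [L D R] gives it: take the
    first columns of the unimodular [L], whose rows generate, and put [D R] in [T]. *)
Lemma integral_frame n r (K : 'M[int]_(n.+1, r)) : (r <= n.+1)%N ->
  (forall v : 'cV[int]_r, K *m v = 0 -> v = 0) ->
  exists (Lam : 'M[int]_(n.+1, r)) (T : 'M[int]_r) (c : 'M[int]_(r, n.+1)),
    [/\ K = Lam *m T, \det T != 0 & c *m Lam = 1%:M].
Proof.
move=> rn Kinj; have [Lm uL [Rm uR [d _ KE]]] := int_Smith_normal_form K.
(* The diagonal factor is the product of an inclusion of coordinates with D. *)
pose D : 'M[int]_r := diag_mx (\row_j d`_j).
have pD : (\matrix_(i, j) (d`_i *+ (i == j :> nat)) : 'M[int]_(n.+1, r)) = pid_mx r *m D.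
  apply/matrixP => i j; rewrite /D mul_mx_diag !mxE.
  have [ij|_] := eqVneq (i : nat) j; last by rewrite mul0r.
  by rewrite ij ltn_ord mul1r.
pose T := D *m Rm; pose Lam : 'M[int]_(n.+1, r) := Lm *m pid_mx r.
have KLT : K = Lam *m T by rewrite KE pD !mulmxA.
exists Lam, T, (pid_mx r *m invmx Lm); split=> //.
  rewrite -det_tr; apply/negP => /det0P[v v0 vT]; case/eqP: v0.
  apply: (can_inj trmxK); rewrite trmx0; apply: Kinj; rewrite KLT -mulmxA.
  by rewrite -[T]trmxK -trmx_mul vT trmx0 mulmx0.
rewrite /Lam mulmxA -(mulmxA (pid_mx r)) mulVmx // mulmx1 mul_pid_mx.
by rewrite minnn (minn_idPr rn) pid_mx_1.
Qed.

(** A linear change of coordinates preserves bases and cones. *)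
Lemma geo_config_mulr {R : realType} n N (V : 'M[R]_(n, N)) (T : 'M[R]_N) E :
  T \in unitmx -> geo_config V E -> geo_config (V *m T) E.
Proof.
move=> uT g; split=> [A AE|A AE h h0|A B AE BE]; first exact: (geo_card g AE).
  have Th : T *m h = 0 by apply: (geo_inj g AE) => i iA; rewrite mulmxA h0.
  by rewrite -(mulKmx uT h) Th mulmx0.
have [a [b [a0 b0 ab]]] := geo_sep g AE BE; exists a, b; split=> //.
have S (A' : {set 'I_n}) (f : 'I_n -> R) :
    \sum_(i in A') f i *: row i (V *m T) = (\sum_(i in A') f i *: row i V) *m T.
  by rewrite mulmx_suml; apply: eq_bigr => i _; rewrite row_mul scalemxAl.
by rewrite !S ab.
Qed.

Section Effective.
Context {R : realType} {n r : nat}.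
Local Notation C := (Cx R).

(** An element of the torus that fixes the point with coordinates 1 takes the same
    value under the characters [lam i], namely 1 because of the zero weight; then all
    characters of the torus, which these generate, are trivial on it. *)
Lemma effective_of_frame (lam : 'I_n.+1 -> 'rV[int]_r) (c : 'M[int]_(r, n.+1)) :
  lam 0 = 0 -> c *m (\matrix_i lam i) = 1%:M -> torus_effective R lam.
Proof.
move=> lam0 cl t tT fix_t.
have c1 i := tchar_neq0 lam i tT.
have o0 := @ones_nonzero R n.
have := fix_t (qP (const_mx 1)).
rewrite /torus_act diag_act_qP // => /(qP_eq (pscale_neq0 c1 o0) o0)[s s0 /rowP e].
have t1 i : s * tchar lam t i = 1 by have := e i; rewrite !mxE mulr1.
have ch0 : tchar lam t 0 = 1 by rewrite /tchar big1 // => j _; rewrite lam0 mxE expr0z.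
have {t1} t1 i : tchar lam t i = 1.
  by have := t1 i; have := t1 0; rewrite ch0 mulr1 => ->; rewrite mul1r.
apply/rowP => j; rewrite mxE.
(* Characters multiply when weights are added. *)
have prodz (z : C) (I : finType) (F : I -> int) : z != 0 ->
    z ^ (\sum_i F i) = \prod_i z ^ F i.
  by move=> z0; apply: (big_morph (fun k => z ^ k)) => [x y|]; rewrite ?expr0z // expfzDr.
have -> : t 0 j = \prod_k t 0 k ^ (1%:M : 'M[int]_r) j k.
  rewrite (bigD1 j) //= mxE eqxx expr1z big1 ?mulr1 // => k kj.
  by rewrite mxE eq_sym (negbTE kj) expr0z.
rewrite -cl.
have -> : \prod_k t 0 k ^ (c *m (\matrix_i lam i)) j k =
    \prod_i \prod_k (t 0 k ^ lam i 0 k) ^ c j i.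
  rewrite exchange_big; apply: eq_bigr => k _; rewrite mxE prodz ?tT //.
  by apply: eq_bigr => i _; rewrite mxE mulrC exprz_exp.
rewrite big1 // => i _; transitivity (tchar lam t i ^ c j i); last by rewrite t1 exp1rz.
have pm (l : seq 'I_r) (F : 'I_r -> C) : (forall k, F k != 0) ->
    \prod_(k <- l) F k ^ c j i = (\prod_(k <- l) F k) ^ c j i.
  move=> F0; elim: l => [|k l IH]; first by rewrite !big_nil exp1rz.
  rewrite !big_cons IH exprzMl // unitfE ?F0 //.
  by rewrite prodf_seq_neq0; apply/allP => z _; rewrite F0.
have pt k : t 0 k ^ lam i 0 k != 0 by apply: exprz_neq0; exact: tT.
exact: (pm _ _ pt).
Qed.

End Effective.

(** * The closed cocompact subgroup *)
Lemma Re_bigsum {R : realType} (I : Type) (s : seq I) (f : I -> Cx R) :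
  complex.Re (\sum_(i <- s) f i) = \sum_(i <- s) complex.Re (f i).
Proof. by elim: s => [|i s IH]; rewrite ?big_nil // !big_cons -IH; case: (f i) => a b; case: (\sum_(_ <- _) _). Qed.

Lemma Re_mul_real {R : realType} (z : Cx R) (x : R) : complex.Re (z * x%:C) = complex.Re z * x.
Proof. by case: z => a b /=; rewrite mulr0 subr0. Qed.

Section CmSubgroup.
Context {R : realType} {m : nat}.
Local Notation C := (Cx R).
Local Notation r := (m + m)%N.
Variable M : 'M[R]_r.
Hypothesis uM : M \in unitmx.

Definition realC_mx {p q} (A : 'M[R]_(p, q)) : 'M[C]_(p, q) := map_mx (real_complex R) A.

Lemma Re_mul_realC_mx p q (w : 'rV[C]_p) (A : 'M[R]_(p, q)) k :
  complex.Re ((w *m realC_mx A) 0 k) = (map_mx (@complex.Re R) w *m A) 0 k.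
Proof. by rewrite !mxE Re_bigsum; apply: eq_bigr => j _; rewrite !mxE Re_mul_real. Qed.

(** The exponents of the embedding: the complex linear map whose composite with the
    transpose of [M] sends [z] to (z, i z). *)
Definition expo : 'M[C]_(m, r) := row_mx 1%:M ('i%C)%:M *m realC_mx (invmx M)^T.
Definition rho0 (z : 'rV[C]_m) : 'rV[C]_r := \row_k cexp ((z *m expo) 0 k).
Definition lnv (t : 'rV[C]_r) : 'rV[R]_r := \row_k ln (cmod (t 0 k)).
(** Recovers [z] from the real parts of its exponents, that is, from the moduli. *)
Definition sig0 (t : 'rV[C]_r) : 'rV[C]_m :=
  \row_j ((lnv t *m M^T) 0 (lshift m j) +i* (- (lnv t *m M^T) 0 (rshift m j))).

(** In the coordinates [M], the real parts of the exponents are those of (z, i z):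
    they determine [z]. *)
Lemma Re_expo (z : 'rV[C]_m) : (map_mx (@complex.Re R) (z *m expo)) *m M^T =
  row_mx (map_mx (@complex.Re R) z) (- map_mx (@complex.Im R) z).
Proof.
have -> : map_mx (@complex.Re R) (z *m expo) =
    row_mx (map_mx (@complex.Re R) z) (- map_mx (@complex.Im R) z) *m (invmx M)^T.
  apply/rowP => k; rewrite mxE /expo mulmxA Re_mul_realC_mx; congr ((_ *m _) 0 k).
  rewrite mul_mx_row mulmx1 mul_mx_scalar map_row_mx; congr row_mx.
  by apply/rowP => j; rewrite !mxE; case: (z 0 j) => a b /=; rewrite mul0r mul1r sub0r.
by rewrite -mulmxA -trmx_mul mulmxV // trmx1 mulmx1.
Qed.

Lemma lnv_rho0 (z : 'rV[C]_m) : lnv (rho0 z) = map_mx (@complex.Re R) (z *m expo).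
Proof. by apply/rowP => k; rewrite !mxE cmod_cexp expRK. Qed.

Lemma rho0K z : sig0 (rho0 z) = z.
Proof.
apply/rowP => j; rewrite mxE lnv_rho0 Re_expo row_mxEl row_mxEr !mxE opprK.
by case: (z 0 j).
Qed.

(** Any point of the torus has the same moduli as a point of the subgroup, since the
    map from [z] to the moduli of its image is a real linear isomorphism in
    logarithmic coordinates. *)
Lemma cmod_rho0_sig0 (t : 'rV[C]_r) k : torus R r t -> cmod (rho0 (sig0 t) 0 k) = cmod (t 0 k).
Proof.
move=> tT; have e : lnv (rho0 (sig0 t)) = lnv t.
  rewrite lnv_rho0 -[LHS]mulmx1 -trmx1 -(mulVmx uM) trmx_mul mulmxA Re_expo.
  rewrite -[RHS]mulmx1 -trmx1 -(mulVmx uM) trmx_mul mulmxA; congr (_ *m _).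
  rewrite -[RHS]hsubmxK; congr row_mx; apply/rowP => j; rewrite !mxE //=.
  by rewrite opprK.
have tk : 0 < cmod (t 0 k) by rewrite cmod_gt0 tT.
have rk : 0 < cmod (rho0 (sig0 t) 0 k) by rewrite cmod_gt0 mxE cexp_neq0.
by rewrite -[LHS]lnK // -[RHS]lnK //; have /rowP/(_ k) := e; rewrite !mxE => ->.
Qed.

Lemma rho0_torus z : torus R r (rho0 z).
Proof. by move=> k; rewrite mxE cexp_neq0. Qed.

Lemma rho0E z k : rho0 z 0 k = cexp ((z *m expo) 0 k).
Proof. by rewrite mxE. Qed.

Lemma rho0D z w : rho0 (z + w) = torus_mul (rho0 z) (rho0 w).
Proof.
apply/rowP => k; rewrite [RHS]mxE !rho0E mulmxDl -cexpD; congr cexp.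
by rewrite mxE.
Qed.

Lemma rho00 : rho0 0 = const_mx 1.
Proof. by apply/rowP => k; rewrite rho0E mul0mx !mxE cexp0. Qed.

Lemma rho0N z : rho0 (- z) = torus_inv (rho0 z).
Proof. by apply/rowP => k; rewrite [RHS]mxE !rho0E -cexpN mulNmx; congr cexp; rewrite mxE. Qed.

Lemma rho0_differentiable z : differentiable (rho0 : 'rV[C]_m -> 'rV[C]_r) z.
Proof.
apply: differentiable_row => k; under eq_fun do rewrite mxE.
apply: (@differentiable_comp _ _ _ _ (fun z : 'rV[C]_m => (z *m expo) 0 k : C^o) (@cexp R : C^o -> C^o)).
  apply: (@differentiable_comp _ _ _ _ (mulmxr expo) (fun w : 'rV[C]_r => w 0 k : C^o)).
    exact: differentiable_mulmxr.
  exact: differentiable_coord.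
exact: cexp_differentiable.
Qed.

Lemma sig0_continuous (t : 'rV[C]_r) : torus R r t -> {for t, continuous sig0}.
Proof.
move=> tT.
have cl k : (fun s : 'rV[C]_r => lnv s 0 k) @ t --> lnv t 0 k.
  rewrite mxE; under eq_fun do rewrite mxE.
  apply: (@continuous_comp _ _ _ (fun s : 'rV[C]_r => cmod (s 0 k)) (@ln R)).
    apply: (@continuous_comp _ _ _ (fun s : 'rV[C]_r => s 0 k) cmod).
      exact: coord_continuous.
    exact: continuous_cmod.
  by apply: continuous_ln; rewrite cmod_gt0 tT.
have cm k : (fun s : 'rV[C]_r => (lnv s *m M^T) 0 k) @ t --> (lnv t *m M^T) 0 k.
  apply: (@cvg_coord _ (nbhs t)); apply: (@cvg_mulmx R _ (nbhs t)); last exact: cvg_cst.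
  by apply: (@cvg_mx _ (nbhs t)) => i j; rewrite (ord1 i); exact: cl.
rewrite /prop_for /continuous_at; apply: (@cvg_mx _ (nbhs t)) => i j; rewrite (ord1 i) mxE.
under eq_fun do rewrite mxE.
by apply: (@cvg_Complex _ _ (nbhs t)); [exact: cm|apply: (@cvgN R R _ (nbhs t)); exact: cm].
Qed.

Definition Cm_torus : set (affine R r) := rho0 @` setT.

Lemma Cm_torus_subgroup : torus_subgroup Cm_torus.
Proof.
split=> [_ [z _ <-]||_ _ [z _ <-] [w _ <-]|_ [z _ <-]]; first exact: rho0_torus.
- by exists 0 => //; exact: rho00.
- by exists (z + w) => //; exact: rho0D.
by exists (- z) => //; exact: rho0N.
Qed.

Lemma rho0_sig0_continuous (t : 'rV[C]_r) : torus R r t -> {for t, continuous (rho0 \o sig0)}.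
Proof.
move=> tT; apply: (@continuous_comp _ _ _ sig0 rho0); first exact: sig0_continuous.
exact: differentiable_continuous (rho0_differentiable _).
Qed.

(** The subgroup is the fixed locus of the continuous map [rho0 \o sig0]. *)
Lemma Cm_torus_closed : closed (set_val @^-1` Cm_torus : set (set_type (torus R r))).
Proof.
pose F k (t : set_type (torus R r)) : R :=
  cmod (rho0 (sig0 (set_val t)) 0 k - (set_val t : 'rV[C]_r) 0 k).
rewrite (_ : _ @^-1` _ = \bigcap_k F k @^-1` [set y | y <= 0]); last first.
  apply/seteqP; split=> [t [z _ e] k _ /=|t h].
    by rewrite /F -e rho0K subrr cmod0.
  exists (sig0 (set_val t)) => //; apply/rowP => k; apply/eqP.
  rewrite -subr_eq0 -cmod_eq0 eq_le cmod_ge0 andbT; exact: (h k).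
apply: closed_bigI => k _; apply: closed_comp; last exact: closed_le.
move=> t _; rewrite /F.
have ct : {for t, continuous (set_val : set_type (torus R r) -> 'rV[C]_r)} by exact: set_val_continuous.
apply: (@continuous_comp _ _ _ (fun t : set_type (torus R r) =>
   rho0 (sig0 (set_val t)) 0 k - (set_val t : 'rV[C]_r) 0 k) cmod); last exact: continuous_cmod.
apply: (@cvgB C C _ (nbhs t)); apply: (@cvg_coord _ (nbhs t)); last exact: ct.
exact: (continuous_comp ct (rho0_sig0_continuous (set_valP t))).
Qed.

(** By [cmod_rho0_sig0], the compact torus of points of modulus 1 meets all cosets. *)
Lemma Cm_torus_cocompact : compact [set: fquot (fun t : fsub (torus R r) =>
                      [set torus_mul (set_val t) g | g in Cm_torus])].
Proof.
set f := fun t : fsub (torus R r) => _.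
have T1 : torus R r (const_mx 1) by move=> k; rewrite mxE oner_neq0.
(* The value of [insubd] off the torus. *)
pose u0 : set_type (torus R r) := exist (fun p => p \in torus R r) _ (mem_set T1).
have pr := presents_open_sub u0 (@presents_affine R r) (@open_torus R r).
have A : polyannulus 0 `<=` setT `&` id @^-1` torus R r by move=> t /polyannulus_torus.
have cA := pres_compact pr (@compact_polyannulus R r 0) A.
have cQ : compact (ker_pi f @` ((fun x => insubd u0 x) @` polyannulus 0)).
  apply: (@continuous_compact (fsub (torus R r)) (ker_quot f)) => //.
  apply: continuous_subspaceT; exact: ker_pi_continuous.
rewrite (_ : [set: _] = ker_pi f @` ((fun x => insubd u0 x) @` polyannulus 0)) //.
apply/seteqP; split=> // y _; set t := ker_repr y.
have tT : torus R r (set_val t) := set_valP t.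
pose z := sig0 (set_val t); pose tau := torus_mul (set_val t) (rho0 (- z)).
have te : set_val t = torus_mul tau (rho0 z).
  apply/rowP => k; rewrite /tau rho0N [RHS]mxE; move: (rho0_torus z k) => zk.
  have -> : torus_mul (set_val t) (torus_inv (rho0 z)) 0 k = (set_val t : 'rV[C]_r) 0 k * (rho0 z 0 k)^-1.
    by rewrite !mxE.
  by rewrite divfK.
have tau1 : polyannulus 0 tau.
  move=> k; have -> : tau 0 k = (set_val t : 'rV[C]_r) 0 k * (rho0 z 0 k)^-1.
    by rewrite /tau rho0N !mxE.
  rewrite cmodM cmodV cmod_rho0_sig0 // mulfV ?oppr0 ?expR0 ?lexx //.
  by rewrite cmod_eq0 tT.
exists (insubd u0 tau); first by exists tau.
rewrite -[RHS]ker_reprK -/t; apply/ker_piP; rewrite /f.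
rewrite (set_val_insubd u0 (polyannulus_torus tau1)).
have mulA (a b c : 'rV[C]_r) : torus_mul a (torus_mul b c) = torus_mul (torus_mul a b) c.
  by apply/rowP => k; rewrite !mxE mulrA.
apply/seteqP; split=> _ [_ [w _ <-] <-].
  by exists (rho0 (- z + w)); [exists (- z + w)|rewrite rho0D mulA].
exists (rho0 (z + w)); first by exists (z + w).
rewrite rho0D mulA; exact: (congr1 (fun x => torus_mul x (rho0 w)) (esym te)).
Qed.

(** A complex linear left inverse of [expo]. *)
Definition expo_inv : 'M[C]_(r, m) := realC_mx M^T *m col_mx 1%:M 0.

Lemma expoK : expo *m expo_inv = 1%:M.
Proof.
have e : realC_mx (invmx M)^T *m realC_mx M^T = 1%:M.
  by rewrite -map_mxM -trmx_mul mulmxV // trmx1 map_mx1.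
rewrite /expo /expo_inv -(mulmxA (row_mx 1%:M _)) (mulmxA _ (realC_mx M^T)) e.
by rewrite mul1mx mul_row_col mulmx1 mulmx0 addr0.
Qed.

(** Locally, [sig0] extends from the subgroup to a holomorphic map on the torus: it
    uses the arguments as well as the moduli, through a branch of the logarithm near
    the point over [z0].  This makes the inverse of the embedding holomorphic. *)
Definition sig_ext (z0 : 'rV[C]_m) (t : 'rV[C]_r) : 'rV[C]_m :=
  z0 + (\row_k clog (t 0 k / rho0 z0 0 k)) *m expo_inv.

Lemma sig_ext_differentiable z0 :
  \forall t \near rho0 z0, differentiable (sig_ext z0 : 'rV[C]_r -> 'rV[C]_m) t.
Proof.
have N : \forall t \near (rho0 z0 : 'rV[C]_r), forall k, 0 < complex.Re ((t : 'rV[C]_r) 0 k / rho0 z0 0 k).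
  apply: (@filter_forall _ _ (fun k (t : 'rV[C]_r) => 0 < complex.Re (t 0 k / rho0 z0 0 k))
    (nbhs (rho0 z0))) => k.
  have c : (fun t : 'rV[C]_r => complex.Re (t 0 k / rho0 z0 0 k)) @ rho0 z0
      --> complex.Re (rho0 z0 0 k / rho0 z0 0 k).
    apply: (@continuous_comp _ _ _ (fun t : 'rV[C]_r => t 0 k / rho0 z0 0 k) (@complex.Re R)).
      apply: (@cvgM C _ (nbhs (rho0 z0))); last exact: cvg_cst.
      exact: coord_continuous.
    exact: continuous_Re.
  by apply: (cvgr_gt _ c); rewrite divff ?(rho0_torus z0 k) //= ltr01.
apply: filterS N => t ht.
apply: (@differentiableD C _ _ (cst z0)); first exact: differentiable_cst.
apply: (@differentiable_comp _ _ _ _ (fun t : 'rV[C]_r => \row_k clog (t 0 k / rho0 z0 0 k)) (mulmxr expo_inv)).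
  apply: differentiable_row => k; under eq_fun do rewrite mxE.
  apply: (@differentiable_comp _ _ _ _ (fun t : 'rV[C]_r => t 0 k / rho0 z0 0 k : C^o) (clog : C^o -> C^o)).
    apply: (@differentiableM C _ (fun t : 'rV[C]_r => t 0 k)); first exact: differentiable_coord.
    exact: differentiable_cst.
  exact: clog_differentiable.
exact: differentiable_mulmxr.
Qed.

Lemma sig_extE z0 : \forall t \near rho0 z0, Cm_torus t -> sig_ext z0 t = sig0 t.
Proof.
have N : \forall t \near (rho0 z0 : 'rV[C]_r), forall k,
    `|complex.Im (((sig0 t - z0) *m expo) 0 k)| < 1.
  apply: (@filter_forall _ _ (fun k (t : 'rV[C]_r) => `|complex.Im (((sig0 t - z0) *m expo) 0 k)| < 1)
    (nbhs (rho0 z0))) => k.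
  have c : (fun t : 'rV[C]_r => complex.Im (((sig0 t - z0) *m expo) 0 k)) @ rho0 z0
      --> complex.Im (((sig0 (rho0 z0) - z0) *m expo) 0 k).
    apply: (@continuous_comp _ _ _ (fun t : 'rV[C]_r => ((sig0 t - z0) *m expo) 0 k) (@complex.Im R)).
      apply: (@cvg_coord _ (nbhs (rho0 z0))); apply: (@cvg_mulmx C _ (nbhs (rho0 z0))); last exact: cvg_cst.
      apply: (@cvgB C _ _ (nbhs (rho0 z0))); last exact: cvg_cst.
      by apply: sig0_continuous; exact: rho0_torus.
    exact: continuous_Im.
  have c0 : complex.Im (((sig0 (rho0 z0) - z0) *m expo) 0 k) = 0 by rewrite rho0K subrr mul0mx mxE.
  have lo : -1 < complex.Im (((sig0 (rho0 z0) - z0) *m expo) 0 k) by rewrite c0 ltrN10.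
  have hi : complex.Im (((sig0 (rho0 z0) - z0) *m expo) 0 k) < 1 by rewrite c0 ltr01.
  have N1 : \forall t \near (rho0 z0 : 'rV[C]_r), -1 < complex.Im (((sig0 t - z0) *m expo) 0 k).
    exact: (cvgr_gt _ c _ lo).
  have N2 : \forall t \near (rho0 z0 : 'rV[C]_r), complex.Im (((sig0 t - z0) *m expo) 0 k) < 1.
    exact: (cvgr_lt _ c _ hi).
  by apply: filterS2 N1 N2 => t h1 h2; rewrite ltr_norml h1 h2.
apply: filterS N => t h [z _ tz]; rewrite -tz rho0K in h *.
rewrite /sig_ext (_ : \row_k _ = (z - z0) *m expo).
  by rewrite -mulmxA expoK mulmx1 addrC subrK.
apply/rowP => k; rewrite mxE !rho0E -cexpN -cexpD.
have -> : (z *m expo) 0 k - (z0 *m expo) 0 k = ((z - z0) *m expo) 0 k.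
  by rewrite mulmxBl !mxE.
exact: cexpK.
Qed.

End CmSubgroup.

(** * LVMB manifolds satisfying condition K *)
Section Bihol.
Context {R : realType} {m : nat}.
Local Notation C := (Cx R).
Local Notation r := (m + m)%N.
Variable M : 'M[R]_r.
Hypothesis uM : M \in unitmx.

Lemma Cm_torus_cocompact_Cm : cocompact_Cm_subgroup m (Cm_torus M : set (affine R r)).
Proof.
split; [exact: Cm_torus_subgroup|exact: Cm_torus_closed|exact: Cm_torus_cocompact|].
pose rho (z : affine R m) : fsub (Cm_torus M : set (affine R r)) :=
  exist (fun t => t \in Cm_torus M) (rho0 M z) (mem_set (ex_intro2 _ _ z I erefl)).
pose sig (t : fsub (Cm_torus M : set (affine R r))) : affine R m := sig0 M (set_val t).
have rhoV z : set_val (rho z) = rho0 M z by [].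
have sigK t : rho (sig t) = t.
  have [z _ tz0] := set_valP t; have tz : rho0 M z = set_val t by exact: tz0.
  apply: val_inj; suff h : rho0 M (sig0 M (set_val t)) = set_val t by exact: h.
  by rewrite -tz rho0K.
have crho : continuous rho.
  move=> z; apply: contP => W /nbhs_set_type[V]; rewrite rhoV => rV VW.
  have c : {for (z : 'rV[C]_m), continuous (rho0 M)} := differentiable_continuous (rho0_differentiable M z).
  have N : \forall w \near z, V (rho0 M w) by exact: (c _ rV).
  by apply: filterS N => w Vw; exact: VW.
exists rho, sig; split; last by move=> z w; rewrite !rhoV rho0D.
split=> [z|//||]; first by rewrite /sig rhoV rho0K.
  split=> // z g [g' [hg' gg']].
  apply: (@hol_affine_eq _ _ _ (g' \o rho0 M)).
    have : \forall w \near z, g (rho w) = g' (set_val (rho w)) by exact: (crho z _ gg').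
    by apply: filterS => w e; exact: (esym e).
  apply: hol_affine_comp; last exact: hg'.
  by apply: near_all => w; exact: rho0_differentiable.
split=> [t|t g hg].
  have tT : torus R r (set_val t) by have [GT _ _ _] := Cm_torus_subgroup M; apply: GT; exact: set_valP.
  apply: contP => W tW.
  have N : nbhs (set_val t) (fun s : affine R r => W (sig0 M s)) by exact: (near_cont (sig0_continuous (M := M) tT) tW).
  by apply/nbhs_set_type; exists (fun s : affine R r => W (sig0 M s)).
have tr : set_val t = rho0 M (sig t) by rewrite -rhoV sigK.
exists (g \o sig_ext M (sig t)); split.
  apply: hol_affine_comp; first by rewrite tr; exact: sig_ext_differentiable.
  have -> : sig_ext M (sig t) (set_val t) = sig t => //.
  have := nbhs_singleton (sig_extE uM (sig t)); rewrite -tr; apply; exact: set_valP.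
have N := sig_extE uM (sig t); rewrite -tr in N.
have : \forall s \near t, Cm_torus M (set_val s) -> sig_ext M (sig t) (set_val s) = sig0 M (set_val s).
  exact: (set_val_continuous N).
by apply: filterS => s h /=; rewrite h //; exact: set_valP.
Qed.

Lemma cexp_exprz (z : C) (k : int) : cexp z ^ k = cexp (k%:~R * z).
Proof.
have cX q : cexp z ^+ q = cexp (q%:R * z).
  by elim: q => [|q IH]; rewrite ?expr0 ?mul0r ?cexp0 // exprS IH -cexpD -natr1; congr cexp; ring.
case: k => q; first by rewrite -exprnP cX.
by rewrite NegzE -exprnN cX -cexpN mulrNz mulNr.
Qed.

Context {n : nat}.
Variables (L : 'I_n.+1 -> 'rV[C]_m) (lam : 'I_n.+1 -> 'rV[int]_r) (b : 'rV[R]_r).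
Hypothesis lamE : forall i, map_mx intr (lam i) = realvec (L i) *m M + b.

(** A complex linear form in [z] is a real combination of the entries of (z, i z). *)
Lemma linform_real i z : linform (L i) z = (realC_mx (realvec (L i)) *m (z *m row_mx 1%:M ('i%C)%:M)^T) 0 0.
Proof.
rewrite mul_mx_row mulmx1 mul_mx_scalar tr_row_mx /realC_mx /realvec map_row_mx mul_row_col.
rewrite !mxE -big_split; apply: eq_bigr => j _ /=; rewrite !mxE.
by case: (L i 0 j) (z 0 j) => a c [x y] /=; congr Complex; ring.
Qed.

(** The weights are the affine images of the forms, and the affine part contributes a
    factor independent of [i], invisible in projective space. *)
Lemma tchar_rho0 z i : tchar lam (rho0 M z) i =
  cexp ((realC_mx b *m (z *m expo M)^T) 0 0) * cexp (linform (L i) z).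
Proof.
have -> : tchar lam (rho0 M z) i = cexp ((realC_mx (map_mx intr (lam i)) *m (z *m expo M)^T) 0 0).
  rewrite mxE cexp_sum; apply: eq_bigr => k _; rewrite rho0E cexp_exprz; congr cexp.
  by rewrite !mxE rmorph_int.
have MD : realC_mx (realvec (L i) *m M + b) = realC_mx (realvec (L i)) *m realC_mx M + realC_mx b.
  by rewrite /realC_mx raddfD /= map_mxM.
rewrite lamE MD mulmxDl [X in cexp X]mxE addrC cexpD linform_real; congr (_ * cexp (_ 0 0)).
rewrite -mulmxA; congr (_ *m _).
rewrite -[realC_mx M]trmxK -trmx_mul; congr trmx; rewrite -mulmxA; congr (_ *m _).
have e : realC_mx (invmx M)^T *m (realC_mx M)^T = 1%:M.
  by rewrite /realC_mx -map_trmx -trmx_mul -map_mxM mulmxV // map_mx1 trmx1.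
by rewrite /expo -mulmxA e mulmx1.
Qed.

Lemma LVMB_act_torus z (p : projective R n) : LVMB_act L z p = torus_act lam (rho0 M z) p.
Proof.
rewrite /LVMB_act -(diag_act_scale (d := fun i => cexp (linform (L i) z)) p
  (cexp_neq0 ((realC_mx b *m (z *m expo M)^T) 0 0))); last by move=> i; exact: cexp_neq0.
by apply: diag_act_ext => i; rewrite -tchar_rho0.
Qed.

Lemma LVMB_orbit_torus (p : projective R n) :
  Defs.orbit setT (LVMB_act L) p = Defs.orbit (Cm_torus M) (torus_act lam) p.
Proof.
apply/seteqP; split=> q.
  by move=> [z _ <-]; exists (rho0 M z); rewrite ?LVMB_act_torus //; exists z.
by move=> [_ [z _ <-] <-]; exists z => //; rewrite LVMB_act_torus.
Qed.

End Bihol.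

Lemma biholomorphic_refl {R : realType} (X : fspace R) : biholomorphic X X.
Proof.
by exists id, id; split=> //; split=> // x; exact: cvg_id.
Qed.

Section ConditionK.
Context {R : realType} {m n : nat}.
Local Notation C := (Cx R).

(** Condition (K) provides an integral configuration; after a translation its first
    vector is 0, and [integral_frame] makes its vectors generate the lattice.  Its
    rank is full because each member of [E] spans. *)
Lemma real_frame (L : 'I_n.+1 -> 'rV[C]_m) (E : {set {set 'I_n.+1}}) :
  is_LVMB L E -> condition_K L -> exists (lam : 'I_n.+1 -> 'rV[int]_(m + m)) M b,
  [/\ M \in unitmx, forall i, map_mx intr (lam i) = realvec (L i) *m M + b :> 'rV[R]_(m + m)
    & torus_effective R lam].
Proof.
move=> lv [M [b [uM hK]]].
have /choice[kk kkE] : forall i, exists k : 'rV[int]_(m + m), map_mx intr k = realvec (L i) *m M + b :> 'rV[R]_(m + m).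
  move=> i; have /choice[f fE] := hK i; exists (\row_j f j).
  by apply/rowP => j; rewrite fE !mxE.
(* Differences with the first vector, which the translation b does not affect. *)
pose K : 'M[int]_(n.+1, m + m) := \matrix_i (kk i - kk 0).
pose it p q (A : 'M[int]_(p, q)) : 'M[R]_(p, q) := map_mx intr A.
have rowK' i : it _ _ (row i K) = (realvec (L i) - realvec (L 0)) *m M.
  by rewrite /it rowK map_mxB !kkE mulmxBl opprD addrACA subrr addr0.
have [[m0 nm [A AE] card] _ _] := lv.
have rn : (m + m <= n.+1)%N by rewrite addnn -mul2n ltnW.
have Kinj (v : 'cV[int]_(m + m)) : K *m v = 0 -> v = 0.
  move=> Kv; pose w := M *m it _ _ v.
  have e i : (realvec (L i) *m w) 0 0 = (realvec (L 0) *m w) 0 0.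
    apply/eqP; rewrite -subr_eq0; apply/eqP.
    have -> : (realvec (L i) *m w) 0 0 - (realvec (L 0) *m w) 0 0 =
       ((realvec (L i) - realvec (L 0)) *m w) 0 0 by rewrite mulmxBl !mxE.
    by rewrite /w mulmxA -rowK' -map_mxM -row_mul Kv row0 /it map_mx0 mxE.
  have h0 := geo_inj (lvmb_geo lv) AE (h := col_mx (- (realvec (L 0) *m w) 0 0)%:M w).
  have {}h0 : col_mx (- (realvec (L 0) *m w) 0 0)%:M w = 0.
    apply: h0 => i _.
    have -> : (aff_rows L *m col_mx (- (realvec (L 0) *m w) 0 0)%:M w) i 0 =
       (row i (aff_rows L) *m col_mx (- (realvec (L 0) *m w) 0 0)%:M w) 0 0.
      by rewrite -row_mul [RHS]mxE.
    rewrite row_aff_rows /aff_pt mul_row_col mul1mx [LHS]mxE e mxE eqxx mulr1n.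
    by rewrite addNr.
  have w0 : w = 0 by rewrite -col_mx0 in h0; have [] := eq_col_mx h0.
  have v0 : it _ _ v = 0 by rewrite -(mulKmx uM (it _ _ v)) -/w w0 mulmx0.
  apply/colP => j; have /colP/(_ j) := v0; rewrite !mxE => /eqP.
  by rewrite intr_eq0 => /eqP.
have [Lam [T [c [KE dT cL]]]] := integral_frame rn Kinj.
have uT : it _ _ T \in unitmx by rewrite unitmxE det_map_mx unitfE intr_eq0.
pose M' := M *m invmx (it _ _ T).
have lamE i : it _ _ (row i Lam) = realvec (L i) *m M' - realvec (L 0) *m M'.
  rewrite -mulmxBl /M' mulmxA -rowK' KE row_mul /it map_mxM -/(it _ _ T).
  by rewrite mulmxK.
exists (fun i => row i Lam), M', (- (realvec (L 0) *m M')); split=> //.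
  by rewrite unitmx_mul uM unitmx_inv.
apply: (effective_of_frame (c := c)).
  apply/rowP => j; have /rowP/(_ j) := lamE 0; rewrite subrr !mxE => /eqP.
  by rewrite intr_eq0 => /eqP.
rewrite (_ : \matrix_i row i Lam = Lam) //.
by apply/row_matrixP => i; rewrite rowK.
Qed.

(** The notion of intermediate quotient for an arbitrary rank [r], which allows the rank
    2m to be written as m + m. *)
Definition intermediate_quotient_rank r m' (Q : fspace R) : Prop :=
  exists (lam : 'I_n.+1 -> 'rV[int]_r) (U : set (projective R n)) (G : set (affine R r)),
    [/\ torus_effective R lam, good (torus R r) (torus_act lam) U & cocompact_Cm_subgroup m' G] /\
    biholomorphic Q (orbit_space G (torus_act lam) U).

(** The orbits of the subgroup under the torus action are the orbits of C^m, so the two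
    orbit spaces are equal. *)
Lemma condition_K_GIT (L : 'I_n.+1 -> 'rV[C]_m) (E : {set {set 'I_n.+1}}) :
  is_LVMB L E -> condition_K L -> is_intermediate_GIT_quotient m n (LVMB_manifold L E).
Proof.
move=> lv hK; have [lam [M [b [uM lamE eff]]]] := real_frame lv hK.
have [[m0 nm [A AE] card] _ comp] := lv.
have E_set B : B \in E -> exists i, i \in B.
  by move=> /card cB; apply/set0Pn; rewrite -card_gt0 cB.
have geo : geo_config (lam_rows lam : 'M[R]_(n.+1, 1 + (m + m))) E.
  have -> : lam_rows lam = aff_rows L *m block_mx 1%:M b 0 M.
    apply/row_matrixP => i; rewrite row_mul row_aff_rows rowK lamE /aff_pt.
    by rewrite mul_row_block !mul1mx mulmx0 addr0 addrC.
  apply: geo_config_mulr (lvmb_geo lv).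
  by rewrite unitmxE det_ublock det1 mul1r -unitmxE.
suff : intermediate_quotient_rank (2 * m) m (LVMB_manifold L E).
  by move=> [l [U [G [[h1 h2 h3] h4]]]]; exists l, U, G.
rewrite mul2n -addnn; exists lam, (LVMB_open E), (Cm_torus M); split.
  split=> //; last exact: Cm_torus_cocompact_Cm.
  by apply: torus_good => //; exists A.
rewrite /LVMB_manifold /orbit_space.
rewrite (_ : (fun u : fsub (LVMB_open E : set (projective R n)) => Defs.orbit setT (LVMB_act L) (set_val u)) =
   (fun u => Defs.orbit (Cm_torus M) (torus_act lam) (set_val u))).
  exact: biholomorphic_refl.
by apply/funext => u; exact: LVMB_orbit_torus.
Qed.

End ConditionK.

(** * The family of LVMB manifolds over a set of parameters *)
Section Family.
Context {R : realType} {m n : nat}.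
Local Notation C := (Cx R).
Local Notation k := (n.+1 * m)%N.
Local Notation D := (n.+1 + k)%N.
Implicit Types (w : 'rV[C]_D) (b : 'rV[C]_k) (x : 'rV[C]_n.+1) (z : 'rV[C]_m) (c : C).

(** The linear forms with parameter [b], the entries of the matrix of coefficients. *)
Definition Lb b (i : 'I_n.+1) : 'rV[C]_m := row i (vec_mx b).

Lemma LbE b i j : Lb b i 0 j = b 0 (mxvec_index i j).
Proof. by rewrite !mxE. Qed.

Lemma Lb_mxvec (L : 'I_n.+1 -> 'rV[C]_m) : Lb (mxvec (\matrix_i L i)) = L.
Proof. by apply/funext => i; rewrite /Lb mxvecK rowK. Qed.

(** Over each [b], the action defined by the linear forms with parameter [b]. *)
Definition flow c z w : 'rV[C]_D :=
  row_mx (pscale (lvmb_char (Lb (rsubmx w)) c z) (lsubmx w)) (rsubmx w).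

Lemma rsub_flow c z w : rsubmx (flow c z w) = rsubmx w.
Proof. by rewrite row_mxKr. Qed.

Lemma lsub_flow c z w : lsubmx (flow c z w) = pscale (lvmb_char (Lb (rsubmx w)) c z) (lsubmx w).
Proof. by rewrite row_mxKl. Qed.

Lemma flowD c c' z z' w : flow c z (flow c' z' w) = flow (c * c') (z + z') w.
Proof.
rewrite /flow !row_mxKl !row_mxKr; congr row_mx; apply/rowP => i.
by rewrite !pscaleE /lvmb_char linformD cexpD; ring.
Qed.

Lemma flow10 w : flow 1 0 w = w.
Proof.
rewrite -[RHS]hsubmxK; congr row_mx; apply/rowP => i.
by rewrite pscaleE /lvmb_char linform0 cexp0 !mul1r.
Qed.

Definition family_orbit w : set 'rV[C]_D := [set v | exists c z, c != 0 /\ v = flow c z w].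

Lemma family_orbitP w w' : family_orbit w = family_orbit w' <-> exists c z, c != 0 /\ w' = flow c z w.
Proof.
split=> [e|[c [z [c0 ->]]]].
  have : family_orbit w' w' by exists 1, 0; rewrite oner_eq0 flow10.
  by rewrite -e.
apply/seteqP; split=> _ [d [y [d0 ->]]].
  exists (d / c), (y - z); rewrite mulf_neq0 ?invr_eq0 // flowD.
  by rewrite divfK // subrK.
exists (d * c), (y + z); rewrite mulf_neq0 // flowD; split=> //.
Qed.

Lemma differentiable_lvmb_char (b : 'rV[C]_D -> 'rV[C]_k) c (z : 'rV[C]_D -> 'rV[C]_m) i w :
  (forall j, differentiable (fun v => b v 0 j : C^o) w) ->
  (forall j, differentiable (fun v => z v 0 j : C^o) w) ->
  differentiable (fun v => lvmb_char (Lb (b v)) c (z v) i : C^o) w.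
Proof.
move=> db dz.
apply: (@differentiableM C _ (cst c)); first exact: differentiable_cst.
apply: (@differentiable_comp _ _ _ _ (fun v => linform (Lb (b v) i) (z v) : C^o) (@cexp R : C^o -> C^o)).
  apply: (@differentiable_bigsum C) => j _.
  apply: (@differentiableM C _ (fun v => Lb (b v) i 0 j) (fun v => z v 0 j)); last exact: dz.
  by under eq_fun do rewrite LbE; exact: db.
exact: cexp_differentiable.
Qed.

Lemma rsub_coord w j : rsubmx w 0 j = w 0 (rshift n.+1 j).
Proof. by rewrite mxE. Qed.
Lemma lsub_coord w j : lsubmx w 0 j = w 0 (lshift k j).
Proof. by rewrite mxE. Qed.

Lemma flow_differentiable c z w : differentiable (flow c z) w.
Proof.
apply: (@differentiable_row C) => j; rewrite /flow.
have dr l : differentiable (fun v : 'rV[C]_D => rsubmx v 0 l : C^o) w.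
  by under eq_fun do rewrite rsub_coord; exact: differentiable_coord.
case: (splitP j) => l jl.
  have -> : j = lshift _ l by exact: val_inj.
  under eq_fun do rewrite row_mxEl pscaleE.
  apply: (@differentiableM C _ (fun v => lvmb_char (Lb (rsubmx v)) c z l) (fun v => lsubmx v 0 l)).
    apply: differentiable_lvmb_char => // l'; exact: differentiable_cst.
  by under eq_fun do rewrite lsub_coord; exact: differentiable_coord.
have -> : j = rshift _ l by exact: val_inj.
by under eq_fun do rewrite row_mxEr; exact: dr.
Qed.

Variables (E : {set {set 'I_n.+1}}) (B : set (affine R k)) (beta0 : 'rV[C]_k).
Hypothesis oB : open B.
Hypothesis B0 : B beta0.
Hypothesis E_ne : exists A, A \in E.

Definition family_domain : set (affine R D) :=
  [set w : 'rV[C]_D | supp_open E (lsubmx w) /\ B (rsubmx w)].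

Lemma continuous_rsub : continuous (rsubmx : 'rV[C]_D -> 'rV[C]_k).
Proof.
move=> w; apply: (@cvg_mx _ (nbhs w)) => i j; rewrite (ord1 i) rsub_coord.
by under eq_fun do rewrite rsub_coord; exact: coord_continuous.
Qed.

Lemma continuous_lsub : continuous (lsubmx : 'rV[C]_D -> 'rV[C]_n.+1).
Proof.
move=> w; apply: (@cvg_mx _ (nbhs w)) => i j; rewrite (ord1 i) lsub_coord.
by under eq_fun do rewrite lsub_coord; exact: coord_continuous.
Qed.

Lemma open_family_domain : open family_domain.
Proof.
rewrite openE => w [sw Bw]; rewrite /interior.
have N1 := @open_nbhs_nbhs (affine R n.+1) (lsubmx w) _ (conj (@open_supp_open R n E) sw).
have N2 := @open_nbhs_nbhs (affine R k) (rsubmx w) _ (conj oB Bw).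
have N1' : nbhs (w : affine R D) (fun v : 'rV[C]_D => supp_open E (lsubmx v)) by exact: (continuous_lsub N1).
have N2' : nbhs (w : affine R D) (fun v : 'rV[C]_D => B (rsubmx v)) by exact: (continuous_rsub N2).
by apply: filterS2 N1' N2' => v; split.
Qed.

Lemma domain_flow c z w : c != 0 -> family_domain w -> family_domain (flow c z w).
Proof.
move=> c0 [sw Bw]; split; rewrite ?rsub_flow // lsub_flow.
by apply: supp_open_scale => // i; exact: lvmb_char_neq0.
Qed.

Lemma family_domainI x b : supp_open E x -> B b -> family_domain (row_mx x b).
Proof. by move=> sx Bb; rewrite /family_domain /= row_mxKl row_mxKr. Qed.

Lemma family_domain_ones : family_domain (row_mx (const_mx 1) beta0).
Proof. by apply: family_domainI => //; have [A AE] := E_ne; exists A => // i _; rewrite mxE oner_neq0. Qed.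

(** The scalars and C^m are divided out at once. *)
Definition family_space : fspace R := fquot (fun u : fsub family_domain => family_orbit (set_val u)).

Definition family_pt : set_type family_domain := exist (fun w => w \in family_domain) _ (mem_set family_domain_ones).

Definition qF : affine R D -> family_space :=
  ker_pi (fun u : fsub family_domain => family_orbit (set_val u)) \o insubd family_pt.

Lemma qF_eq w w' : family_domain w -> family_domain w' -> qF w = qF w' <-> exists c z, c != 0 /\ w' = flow c z w.
Proof.
move=> tw tw'; rewrite -family_orbitP.
have := ker_piP (fun u : fsub family_domain => family_orbit (set_val u))
  (insubd family_pt w : fsub family_domain) (insubd family_pt w' : fsub family_domain).
by rewrite (set_val_insubd family_pt tw) (set_val_insubd family_pt tw').
Qed.

Lemma presents_family : presents family_domain qF.
Proof.
have := presents_open_sub family_pt (@presents_affine R D) open_family_domain.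
have -> : [set: affine R D] `&` id @^-1` family_domain = family_domain by rewrite setTI.
move=> pr; apply: (presents_quot (f := fun u : fsub family_domain => family_orbit (set_val u)) pr).
move=> w w' tw tw'; rewrite !set_val_insubd // => /family_orbitP[c [z [c0 e]]].
exists (flow c z); split=> //.
have N : \forall y \near (w : affine R D), family_domain y.
  by apply: open_nbhs_nbhs; split=> //; exact: open_family_domain.
apply: filterS N => y ty; have ty' := domain_flow z c0 ty.
split=> //; last exact: flow_differentiable.
rewrite !set_val_insubd //; apply/family_orbitP; exists c^-1, (- z).
by rewrite invr_eq0 flowD mulVf // addNr flow10.
Qed.

(** The group preserves the parameter, so the choice of a representative is immaterial. *)
Definition base_of (y : family_space) : affine R k := rsubmx (set_val (ker_repr y) : 'rV[C]_D).

Lemma base_qF w : family_domain w -> base_of (qF w) = rsubmx w.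
Proof.
move=> tw.
have := f_ker_repr (fun u : fsub family_domain => family_orbit (set_val u)) (insubd family_pt w : fsub family_domain).
rewrite [in RHS]set_val_insubd // => /family_orbitP[c [z [_ e]]].
by rewrite [in RHS]e rsub_flow.
Qed.

Lemma base_range : range base_of = B.
Proof.
apply/seteqP; split=> [_ [y _ <-]|b Bb].
  by have [] := set_valP (ker_repr y).
have t : family_domain (row_mx (const_mx 1) b).
  by apply: family_domainI => //; have [A AE] := E_ne; exists A => // i _; rewrite mxE oner_neq0.
by exists (qF (row_mx (const_mx 1) b)) => //; rewrite base_qF // row_mxKr.
Qed.

Lemma base_holomorphic : holomorphic base_of.
Proof.
have near_base w : family_domain w -> \forall v \near w, base_of (qF v) = rsubmx v.
  move=> tw; apply: filterS (pres_near_dom presents_family tw) => v; exact: base_qF.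
split.
  apply: (pres_continuous presents_family) => w tw; apply: contP => W; rewrite /= base_qF // => bW.
  have N : \forall v \near w, W (rsubmx v) by exact: (continuous_rsub bW).
  by apply: filterS2 N (near_base w tw) => v; rewrite /= => Wv ->.
move=> y g; have [w tw <-] := pres_surj presents_family y; rewrite base_qF // => hg.
apply: (proj2 (pres_hol presents_family _ tw)).
have h : hol_at (w : affine R D) (g \o (rsubmx : affine R D -> affine R k)).
  apply: hol_affine_comp hg; apply: near_all => v.
  apply: (@differentiable_row C) => j; under eq_fun do rewrite rsub_coord; exact: differentiable_coord.
by apply: hol_affine_eq h; apply: filterS (near_base w tw) => v /= ->.
Qed.

End Family.

(** * Properness and separation of the family *)
Lemma cvg_cexp {R : realType} {T : Type} {F : set_system T} {FF : Filter F} (f : T -> Cx R) (l : Cx R) :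
  f @ F --> l -> (fun t => cexp (f t)) @ F --> cexp l.
Proof.
move=> h; apply: (@cvg_comp _ _ _ f (@cexp R) F (nbhs l) (nbhs (cexp l)) h); exact: continuous_cexp.
Qed.

Section RealParts.
Context {R : realType} {m n : nat}.
Local Notation C := (Cx R).
Implicit Types (L : 'I_n.+1 -> 'rV[C]_m) (z : 'rV[C]_m) (c : C).

(** The real vector on which the rows (1, [l_i]) give the logarithms of the moduli of
    the characters. *)
Definition hcol c z : 'cV[R]_(1 + (m + m)) :=
  col_mx (ln (cmod c))%:M (row_mx (map_mx (@complex.Re R) z) (- map_mx (@complex.Im R) z))^T.

Lemma Re_linform (l z : 'rV[C]_m) : complex.Re (linform l z) =
  (realvec l *m (row_mx (map_mx (@complex.Re R) z) (- map_mx (@complex.Im R) z))^T) 0 0.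
Proof.
rewrite /linform Re_bigsum tr_row_mx /realvec mul_row_col [RHS]mxE.
rewrite mxE [X in _ + X]mxE -big_split; apply: eq_bigr => j _ /=; rewrite !mxE.
by case: (l 0 j) (z 0 j) => a b [x y] /=; rewrite mulrN.
Qed.

Lemma aff_hcol L c z i : (aff_rows L *m hcol c z) i 0 = ln (cmod c) + complex.Re (linform (L i) z).
Proof.
have -> : (aff_rows L *m hcol c z) i 0 = (row i (aff_rows L) *m hcol c z) 0 0.
  by rewrite -row_mul [RHS]mxE.
rewrite row_aff_rows /aff_pt mul_row_col mul1mx [LHS]mxE Re_linform; congr (_ + _).
by rewrite mxE eqxx mulr1n.
Qed.

Lemma cmod_lvmb_char L c z i : c != 0 ->
  cmod (lvmb_char L c z i) = expR ((aff_rows L *m hcol c z) i 0).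
Proof. by move=> c0; rewrite aff_hcol expRD lnK ?posrE ?cmod_gt0 // cmodM cmod_cexp. Qed.

(** Any real vector arises, so moduli can be adjusted freely by the group. *)
Lemma hcol_surj (h : 'cV[R]_(1 + (m + m))) : exists c z, c != 0 /\ hcol c z = h.
Proof.
pose v := dsubmx h.
exists (expR (usubmx h 0 0))%:C, (\row_j (v (lshift m j) 0 +i* (- v (rshift m j) 0))).
have p : 0 < cmod (expR (usubmx h 0 0))%:C by rewrite cmod_real gtr0_norm expR_gt0.
split; first by rewrite -cmod_gt0.
rewrite /hcol cmod_real gtr0_norm ?expR_gt0 // expRK -[RHS]vsubmxK; congr col_mx.
  by apply/colP => i; rewrite (ord1 i) [LHS]mxE eqxx mulr1n.
apply/colP => i; rewrite mxE -/v; case: (splitP i) => j ij.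
  have -> : i = lshift _ j by exact: val_inj.
  by rewrite row_mxEl !mxE.
have -> : i = rshift _ j by exact: val_inj.
by rewrite row_mxEr !mxE opprK.
Qed.

Lemma hcol_c c z : hcol c z (lshift _ 0) 0 = ln (cmod c).
Proof. by rewrite col_mxEu mxE eqxx mulr1n. Qed.

Lemma hcol_Re c z j : hcol c z (rshift 1 (lshift m j)) 0 = complex.Re (z 0 j).
Proof. by rewrite col_mxEd mxE row_mxEl mxE. Qed.

Lemma hcol_Im c z j : hcol c z (rshift 1 (rshift m j)) 0 = - complex.Im (z 0 j).
Proof. by rewrite col_mxEd mxE row_mxEr !mxE. Qed.

Lemma near_moduli (x : 'rV[C]_n.+1) (A : {set 'I_n.+1}) : (forall i, i \in A -> x 0 i != 0) ->
  exists2 c : R, 0 <= c & \forall y \near x, (forall i, cmod ((y : 'rV[C]_n.+1) 0 i) < expR c) /\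
    forall i, i \in A -> expR (- c) < cmod ((y : 'rV[C]_n.+1) 0 i).
Proof.
move=> xA; pose c := 1 + \sum_i `|ln (cmod (x 0 i))|.
have ci i : `|ln (cmod (x 0 i))| < c.
  rewrite /c (bigD1 i) //= addrCA ltrDl ltr_pwDl // sumr_ge0 //.
have c0 : 0 <= c by rewrite addr_ge0 // sumr_ge0.
have h1 : \forall y \near x, forall i, cmod ((y : 'rV[C]_n.+1) 0 i) < expR c.
  apply: (@filter_forall _ _ (fun i (z : 'rV[C]_n.+1) => cmod (z 0 i) < expR c) (nbhs x)) => i.
  apply: (cvgr_lt _ (@continuous_cmod_coord R n i x)).
  have [->|xi] := eqVneq (x 0 i) 0; first by rewrite cmod0 expR_gt0.
  rewrite -[ltLHS]lnK ?posrE ?cmod_gt0 // ltr_expR; apply: le_lt_trans (ci i); exact: ler_norm.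
have h2 : \forall y \near x, forall i, i \in A -> expR (- c) < cmod ((y : 'rV[C]_n.+1) 0 i).
  apply: (@filter_forall _ _ (fun i (z : 'rV[C]_n.+1) => i \in A -> expR (- c) < cmod (z 0 i)) (nbhs x)) => i.
  have [iA|_] := boolP (i \in A); last by apply: (@filterE _ (nbhs x)).
  have h : \forall z \near x, expR (- c) < cmod ((z : 'rV[C]_n.+1) 0 i).
    apply: (cvgr_gt _ (@continuous_cmod_coord R n i x)).
    rewrite -[ltRHS]lnK ?posrE ?cmod_gt0 ?xA // ltr_expR ltrNl; apply: le_lt_trans (ci i).
    by rewrite -normrN; exact: ler_norm.
  by apply: filterS h => z ? _.
by exists c => //; apply: filterS2 h1 h2 => y; split.
Qed.

End RealParts.

Section FamilyTopology.
Context {R : realType} {m n : nat}.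
Local Notation C := (Cx R).
Local Notation k := (n.+1 * m)%N.
Local Notation D := (n.+1 + k)%N.
Implicit Types (w : 'rV[C]_D) (b : 'rV[C]_k) (x : 'rV[C]_n.+1) (z : 'rV[C]_m) (c : C).
Variables (E : {set {set 'I_n.+1}}) (B : set (affine R k)) (beta0 : 'rV[C]_k) (K : R).
Hypothesis oB : open B.
Hypothesis B0 : B beta0.
Hypothesis E_ne : exists A, A \in E.
Hypothesis comp : forall A i, A \in E -> exists2 j, j \in A & i |: (A :\ j) \in E.
Hypothesis K0 : 0 < K.
Hypothesis unif : forall b, B b -> unif_config K (aff_rows (Lb b) : 'M[R]_(n.+1, 1 + (m + m))) E.
Local Notation fam := (@family_space R m n E B).
Local Notation qF := (qF B0 E_ne).

(** The inverse image of a compact set of parameters is the image of its product with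
    the compact set [fundamental]. *)
Lemma family_proper (Q : set (affine R k)) : Q `<=` B -> compact Q ->
  compact (@base_of R m n E B @^-1` Q).
Proof.
move=> QB cQ; have pr := presents_family oB B0 E_ne.
pose F : set (affine R D) := (fun p : 'rV[C]_n.+1 * 'rV[C]_k => row_mx p.1 p.2) @` (fundamental E `*` Q).
have cF : compact F.
  apply: (@continuous_compact _ 'rV[C]_D).
    apply: continuous_subspaceT => p; apply: (@cvg_mx _ (nbhs p)) => i j.
    rewrite (ord1 i); case: (splitP j) => l jl.
      have -> : j = lshift _ l by exact: val_inj.
      rewrite row_mxEl; under eq_fun do rewrite row_mxEl.
      by apply: (@cvg_coord _ (nbhs p)); exact: cvg_fst.
    have -> : j = rshift _ l by exact: val_inj.
    rewrite row_mxEr; under eq_fun do rewrite row_mxEr.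
    by apply: (@cvg_coord _ (nbhs p)); exact: cvg_snd.
  by apply: compact_setX => //; exact: compact_fundamental.
have FT : F `<=` family_domain E B.
  move=> _ [[x b] [/= Fx Qb] <-]; apply: family_domainI; last exact: QB.
  exact: fundamental_supp.
have := pres_compact pr cF FT; congr compact; apply/seteqP; split=> [_ [w Fw <-]|y /= Qy].
  rewrite /= base_qF; last exact: FT.
  by have [[x b] [/= _ Qb] <-] := Fw; rewrite row_mxKr.
have [w tw wy] := pres_surj pr y; have [sw Bw] := tw.
have Qw : Q (rsubmx w) by rewrite -(base_qF B0 E_ne tw) wy.
have [h [hle [A AE hA]]] := normalize (geo_cone (unif_cfg (unif Bw))) comp sw.
have [c [z [c0 hcz]]] := hcol_surj (- h).
have e i : cmod (lsubmx (flow c z w) 0 i) = cmod (lsubmx w 0 i) * expR (- (aff_rows (Lb (rsubmx w)) *m h) i 0).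
  rewrite lsub_flow pscaleE cmodM cmod_lvmb_char // hcz mulrC; congr (_ * expR _).
  by rewrite mulmxN mxE.
exists (flow c z w).
  exists (lsubmx (flow c z w), rsubmx w); last by rewrite /= lsub_flow.
  split=> //=; split=> [i|]; first by rewrite e.
  by exists A => // i iA; rewrite e hA.
rewrite -wy; apply/(qF_eq B0 E_ne); [exact: domain_flow|exact: tw|].
exists c^-1, (- z); rewrite invr_eq0; split=> //.
by rewrite flowD mulVf // addNr flow10.
Qed.

Lemma near_coord_neq {T : topologicalType} (t : T) (f g : T -> 'rV[C]_n.+1) :
  (forall i, (fun s => f s 0 i) @ t --> f t 0 i) -> (forall i, (fun s => g s 0 i) @ t --> g t 0 i) ->
  f t <> g t -> \forall s \near t, f s <> g s.
Proof.
move=> cf cg fg; have /existsP[i fgi] : [exists i, f t 0 i - g t 0 i != 0].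
  apply: contrapT => /negP; rewrite negb_exists => /forallP h; apply: fg.
  by apply/rowP => i; apply/eqP; rewrite -subr_eq0; have := h i; rewrite negbK.
have cfg : (fun s => f s 0 i - g s 0 i) @ t --> f t 0 i - g t 0 i.
  by apply: (@cvgB C C _ (nbhs t)); [exact: cf|exact: cg].
have N : \forall s \near t, f s 0 i - g s 0 i != 0 by exact: (cvgr_neq0 _ cfg fgi).
by apply: filterS N => s; apply: contra_neq_not => ->; rewrite subrr.
Qed.

Lemma cvg_flow {T : Type} {F : set_system T} {FF : Filter F} (c : T -> C) (z : T -> 'rV[C]_m) (w : T -> 'rV[C]_D)
    c1 z1 w1 i : c @ F --> c1 -> z @ F --> z1 -> w @ F --> w1 ->
  (fun t => lsubmx (flow (c t) (z t) (w t)) 0 i) @ F --> lsubmx (flow c1 z1 w1) 0 i.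
Proof.
move=> hc hz hw.
have lE c2 z2 w2 : lsubmx (flow c2 z2 w2) 0 i = c2 * cexp (linform (Lb (rsubmx w2) i) z2) * w2 0 (lshift k i).
  by rewrite lsub_flow pscaleE lsub_coord.
rewrite lE; under eq_fun do rewrite lE.
apply: cvgM; last exact: cvg_coord.
have hl : (fun t => linform (Lb (rsubmx (w t)) i) (z t)) @ F --> linform (Lb (rsubmx w1) i) z1.
  apply: cvg_bigsum => j _.
  rewrite LbE rsub_coord; under eq_fun do rewrite LbE rsub_coord.
  by apply: cvgM; exact: cvg_coord.
apply: cvgM; first exact: hc.
exact: cvg_cexp.
Qed.

(** Points over distinct parameters are separated by them.  Over the same parameter,
    group elements that carry a point near [w] to a point near [w'] stay in a compact
    set by [unif_proper], uniformly in the parameter; and none of the elements of this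
    compact set carries [w] to [w']. *)
Lemma family_hausdorff : hausdorff_space fam.
Proof.
have pr := presents_family oB B0 E_ne.
apply: (pres_hausdorff pr) => w w' tw tw' qne.
have [bb|bb] := eqVneq (rsubmx w) (rsubmx w'); last first.
  have hH : hausdorff_space 'rV[C]_k by exact: norm_hausdorff.
  rewrite open_hausdorff in hH.
  have [[V W] [/= /set_mem Vw /set_mem Ww'] [oV oW /eqP VW]] := hH _ _ bb.
  exists (fun v => V (rsubmx v)), (fun v => W (rsubmx v)); split.
  - exact: (continuous_rsub (open_nbhs_nbhs (conj oV Vw))).
  - exact: (continuous_rsub (open_nbhs_nbhs (conj oW Ww'))).
  move=> v v' tv tv' Vv Wv' /(qF_eq B0 E_ne tv tv')[c [z [_ e]]].
  have : (V `&` W) (rsubmx v) by split=> //; rewrite e rsub_flow in Wv'.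
  by rewrite VW.
have [[A AE xA] _] := tw; have [[A' AE' xA'] _] := tw'.
have [d d0 N] := near_moduli xA; have [d' d'0 N'] := near_moduli xA'.
(* Moduli of the coordinates lie between exp (-d) and exp d near w, on A, and
   between exp (-d') and exp d' near w', on A'; upper bounds hold for all indices. *)
pose e := d + d'; have e0 : 0 <= e by rewrite addr_ge0.
(* The bound of [unif_proper], and the compact set Q of group elements. *)
pose Z := K * (e + K * (n.+1%:R * (K * e) + n.+1%:R * (K * e))).
pose Q : set (C * 'rV[C]_m) := [set c : C | expR (- Z) <= cmod c <= expR Z] `*` [set z : 'rV[C]_m | forall j, cbox Z (z 0 j)].
have cQ : compact Q.
  apply: compact_setX; last exact: compact_polycbox.
  have cl : closed [set c : C | expR (- Z) <= cmod c <= expR Z].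
    rewrite (_ : [set c : C | _] = (cmod : C -> R) @^-1` ([set y | expR (- Z) <= y] `&` [set y | y <= expR Z])).
      apply: closed_comp; first by move=> x _; exact: continuous_cmod.
      by apply: closedI; [exact: closed_ge|exact: closed_le].
    by apply/seteqP; split=> x /=; [move/andP|move=> ?; apply/andP].
  apply: (subclosed_compact cl (@compact_cbox R (expR Z))) => c /= /andP[_ h].
  exact: cbox_cmod.
pose P (vv : 'rV[C]_D * 'rV[C]_D) (cz : C * 'rV[C]_m) :=
  lsubmx (flow cz.1 cz.2 vv.1) <> lsubmx vv.2.
have NP : \forall vv \near ((w, w') : 'rV[C]_D * 'rV[C]_D), Q `<=` P vv.
  (* That an element of Q does not carry v to v' is an open condition in all three. *)
  move/compact_near_coveringP: cQ => ncQ; apply: (ncQ ('rV[C]_D * 'rV[C]_D)%type (nbhs ((w, w') : 'rV[C]_D * 'rV[C]_D)) P _) => -[c z] /= [/andP[cZ _] _].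
  have c0 : c != 0 by rewrite -cmod_gt0; apply: lt_le_trans cZ; exact: expR_gt0.
  have ne : lsubmx (flow c z w) <> lsubmx w'.
    move=> h; apply: qne; apply/(qF_eq B0 E_ne tw tw'); exists c, z; split=> //.
    by rewrite -[LHS]hsubmxK -[RHS]hsubmxK h rsub_flow bb.
  pose f (s : (C * 'rV[C]_m) * ('rV[C]_D * 'rV[C]_D)) := lsubmx (flow s.1.1 s.1.2 s.2.1).
  pose g (s : (C * 'rV[C]_m) * ('rV[C]_D * 'rV[C]_D)) := lsubmx s.2.2.
  have : \forall s \near ((c, z), (w, w')), f s <> g s; last by [].
  apply: near_coord_neq; last exact: ne.
    move=> i; apply: (@cvg_flow _ (nbhs ((c, z), (w, w')))).
    - by apply: (@cvg_comp _ _ _ fst fst _ (nbhs (c, z))); exact: cvg_fst.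
    - by apply: (@cvg_comp _ _ _ fst snd _ (nbhs (c, z))); [exact: cvg_fst|exact: cvg_snd].
    by apply: (@cvg_comp _ _ _ snd fst _ (nbhs (w, w'))); [exact: cvg_snd|exact: cvg_fst].
  move=> i; rewrite /g lsub_coord; under eq_fun do rewrite lsub_coord.
  apply: (@cvg_coord _ (nbhs ((c, z), (w, w')))).
  by apply: (@cvg_comp _ _ _ snd snd _ (nbhs (w, w'))); exact: cvg_snd.
have [[V1 W1] [/= V1w W1w] VW1] := NP.
exists (V1 `&` (fun v => [set y : 'rV[C]_n.+1 | (forall i, cmod (y 0 i) < expR d) /\
    forall i, i \in A -> expR (- d) < cmod (y 0 i)] (lsubmx v))),
  (W1 `&` (fun v => [set y : 'rV[C]_n.+1 | (forall i, cmod (y 0 i) < expR d') /\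
    forall i, i \in A' -> expR (- d') < cmod (y 0 i)] (lsubmx v))); split.
- by apply: filterI => //; exact: (continuous_lsub N).
- by apply: filterI => //; exact: (continuous_lsub N').
move=> v v' tv tv' [V1v [vM vm]] [W1v' [v'M v'm]] /(qF_eq B0 E_ne tv tv')[c [z [c0 ev]]].
apply: (VW1 (v, v') (conj V1v W1v') (c, z)); last by rewrite /P /= ev.
have u := unif tv.2.
pose h := hcol c z.
have hE i : cmod (lsubmx v' 0 i) = expR ((aff_rows (Lb (rsubmx v)) *m h) i 0) * cmod (lsubmx v 0 i).
  by rewrite ev lsub_flow pscaleE cmodM cmod_lvmb_char.
have hA i : i \in A -> (aff_rows (Lb (rsubmx v)) *m h) i 0 <= e.
  move=> iA; rewrite -ler_expR -(ler_pM2r (lt_trans (expR_gt0 _) (vm i iA))) -hE.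
  apply: (le_trans (ltW (v'M i))).
  apply: (@le_trans _ _ (expR e * expR (- d))); first by rewrite -expRD ler_expR /e addrAC subrr add0r.
  by rewrite ler_wpM2l ?expR_ge0 // ltW // vm.
have hA' i : i \in A' -> - e <= (aff_rows (Lb (rsubmx v)) *m h) i 0.
  move=> iA; have v0 : 0 < cmod (lsubmx v 0 i).
    rewrite cmod_gt0; apply/negP => /eqP vi.
    by have := v'm i iA; rewrite hE vi cmod0 mulr0 ltNge expR_ge0.
  rewrite -ler_expR -(ler_pM2r v0) -hE; apply: le_trans (ltW (v'm i iA)).
  apply: (@le_trans _ _ (expR (- e) * expR d)); first by rewrite ler_wpM2l ?expR_ge0 // ltW.
  by rewrite -expRD ler_expR /e opprD addrAC addNr add0r.
have bd := unif_proper K0 e0 u AE AE' hA hA'.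
split=> /= [|j].
  have := bd (lshift _ 0); rewrite /h hcol_c ler_norml => /andP[b1 b2].
  by rewrite -(@lnK R (cmod c)) ?posrE ?cmod_gt0 // !ler_expR b1 b2.
split; first by have := bd (rshift 1 (lshift m j)); rewrite /h hcol_Re.
by have := bd (rshift 1 (rshift m j)); rewrite /h hcol_Im normrN.
Qed.

End FamilyTopology.

(** * Complex coordinates of the action *)
Section ComplexFrame.
Context {R : realType} {m n : nat}.
Local Notation C := (Cx R).
Variables (L : 'I_n.+1 -> 'rV[C]_m) (E : {set {set 'I_n.+1}}) (A : {set 'I_n.+1}).
Hypothesis geo : geo_config (aff_rows L : 'M[R]_(n.+1, 1 + (m + m))) E.
Hypothesis AE : A \in E.

(** The complex analogue of [aff_rows], on which the group acts by its exponents. *)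
Definition complex_rows : 'M[C]_(n.+1, 1 + m) := \matrix_i row_mx 1%:M (L i).

Lemma complex_rowsE (u : 'cV[C]_(1 + m)) i : (complex_rows *m u) i 0 = usubmx u 0 0 + linform (L i) (dsubmx u)^T.
Proof.
have -> : (complex_rows *m u) i 0 = (row i complex_rows *m u) 0 0 by rewrite -row_mul [RHS]mxE.
rewrite rowK -{1}[u]vsubmxK mul_row_col mul1mx [LHS]mxE; congr (_ + _).
by rewrite mxE; apply: eq_bigr => j _; rewrite [in RHS]mxE.
Qed.

(** A complex solution has as real part a real solution of the same equations, which
    [hcol] makes explicit. *)
Lemma complex_rows_inj (u : 'cV[C]_(1 + m)) : (forall i, i \in A -> (complex_rows *m u) i 0 = 0) -> u = 0.
Proof.
move=> uA; pose ze := usubmx u 0 0; pose z := (dsubmx u)^T.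
have h0 : hcol (cexp ze) z = 0.
  apply: (geo_inj geo AE) => i /uA; rewrite complex_rowsE aff_hcol cmod_cexp expRK => /(congr1 (@complex.Re R)).
  by rewrite -/ze -/z; case: (ze) (linform _ _) => [a b] [c d] /=.
have z0 : z = 0.
  apply/rowP => j; rewrite [RHS]mxE.
  have hR := hcol_Re (cexp ze) z j; have hI := hcol_Im (cexp ze) z j.
  rewrite h0 mxE in hR; rewrite h0 mxE in hI.
  move/esym/eqP: hI; rewrite oppr_eq0 => /eqP hI.
  by case: (z 0 j) hI (esym hR) => a b /= -> ->.
have [i iA] : exists i, i \in A by apply/set0Pn; rewrite -card_gt0 (geo_card geo AE).
have := uA i iA; rewrite complex_rowsE -/z z0 linform0 addr0 => ze0.
rewrite -[u]vsubmxK -col_mx0; congr col_mx.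
  by apply/colP => k; rewrite (ord1 k) ze0 mxE.
by rewrite -[dsubmx u]trmxK -/z z0 trmx0.
Qed.

Lemma complex_frame : exists f : 'I_(1 + m) -> 'I_n.+1,
  [/\ injective f, forall k, f k \in A & rowsub f complex_rows \in unitmx].
Proof.
pose AA : 'M[C]_(n.+1, 1 + m) := \matrix_i (if i \in A then row i complex_rows else 0).
have AAE (u : 'cV[C]_(1 + m)) i : i \in A -> (AA *m u) i 0 = (complex_rows *m u) i 0.
  move=> iA; have -> : (AA *m u) i 0 = (row i AA *m u) 0 0 by rewrite -row_mul [RHS]mxE.
  by rewrite rowK iA -row_mul [LHS]mxE.
have full : row_full AA.
  rewrite /row_full -mxrank_tr -/(row_free _) -kermx_eq0.
  apply/eqP/row_matrixP => i; rewrite row0; apply: (can_inj trmxK); rewrite trmx0.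
  apply: complex_rows_inj => j jA; rewrite -AAE //.
  have -> : AA *m (row i (kermx AA^T))^T = (row i (kermx AA^T) *m AA^T)^T by rewrite trmx_mul trmxK.
  by rewrite -row_mul mulmx_ker row0 trmx0 mxE.
have uf := fullrowsub_unit full; set f := fullrankfun full in uf.
have fA k : f k \in A.
  apply: contraT => fk; suff : (1%:M : 'M[C]_(1 + m)) k k = 0.
    by rewrite mxE eqxx => /eqP; rewrite oner_eq0.
  have r0 : row k (rowsub f AA) = 0 by rewrite row_rowsub rowK (negbTE fk).
  have := row_mul k (rowsub f AA) (invmx (rowsub f AA)); rewrite r0 mul0mx mulmxV //.
  by move/rowP/(_ k); rewrite !mxE.
exists f; split=> //; first exact: fullrankfun_inj.
suff -> : rowsub f complex_rows = rowsub f AA by [].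
by apply/row_matrixP => k; rewrite !row_rowsub [RHS]rowK fA.
Qed.

Lemma lvmb_char_rows (u : 'cV[C]_(1 + m)) i :
  lvmb_char L (cexp (- usubmx u 0 0)) (- (dsubmx u)^T) i = cexp (- (complex_rows *m u) i 0).
Proof. by rewrite complex_rowsE opprD cexpD /lvmb_char linformN. Qed.

End ComplexFrame.

Section Fill.
Context {R : realType} {n p q : nat}.
Local Notation C := (Cx R).
Variables (f : 'I_p -> 'I_n) (g : 'I_q -> 'I_n) (x0 : 'rV[C]_n).
Hypothesis g_inj : injective g.
Hypothesis g_f : forall i, (exists j, g j = i) <-> ~ exists k, f k = i.

(** Coordinates with index in the image of [g] are free, the others are those of [x0]. *)
Definition fill (u : 'rV[C]_q) : 'rV[C]_n :=
  \row_i (if [pick j | g j == i] is Some j then u 0 j else x0 0 i).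

Lemma fill_g u j : fill u 0 (g j) = u 0 j.
Proof.
rewrite mxE; case: pickP => [j' /eqP/g_inj -> //|/(_ j)].
by rewrite eqxx.
Qed.

Lemma fill_f u k : fill u 0 (f k) = x0 0 (f k).
Proof.
rewrite mxE; case: pickP => [j' /eqP e|//].
by case: ((proj1 (g_f (f k))) (ex_intro _ j' e)); exists k.
Qed.

Lemma fillK (y : 'rV[C]_n) : (forall k, y 0 (f k) = x0 0 (f k)) -> fill (\row_j y 0 (g j)) = y.
Proof.
move=> yf; apply/rowP => i; have [[j <-]|ng] := pselect (exists j, g j = i).
  by rewrite fill_g mxE.
have [[k <-]|nf] := pselect (exists k, f k = i); first by rewrite fill_f yf.
by case: ng; apply/g_f.
Qed.

Lemma fill_differentiable u : differentiable fill u.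
Proof.
apply: (@differentiable_row C) => i; under eq_fun do rewrite mxE.
by case: pickP => [j _|_]; [exact: differentiable_coord|exact: differentiable_cst].
Qed.

End Fill.

(** * Slices of the family *)
Section Slice.
Context {R : realType} {m n : nat}.
Local Notation C := (Cx R).
Local Notation k := (n.+1 * m)%N.
Local Notation D := (n.+1 + k)%N.
Local Notation d := (n - m + k)%N.
Variables (f : 'I_(1 + m) -> 'I_n.+1) (g : 'I_(n - m) -> 'I_n.+1) (x0 : 'rV[C]_n.+1).
Hypothesis g_inj : injective g.
Hypothesis g_f : forall i, (exists j, g j = i) <-> ~ exists l, f l = i.
Hypothesis x0f : forall l, x0 0 (f l) != 0.
Implicit Types (w : 'rV[C]_D) (b : 'rV[C]_k).

Definition frame b : 'M[C]_(1 + m) := rowsub f (complex_rows (Lb b)).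

(** The coordinates of index [f l] are frozen, and the group has m+1 parameters to
    adjust them. *)
Definition slice (e : 'rV[C]_d) : 'rV[C]_D := row_mx (fill g x0 (lsubmx e)) (rsubmx e).

Definition ratios w : 'cV[C]_(1 + m) := \col_l clog (lsubmx w 0 (f l) / x0 0 (f l)).

(** The exponents of the group element that brings the frozen coordinates back to
    their values at [x0]. *)
Definition solve w : 'cV[C]_(1 + m) := invmx (frame (rsubmx w)) *m ratios w.

Definition slide w : 'rV[C]_D :=
  flow (cexp (- usubmx (solve w) 0 0)) (- (dsubmx (solve w))^T) w.

Definition retract w : 'rV[C]_d := row_mx (\row_j lsubmx (slide w) 0 (g j)) (rsubmx w).

(** The set where the exponents are defined: the frame is invertible and the logarithms
    of the ratios exist. *)
Definition slidable w := frame (rsubmx w) \in unitmx /\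
  forall l, 0 < complex.Re (lsubmx w 0 (f l) / x0 0 (f l)).

Lemma lsub_slide w i : lsubmx (slide w) 0 i =
  cexp (- (complex_rows (Lb (rsubmx w)) *m solve w) i 0) * lsubmx w 0 i.
Proof. by rewrite lsub_flow pscaleE lvmb_char_rows. Qed.

Lemma slide_f w l : slidable w -> lsubmx (slide w) 0 (f l) = x0 0 (f l).
Proof.
move=> [uw w0]; rewrite lsub_slide.
have -> : (complex_rows (Lb (rsubmx w)) *m solve w) (f l) 0 = (frame (rsubmx w) *m solve w) l 0.
  by rewrite mul_rowsub_mx [RHS]mxE.
rewrite /solve mulKVmx //.
have -> : ratios w l 0 = clog (lsubmx w 0 (f l) / x0 0 (f l)) by rewrite mxE.
rewrite cexpN clogK // invf_div divfK //.
by apply: contraTneq (w0 l) => ->; rewrite mul0r ltxx.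
Qed.

Lemma slice_retract w : slidable w -> slice (retract w) = slide w.
Proof.
move=> sw; rewrite /slice /retract row_mxKl row_mxKr -[RHS]hsubmxK rsub_flow.
congr row_mx; apply: fillK => // l; exact: slide_f.
Qed.

Lemma retract_slice e : retract (slice e) = e.
Proof.
have r0 : ratios (slice e) = 0.
  apply/colP => l; rewrite mxE [RHS]mxE /slice row_mxKl fill_f // divff //.
  by rewrite -(@cexp0 R) cexpK //= normr0 ltr01.
have s0 : slide (slice e) = slice e.
  rewrite /slide /solve r0 mulmx0 !linear0 mxE oppr0 cexp0.
  exact: flow10.
rewrite /retract s0 /slice row_mxKl row_mxKr -[RHS]hsubmxK; congr row_mx.
by apply/rowP => j; rewrite mxE fill_g.
Qed.

Lemma slice_differentiable e : differentiable slice e.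
Proof.
apply: (@differentiable_row C) => j; rewrite /slice.
case: (splitP j) => l jl.
  have -> : j = lshift _ l by exact: val_inj.
  under eq_fun do rewrite row_mxEl mxE.
  case: pickP => [j' _|_]; last exact: differentiable_cst.
  by under eq_fun do rewrite mxE; exact: differentiable_coord.
have -> : j = rshift _ l by exact: val_inj.
by under eq_fun do rewrite row_mxEr mxE; exact: differentiable_coord.
Qed.

Lemma frame_continuous w : {for w, continuous (fun v => frame (rsubmx v))}.
Proof.
apply: (@cvg_mx _ (nbhs w)) => i j; case: (splitP j) => l jl.
  have -> : j = lshift _ l by exact: val_inj.
  have e v : frame (rsubmx v) i (lshift m l) = (1%:M : 'M[C]_1) 0 l by rewrite mxE mxE row_mxEl.
  by rewrite e; under eq_fun do rewrite e; exact: cvg_cst.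
have -> : j = rshift _ l by exact: val_inj.
have e v : frame (rsubmx v) i (rshift 1 l) = v 0 (rshift n.+1 (mxvec_index (f i) l)).
  by rewrite mxE mxE row_mxEr LbE rsub_coord.
by rewrite e; under eq_fun do rewrite e; exact: coord_continuous.
Qed.

Lemma frame_entry_diff w : entry_diff (fun v : 'rV[C]_D => frame (rsubmx v)) w.
Proof.
move=> i j; case: (splitP j) => l jl.
  have -> : j = lshift _ l by exact: val_inj.
  have e v : frame (rsubmx v) i (lshift m l) = (1%:M : 'M[C]_1) 0 l by rewrite mxE mxE row_mxEl.
  by under eq_fun do rewrite e; exact: differentiable_cst.
have -> : j = rshift _ l by exact: val_inj.
have e v : frame (rsubmx v) i (rshift 1 l) = v 0 (rshift n.+1 (mxvec_index (f i) l)).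
  by rewrite mxE mxE row_mxEr LbE rsub_coord.
by under eq_fun do rewrite e; exact: differentiable_coord.
Qed.

Lemma near_slidable w : slidable w -> \forall v \near w, slidable v.
Proof.
move=> [uw w0].
have N1 : \forall v \near w, frame (rsubmx v) \in unitmx by exact: (near_unitmx (frame_continuous (w := w)) uw).
have N2 : \forall v \near w, forall l, 0 < complex.Re (lsubmx v 0 (f l) / x0 0 (f l)).
  apply: (@filter_forall _ _ (fun l (v : 'rV[C]_D) => 0 < complex.Re (lsubmx v 0 (f l) / x0 0 (f l))) (nbhs w)) => l.
  have c : (fun v => complex.Re (lsubmx v 0 (f l) / x0 0 (f l))) @ w -->
      complex.Re (lsubmx w 0 (f l) / x0 0 (f l)).
    apply: (@continuous_comp _ _ _ (fun v : 'rV[C]_D => lsubmx v 0 (f l) / x0 0 (f l)) (@complex.Re R)).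
      apply: (@cvgM C _ (nbhs w)); last exact: cvg_cst.
      rewrite lsub_coord; under eq_fun do rewrite lsub_coord; exact: coord_continuous.
    exact: continuous_Re.
  exact: (cvgr_gt _ c 0 (w0 l)).
by apply: filterS2 N1 N2 => v; split.
Qed.

Lemma retract_differentiable w : slidable w -> differentiable retract w.
Proof.
move=> [uw w0].
have dl i : differentiable (fun v : 'rV[C]_D => lsubmx v 0 i : C^o) w.
  by under eq_fun do rewrite lsub_coord; exact: differentiable_coord.
have ds : entry_diff solve w.
  apply: entry_diff_mul; first exact: (entry_diff_inv (frame_continuous (w := w)) (frame_entry_diff w) uw).
  move=> l j; under eq_fun do rewrite mxE.
  apply: (@differentiable_comp _ _ _ _ (fun v : 'rV[C]_D => lsubmx v 0 (f l) / x0 0 (f l) : C^o) (clog : C^o -> C^o)).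
    by apply: (@differentiableM C _ (fun v : 'rV[C]_D => lsubmx v 0 (f l))) => //; exact: differentiable_cst.
  exact: clog_differentiable.
apply: (@differentiable_row C) => j; rewrite /retract.
case: (splitP j) => l jl.
  have -> : j = lshift _ l by exact: val_inj.
  under eq_fun do rewrite row_mxEl mxE lsub_slide.
  apply: (@differentiableM C _ (fun v => cexp (- (complex_rows (Lb (rsubmx v)) *m solve v) (g l) 0))) => //.
  apply: (@differentiable_comp _ _ _ _ (fun v => - (complex_rows (Lb (rsubmx v)) *m solve v) (g l) 0 : C^o) (@cexp R : C^o -> C^o)).
    apply: differentiableN.
    have e v : (complex_rows (Lb (rsubmx v)) *m solve v) (g l) 0 =
      solve v (lshift m 0) 0 + \sum_i v 0 (rshift n.+1 (mxvec_index (g l) i)) * solve v (rshift 1 i) 0.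
      rewrite complex_rowsE; congr (_ + _); first by rewrite mxE.
      by apply: eq_bigr => i _; rewrite LbE rsub_coord !mxE.
    under eq_fun do rewrite e.
    apply: (@differentiableD C _ _ (fun v => solve v (lshift m 0) 0 : C^o)); first exact: ds.
    apply: (@differentiable_bigsum C) => i _.
    apply: (@differentiableM C _ (fun v : 'rV[C]_D => v 0 _)); first exact: differentiable_coord.
    exact: ds.
  exact: cexp_differentiable.
have -> : j = rshift _ l by exact: val_inj.
by under eq_fun do rewrite row_mxEr rsub_coord; exact: differentiable_coord.
Qed.

End Slice.

(** * Injectivity of small slices *)
Lemma exponent_bound {R : realType} (p x y t de : R) : 0 < p -> y = expR t * x ->
  expR (- de) * p <= x -> x <= expR de * p -> expR (- de) * p <= y -> y <= expR de * p ->
  `|t| <= 2 * de.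
Proof.
move=> p0 yE x1 x2 y1 y2.
have px : 0 < x by apply: lt_le_trans x1; rewrite mulr_gt0 ?expR_gt0.
have h1 : expR (- (2 * de)) * x <= y.
  apply: le_trans y1; rewrite mulr_natl mulr2n opprD expRD -mulrA ler_wpM2l ?expR_ge0 //.
  by rewrite -(ler_pM2l (expR_gt0 de)) mulrA -expRD subrr expR0 mul1r.
have h2 : y <= expR (2 * de) * x.
  apply: (le_trans y2); rewrite mulr_natl mulr2n expRD -mulrA ler_wpM2l ?expR_ge0 //.
  by rewrite -(ler_pM2l (expR_gt0 (- de))) mulrA -expRD addNr expR0 mul1r.
move: h1 h2; rewrite yE !(ler_pM2r px) !ler_expR => h1 h2.
by rewrite ler_norml h1 h2.
Qed.

Section Charts.
Context {R : realType} {m n : nat}.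
Local Notation C := (Cx R).
Local Notation k := (n.+1 * m)%N.
Local Notation D := (n.+1 + k)%N.
Local Notation d := (n - m + k)%N.
Implicit Types (w : 'rV[C]_D) (b : 'rV[C]_k) (x : 'rV[C]_n.+1) (z : 'rV[C]_m) (c : C).
Variables (E : {set {set 'I_n.+1}}) (B : set (affine R k)) (beta0 : 'rV[C]_k) (K : R).
Hypothesis oB : open B.
Hypothesis B0 : B beta0.
Hypothesis E_ne : exists A, A \in E.
Hypothesis K0 : 0 < K.
Hypothesis unif : forall b, B b -> unif_config K (aff_rows (Lb b) : 'M[R]_(n.+1, 1 + (m + m))) E.
Local Notation fam := (@family_space R m n E B).
Local Notation qF := (qF B0 E_ne).

(** If two points of a thin slice are identified, comparing their moduli on [A] shows
    that [z] is small ([unif_bound]).  The equations of the frozen coordinates then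
    involve exponentials of small numbers, on which the exponential is injective, and
    become linear equations with an invertible matrix. *)
Lemma flow_rigid b c z x y x0 (f : 'I_(1 + m) -> 'I_n.+1) A (de La : R) :
  B b -> A \in E -> frame f b \in unitmx -> c != 0 ->
  y = pscale (lvmb_char (Lb b) c z) x ->
  (forall l, x0 0 (f l) != 0) -> (forall l, x 0 (f l) = x0 0 (f l)) ->
  (forall l, y 0 (f l) = x0 0 (f l)) -> (forall i, i \in A -> x0 0 i != 0) ->
  (forall i, i \in A -> expR (- de) * cmod (x0 0 i) <= cmod (x 0 i) <= expR de * cmod (x0 0 i)) ->
  (forall i, i \in A -> expR (- de) * cmod (x0 0 i) <= cmod (y 0 i) <= expR de * cmod (x0 0 i)) ->
  (forall j, cmod (b 0 j) <= La) -> 0 <= de -> 0 <= La ->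
  m%:R * (2 * La * (4 * K * de)) < 1 -> c = 1 /\ z = 0.
Proof.
move=> Bb AE uf c0 yE x0f xf yf x0A xA yA bLa de0 La0 small.
have u := unif Bb; pose V : 'M[R]_(n.+1, 1 + (m + m)) := aff_rows (Lb b); pose h := hcol c z.
have yVx i : cmod (y 0 i) = expR ((V *m h) i 0) * cmod (x 0 i).
  by rewrite yE pscaleE cmodM cmod_lvmb_char.
have Vh i : i \in A -> `|(V *m h) i 0| <= 2 * de.
  move=> iA; have p0 : 0 < cmod (x0 0 i) by rewrite cmod_gt0 x0A.
  have /andP[x1 x2] := xA i iA; have /andP[y1 y2] := yA i iA.
  exact: (exponent_bound p0 (yVx i) x1 x2 y1 y2).
have bd := unif_bound u AE (mulr_ge0 (ler0n _ 2) de0) Vh.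
have zj j : cmod (z 0 j) <= 4 * K * de.
  apply: le_trans (cmod_le_sum _) _.
  have := bd (rshift 1 (lshift m j)); have := bd (rshift 1 (rshift m j)).
  rewrite /h hcol_Re hcol_Im normrN => h1 h2.
  apply: le_trans (lerD h2 h1) _; rewrite le_eqVlt; apply/orP; left; apply/eqP; ring.
have bdl l l' : cmod (linform (Lb b (f l)) z - linform (Lb b (f l')) z) < 1.
  apply: le_lt_trans small.
  have -> : linform (Lb b (f l)) z - linform (Lb b (f l')) z =
      \sum_j (Lb b (f l) 0 j - Lb b (f l') 0 j) * z 0 j.
    by rewrite /linform -sumrB; apply: eq_bigr => j _; rewrite mulrBl.
  have cs (s : seq 'I_m) (F : 'I_m -> C) (G : 'I_m -> R) : (forall j, cmod (F j) <= G j) ->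
      cmod (\sum_(j <- s) F j) <= \sum_(j <- s) G j.
    move=> FG; elim: s => [|j s IH]; first by rewrite !big_nil cmod0.
    by rewrite !big_cons; apply: le_trans (cmodD _ _) _; exact: lerD.
  have -> : m%:R * (2 * La * (4 * K * de)) = \sum_(j < m) 2 * La * (4 * K * de).
    by rewrite sumr_const card_ord mulr_natl.
  apply: cs.
  move=> j; rewrite cmodM ler_pM ?cmod_ge0 //.
  apply: le_trans (cmodD _ _) _; rewrite cmodN !LbE mulr_natl mulr2n; exact: lerD.
have cl l : c * cexp (linform (Lb b (f l)) z) = 1.
  apply: (mulIf (x0f l)); rewrite mul1r -{1}xf -yf yE pscaleE //.
(* The equation of index l0 provides a logarithm of c, so that c need not be near 1
   for the other equations to be written with exponents. *)
pose l0 : 'I_(1 + m) := lshift m 0; pose ze := - linform (Lb b (f l0)) z.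
have cz : c = cexp ze.
  by apply: (mulIf (cexp_neq0 (linform (Lb b (f l0)) z))); rewrite cl -cexpD addNr cexp0.
pose v : 'cV[C]_(1 + m) := col_mx ze%:M z^T.
have fv0 : frame f b *m v = 0.
  apply/colP => l; rewrite [RHS]mxE mul_rowsub_mx mxE complex_rowsE col_mxKu col_mxKd trmxK.
  rewrite mxE eqxx mulr1n; apply: cexp_small_inj; first by rewrite cexpD -cz cl.
  apply: le_lt_trans (Im_le_cmod _) _; rewrite addrC; exact: bdl.
have v0 : v = 0 by rewrite -(mulKmx uf v) fv0 mulmx0.
have [/matrixP/(_ 0 0) e1 e2] : ze%:M = 0 :> 'M[C]_1 /\ z^T = 0.
  by rewrite -col_mx0 in v0; exact: eq_col_mx v0.
split; last by rewrite -[z]trmxK e2 trmx0.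
by rewrite cz; move: e1; rewrite !mxE eqxx mulr1n => ->; rewrite cexp0.
Qed.

Lemma near_ratio x0 (A : {set 'I_n.+1}) (de : R) : (forall i, i \in A -> x0 0 i != 0) -> 0 < de ->
  \forall x \near x0, forall i, i \in A ->
    expR (- de) * cmod (x0 0 i) <= cmod ((x : 'rV[C]_n.+1) 0 i) <= expR de * cmod (x0 0 i).
Proof.
move=> xA de0.
apply: (@filter_forall _ _ (fun i (x : 'rV[C]_n.+1) => i \in A ->
  expR (- de) * cmod (x0 0 i) <= cmod (x 0 i) <= expR de * cmod (x0 0 i)) (nbhs x0)) => i.
have [iA|_] := boolP (i \in A); last by apply: (@filterE _ (nbhs x0)).
have p0 : 0 < cmod (x0 0 i) by rewrite cmod_gt0 xA.
have h1 : \forall z \near x0, expR (- de) * cmod (x0 0 i) < cmod ((z : 'rV[C]_n.+1) 0 i).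
  apply: (cvgr_gt _ (@continuous_cmod_coord R n i x0)).
  by rewrite gtr_pMl // expR_lt1 oppr_lt0.
have h2 : \forall z \near x0, cmod ((z : 'rV[C]_n.+1) 0 i) < expR de * cmod (x0 0 i).
  apply: (cvgr_lt _ (@continuous_cmod_coord R n i x0)).
  by rewrite ltr_pMl // expR_gt1.
by apply: filterS2 h1 h2 => z /ltW a1 /ltW a2 _; rewrite a1.
Qed.

Lemma near_base_bound b : \forall b' \near b, forall j, cmod ((b' : 'rV[C]_k) 0 j) <= 1 + \sum_j cmod (b 0 j).
Proof.
apply: (@filter_forall _ _ (fun j (b' : 'rV[C]_k) => cmod (b' 0 j) <= 1 + \sum_j cmod (b 0 j)) (nbhs b)) => j.
have c : (fun b' : 'rV[C]_k => cmod (b' 0 j)) @ b --> cmod (b 0 j).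
  apply: (@continuous_comp _ _ _ (fun x : 'rV[C]_k => x 0 j) cmod).
    exact: coord_continuous.
  exact: continuous_cmod.
apply: (cvgr_le _ c); rewrite (bigD1 j) //= addrCA ltrDl ltr_pwDl // sumr_ge0 // => i _; exact: cmod_ge0.
Qed.

End Charts.

(** * The family as a proper submersion *)
(** There are n+1 coordinates, of which m+1 are frozen. *)
Lemma complement_index {R : realType} (m n : nat) (f : 'I_(1 + m) -> 'I_n.+1) : injective f ->
  exists g : 'I_(n - m) -> 'I_n.+1, injective g /\
    forall i, (exists j, g j = i) <-> ~ exists l, f l = i.
Proof.
move=> fi; pose T := (~: (f @: [set: 'I_(1 + m)]))%SET.
have cT : #|T| = (n - m)%N.
  have := cardsC (f @: [set: 'I_(1 + m)])%SET; rewrite card_imset // cardsT !card_ord -/T.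
  by move=> /(canRL (addKn _)) ->; rewrite subSS.
have [g [gi gT Tg _]] := @enum_rows R _ _ _ cT.
exists g; split=> // i; split=> [[j <-] [l e]|h].
  by have := gT j; rewrite inE -e imset_f ?inE.
by apply: Tg; rewrite inE; apply/imsetP => -[l _ e]; apply: h; exists l.
Qed.

Section Manifold.
Context {R : realType} {m n : nat}.
Local Notation C := (Cx R).
Local Notation k := (n.+1 * m)%N.
Local Notation D := (n.+1 + k)%N.
Local Notation d := (n - m + k)%N.
Implicit Types (w : 'rV[C]_D) (b : 'rV[C]_k) (x : 'rV[C]_n.+1) (z : 'rV[C]_m) (c : C).
Variables (E : {set {set 'I_n.+1}}) (B : set (affine R k)) (beta0 : 'rV[C]_k) (K : R).
Hypothesis oB : open B.
Hypothesis B0 : B beta0.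
Hypothesis E_ne : exists A, A \in E.
Hypothesis K0 : 0 < K.
Hypothesis unif : forall b, B b -> unif_config K (aff_rows (Lb b) : 'M[R]_(n.+1, 1 + (m + m))) E.
Local Notation fam := (@family_space R m n E B).
Local Notation qF := (qF B0 E_ne : affine R D -> fam).

(** A slice given by a map from the free coordinates to homogeneous coordinates, with
    the parameter of the base as a further coordinate. *)
Definition slice_of (X : 'rV[C]_(n - m) -> 'rV[C]_n.+1) (e : affine R d) : affine R D :=
  row_mx (X (lsubmx (e : 'rV[C]_d))) (rsubmx (e : 'rV[C]_d)).

(** A point is presented on the slice through it that freezes m+1 of its coordinates;
    its form [slice_of], with the parameter as a coordinate, exhibits the projection to
    the base as a linear projection. *)
Lemma family_slice w0 : family_domain E B w0 ->
  exists (X : 'rV[C]_(n - m) -> 'rV[C]_n.+1) (Dm : set (affine R d)) (phi : fam -> affine R d) (e0 : affine R d),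
   [/\ open Dm, Dm e0, slice_of X e0 = w0, forall u, differentiable X u
     & [/\ forall e, Dm e -> family_domain E B (slice_of X e),
           is_chart ((qF \o slice_of X) @` Dm) phi (qF \o slice_of X)
         & forall e, Dm e -> phi (qF (slice_of X e)) = e]].
Proof.
move=> tw; have [[A AE xA] Bb] := tw; have pr := presents_family oB B0 E_ne.
set x0 := lsubmx w0 in xA; set b0 := rsubmx w0 in Bb.
have [f [fi fA uf]] := complex_frame (unif_cfg (unif Bb)) AE.
have [g [gi gf]] := @complement_index R m n f fi.
have x0f l : x0 0 (f l) != 0 by exact: xA.
pose s : affine R d -> affine R D := slice_of (fill g x0).
pose e0 : affine R d := row_mx (\row_j x0 0 (g j)) b0.
have se0 : s e0 = w0.
  by rewrite /s /slice_of /e0 row_mxKl row_mxKr (fillK gi gf) // hsubmxK.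
have ds (e : 'rV[C]_d) : differentiable (s : 'rV[C]_d -> 'rV[C]_D) e := slice_differentiable g x0 e.
(* [La] bounds the parameters near b0, and [de] the logarithmic width of the slice,
   for which the last hypothesis of [flow_rigid] holds. *)
pose La := 1 + \sum_j cmod (b0 0 j).
have La0 : 0 <= La by rewrite addr_ge0 // sumr_ge0 // => j _; exact: cmod_ge0.
pose T := m%:R * (2 * La * (4 * K)).
have T0 : 0 <= T by rewrite !mulr_ge0 // ltW.
pose de := (1 + T)^-1; have de0 : 0 < de by rewrite invr_gt0 ltr_wpDr.
have small : m%:R * (2 * La * (4 * K * de)) < 1.
  have -> : m%:R * (2 * La * (4 * K * de)) = T * de by rewrite /T !mulrA.
  by rewrite /de ltr_pdivrMr ?ltr_wpDr // mul1r ltrDr.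
pose cond (w : 'rV[C]_D) := [/\ family_domain E B w, frame f (rsubmx w) \in unitmx,
   forall i, i \in A -> expR (- de) * cmod (x0 0 i) <= cmod (lsubmx w 0 i) <= expR de * cmod (x0 0 i)
   & forall j, cmod (rsubmx w 0 j) <= La].
have N : \forall w \near w0, cond w.
  have N1 : \forall w \near w0, family_domain E B w by exact: (pres_near_dom pr tw).
  have N2 : \forall w \near w0, frame f (rsubmx w) \in unitmx.
    by apply: (near_unitmx (frame_continuous (w := w0))); exact: uf.
  have N3 : \forall w \near w0, forall i, i \in A ->
      expR (- de) * cmod (x0 0 i) <= cmod (lsubmx w 0 i) <= expR de * cmod (x0 0 i).
    exact: (continuous_lsub (near_ratio xA de0)).
  have N4 : \forall w \near w0, forall j, cmod (rsubmx w 0 j) <= La.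
    exact: (continuous_rsub (near_base_bound b0)).
  by apply: filterS2 (filterI N1 N2) (filterI N3 N4) => w [? ?] [? ?]; split.
have cs : {for e0, continuous s} := differentiable_continuous (ds e0).
have Ns : \forall e \near e0, cond (s e) by apply: (near_cont cs); rewrite se0.
have [Dm [oD De0 DmC _]] := open_in2 Ns Ns.
have [|e De|e De|e e' De De' qe|phi [ch phiK]] := @chart_of_slice R fam D _ qF pr d Dm s
   (fun _ => retract f g x0 : affine R D -> affine R d) e0 oD.
- by move=> e /DmC[].
- exact: ds.
- have [te ue _ _] := DmC e De; split; first exact: (retract_slice gi gf x0f).
  have sl : slidable f x0 (s e).
    split=> // l; rewrite /s /slice_of row_mxKl (fill_f _ gf) divff //=; exact: ltr01.
  have N1 : \forall w \near (s e : 'rV[C]_D), family_domain E B w by exact: (pres_near_dom pr te).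
  have N2 := near_slidable sl.
  apply: filterS2 N1 N2 => w tw' sw; split; first exact: retract_differentiable.
  have -> : s (retract f g x0 w) = slide f x0 w by exact: slice_retract.
  have c0 := cexp_neq0 (- usubmx (solve f x0 w) 0 0).
  apply/(qF_eq B0 E_ne); [exact: domain_flow|exact: tw'|].
  exists (cexp (- usubmx (solve f x0 w) 0 0))^-1, (dsubmx (solve f x0 w))^T.
  by rewrite invr_eq0 flowD mulVf // subrr flow10.
- have [te ue be ble] := DmC e De; have [te' ue' be' _] := DmC e' De'.
  move/(qF_eq B0 E_ne te te'): qe => [c [z [c0 ev]]].
  have yE : lsubmx (s e') = pscale (lvmb_char (Lb (rsubmx (s e))) c z) (lsubmx (s e)).
    by rewrite ev lsub_flow.
  have sf v l : lsubmx (s v) 0 (f l) = x0 0 (f l) by rewrite /s /slice_of row_mxKl (fill_f _ gf).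
  have [c1 z0] : c = 1 /\ z = 0.
    exact: (flow_rigid unif te.2 AE ue c0 yE x0f (sf e) (sf e') xA be be' ble (ltW de0) La0 small).
  apply: (can_inj (retract_slice gi gf x0f)).
  by rewrite -[LHS]flow10 -c1 -z0; exact: (esym ev).
exists (fill g x0), Dm, phi, e0; split=> //; first exact: fill_differentiable.
by split=> // e /DmC[].
Qed.

(** In the chart of a slice the projection to the base is a coordinate projection, so
    its differential is onto. *)
Lemma family_chart (y : fam) : exists (W : set fam) (phi : fam -> affine R d) (psi : affine R d -> fam),
  [/\ W y, is_chart W phi psi
    & forall v : 'rV[C]_k, exists u : 'rV[C]_d,
       'd (@base_of R m n E B \o psi : 'rV[C]_d -> 'rV[C]_k) (phi y) u = v].
Proof.
have [w tw <-] := pres_surj (presents_family oB B0 E_ne) y.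
have [X [Dm [phi [e0 [oD De0 se0 dX [Dt ch phiK]]]]]] := family_slice tw.
exists ((qF \o slice_of X) @` Dm), phi, (qF \o slice_of X); split=> //.
  by exists e0 => //=; rewrite se0.
have phi0 : phi (qF w) = e0 by rewrite -se0 phiK.
rewrite phi0 => v.
have dr : differentiable (rsubmx : 'rV[C]_d -> 'rV[C]_k) (e0 : 'rV[C]_d).
  by apply: (@differentiable_row C) => j; under eq_fun do rewrite mxE; exact: differentiable_coord.
have N : \forall e \near (e0 : 'rV[C]_d), rsubmx (e : 'rV[C]_d) = (@base_of R m n E B \o (qF \o slice_of X)) e.
  have ND : \forall e \near (e0 : affine R d), Dm e by exact: open_nbhs_nbhs.
  apply: filterS ND => e De; rewrite /= base_qF; last exact: Dt.
  by rewrite /slice_of row_mxKr.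
have [_ ->] := diff_near_eq N dr.
exists (row_mx 0 v).
have cr : continuous (rsubmx : 'rV[C]_d -> 'rV[C]_k).
  move=> x; apply: (@cvg_mx _ (nbhs x)) => i j; rewrite (ord1 i) mxE.
  by under eq_fun do rewrite mxE; exact: coord_continuous.
rewrite (_ : 'd _ _ = rsubmx :> ('rV[C]_d -> 'rV[C]_k)) ?row_mxKr //.
exact: (@diff_lin C 'rV[C]_d 'rV[C]_k (rsubmx : {linear 'rV[C]_d -> 'rV[C]_k}) e0 cr).
Qed.

Hypothesis comp : forall A i, A \in E -> exists2 j, j \in A & i |: (A :\ j) \in E.

Lemma family_complex_family (cB : connected B) : complex_family B (@base_of R m n E B).
Proof.
split=> //; first exact: (base_range B0 E_ne).
split; first exact: (family_proper oB B0 E_ne comp unif).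
split; first exact: (base_holomorphic oB B0 E_ne).
exists d; split; last exact: family_chart.
split; first exact: (family_hausdorff oB B0 E_ne K0 unif).
  exact: (pres_second_countable (presents_family oB B0 E_ne)).
by move=> y; have [W [phi [psi [Wy ch _]]]] := family_chart y; exists W, phi, psi.
Qed.

End Manifold.

(** * Fibres of the family *)
Section Fibres.
Context {R : realType} {m n : nat}.
Local Notation C := (Cx R).
Local Notation k := (n.+1 * m)%N.
Local Notation D := (n.+1 + k)%N.
Local Notation d := (n - m + k)%N.
Implicit Types (w : 'rV[C]_D) (x : 'rV[C]_n.+1) (z : 'rV[C]_m) (c : C).
Variables (E : {set {set 'I_n.+1}}) (B : set (affine R k)) (beta0 : 'rV[C]_k) (K : R).
Hypothesis oB : open B.
Hypothesis B0 : B beta0.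
Hypothesis E_ne : exists A, A \in E.
Hypothesis E_set : forall A, A \in E -> exists i, i \in A.
Hypothesis K0 : 0 < K.
Hypothesis unif : forall b, B b -> unif_config K (aff_rows (Lb b) : 'M[R]_(n.+1, 1 + (m + m))) E.
Local Notation fam := (@family_space R m n E B).
Local Notation qF := (qF B0 E_ne : affine R D -> fam).
Variable b : 'rV[C]_k.
Hypothesis Bb : B b.

Definition at_base x : affine R D := row_mx x b.

Lemma at_base_differentiable x : differentiable (at_base : 'rV[C]_n.+1 -> 'rV[C]_D) x.
Proof.
apply: (@differentiable_row C) => j; rewrite /at_base; case: (splitP j) => l jl.
  have -> : j = lshift _ l by exact: val_inj.
  by under eq_fun do rewrite row_mxEl; exact: differentiable_coord.
have -> : j = rshift _ l by exact: val_inj.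
by under eq_fun do rewrite row_mxEr; exact: differentiable_cst.
Qed.

Lemma domain_at_base x : supp_open E x -> family_domain E B (at_base x).
Proof. by move=> sx; apply: family_domainI. Qed.

Lemma base_at_base x : supp_open E x -> @base_of R m n E B (qF (at_base x)) = b.
Proof. by move=> sx; rewrite base_qF ?row_mxKr //; exact: domain_at_base. Qed.

Lemma supp_ones : supp_open E (const_mx 1 : 'rV[C]_n.+1).
Proof. by have [A AE] := E_ne; exists A => // i _; rewrite mxE oner_neq0. Qed.

Definition fibre_pt : set_type (@base_of R m n E B @^-1` [set b]) :=
  exist (fun y => y \in @base_of R m n E B @^-1` [set b]) _ (mem_set (base_at_base supp_ones)).

Definition fibre_map : affine R n.+1 -> fibre (@base_of R m n E B) b :=
  fun x => insubd fibre_pt (qF (at_base x)).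

Lemma fibre_mapE x : supp_open E x -> set_val (fibre_map x) = qF (at_base x).
Proof. by move=> sx; apply: set_val_insubd; exact: base_at_base. Qed.

Lemma fibre_map_continuous x : supp_open E x -> {for (x : affine R n.+1), continuous fibre_map}.
Proof.
move=> sx; have pr := presents_family oB B0 E_ne; have tx := domain_at_base sx.
apply: contP => V /nbhs_set_type[W]; rewrite fibre_mapE // => Wx WV.
have cb : {for x, continuous (at_base : 'rV[C]_n.+1 -> 'rV[C]_D)} :=
  differentiable_continuous (at_base_differentiable x).
have N1 : \forall y \near (x : affine R n.+1), W (qF (at_base y)).
  exact: (near_cont cb (near_cont (pres_cont pr tx) Wx)).
have N2 : \forall y \near (x : affine R n.+1), supp_open E y.
  by apply: open_nbhs_nbhs; split=> //; exact: open_supp_open.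
by apply: filterS2 N1 N2 => y Wy sy; apply: WV; rewrite /= fibre_mapE.
Qed.

(** The fibre carries the induced structure: its functions are those that extend locally
    to the family.  In the chart of a slice an extension exists, by making a function
    constant in the direction of the base. *)
Lemma presents_fibre : presents (supp_open E) fibre_map.
Proof.
have pr := presents_family oB B0 E_ne.
split.
- exact: open_supp_open.
- by move=> x sx; exact: fibre_map_continuous.
- move=> x V sx xV; apply/nbhs_set_type; rewrite fibre_mapE //; have tx := domain_at_base sx.
  exists (qF @` (family_domain E B `&` (fun w : 'rV[C]_D => V (lsubmx w)))).
    apply: (pres_nbhs pr tx); apply: filterI; first exact: (pres_near_dom pr tx).
    apply: (@continuous_lsub R m n (at_base x)); rewrite /at_base row_mxKl; exact: xV.
  move=> y [w [tw Vw] wy]; exists (lsubmx w) => //; apply: val_inj.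
  have bw : rsubmx w = b by rewrite -(base_qF B0 E_ne tw) wy; exact: (set_valP y).
  have h : set_val (fibre_map (lsubmx w)) = set_val y.
    by rewrite fibre_mapE; [rewrite -wy /at_base -bw hsubmxK|exact: tw.1].
  exact: h.
- move=> y; have [w tw wy] := pres_surj pr (set_val y).
  have bw : rsubmx w = b by rewrite -(base_qF B0 E_ne tw) wy; exact: (set_valP y).
  exists (lsubmx w); first exact: tw.1.
  have h : set_val (fibre_map (lsubmx w)) = set_val y.
    by rewrite fibre_mapE; [rewrite -wy /at_base -bw hsubmxK|exact: tw.1].
  by apply: val_inj; exact: h.
move=> x g sx; have tx := domain_at_base sx.
have N2 : \forall y \near (x : affine R n.+1), supp_open E y.
  by apply: open_nbhs_nbhs; split=> //; exact: open_supp_open.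
split=> [[g' [hg' gg']]|hg].
  rewrite fibre_mapE // in hg'.
  have h1 : hol_at (x : affine R n.+1) ((g' \o qF) \o at_base).
    apply: hol_affine_comp; last exact: (proj1 (pres_hol pr g' tx) hg').
    by apply: near_all => y; exact: at_base_differentiable.
  apply: hol_affine_eq h1.
  have N1 : \forall y \near (x : affine R n.+1), g (fibre_map y) = g' (set_val (fibre_map y)).
    exact: (near_cont (fibre_map_continuous sx) gg').
  by apply: filterS2 N1 N2 => y e sy; rewrite /= e fibre_mapE.
have [X [Dm [phi [e0 [oD De0 se0 dX [Dt ch phiK]]]]]] := family_slice oB B0 E_ne K0 unif tx.
have e0E : X (lsubmx (e0 : 'rV[C]_d)) = x /\ rsubmx (e0 : 'rV[C]_d) = b by apply: eq_row_mx; exact: se0.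
(* The extension: forget the base coordinates in the chart, and evaluate on the
   point of the fibre over b with the same free coordinates. *)
pose g' (y : fam) : C := g (fibre_map (X (lsubmx (phi y : 'rV[C]_d)))).
have W0 : ((qF \o slice_of X) @` Dm) (qF (at_base x)) by exists e0 => //=; rewrite se0.
have phi0 : phi (qF (at_base x)) = e0 by rewrite -se0 phiK.
have ND : \forall e \near e0, Dm e by exact: open_nbhs_nbhs.
exists g'; split.
  rewrite fibre_mapE //; have [_ _ _ _ ch5] := ch; apply/(ch5 _ g' W0); rewrite phi0.
  have h1 : hol_at e0 ((g \o fibre_map) \o (fun e : affine R d => X (lsubmx (e : 'rV[C]_d)) : affine R n.+1)).
    apply: hol_affine_comp; last by rewrite e0E.1.
    apply: near_all => e; apply: (@differentiable_comp _ _ _ _ (lsubmx : 'rV[C]_d -> 'rV[C]_(n - m)) X); last exact: dX.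
    by apply: (@differentiable_row C) => j; under eq_fun do rewrite mxE; exact: differentiable_coord.
  apply: hol_affine_eq h1; apply: filterS ND => e De.
  by rewrite /= /g' /= phiK.
have [oW _ _ _ _] := ch.
apply/nbhs_set_type; exists ((qF \o slice_of X) @` Dm).
  by rewrite fibre_mapE //; exact: open_nbhs_nbhs.
move=> y [e De /= ye]; rewrite /g' -ye phiK //; congr g.
have te := Dt e De.
have be : rsubmx (e : 'rV[C]_d) = b.
  have : @base_of R m n E B (set_val y) = b by exact: (set_valP y).
  by rewrite -ye base_qF // /slice_of row_mxKr.
have sX : supp_open E (X (lsubmx (e : 'rV[C]_d))) by have [] := te; rewrite /slice_of row_mxKl.
have h : set_val y = set_val (fibre_map (X (lsubmx (e : 'rV[C]_d)))).
  by rewrite fibre_mapE // -ye /slice_of be.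
by apply: val_inj; exact: h.
Qed.

(** Both sides are presented by the cone over the LVMB open set, with the same
    identifications. *)
Lemma LVMB_fibre : biholomorphic (LVMB_manifold (Lb b) E) (fibre (@base_of R m n E B) b).
Proof.
have [q [prq qE]] := presents_LVMB (Lb b) E_ne E_set.
apply: (biholomorphic_presents prq presents_fibre) => x y sx sy.
rewrite qE //; split=> [[c [z [c0 e]]]|e].
  apply: val_inj; suff h : set_val (fibre_map x) = set_val (fibre_map y) by exact: h.
  rewrite !fibre_mapE //; apply/(qF_eq B0 E_ne (domain_at_base sx) (domain_at_base sy)).
  by exists c, z; split=> //; rewrite /flow /at_base row_mxKl row_mxKr e.
have : qF (at_base x) = qF (at_base y) by rewrite -!fibre_mapE // e.
move/(qF_eq B0 E_ne (domain_at_base sx) (domain_at_base sy)) => [c [z [c0 ev]]].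
by exists c, z; split=> //; have := congr1 lsubmx ev; rewrite lsub_flow /at_base !row_mxKl row_mxKr.
Qed.

End Fibres.

(** * Density of the parameters satisfying condition K *)
Section Density.
Context {R : realType} {m n : nat}.
Local Notation C := (Cx R).
Local Notation k := (n.+1 * m)%N.

Lemma aff_rows_continuous (b0 : 'rV[C]_k) :
  (fun b : 'rV[C]_k => aff_rows (Lb b) : 'M[R]_(n.+1, 1 + (m + m))) @ b0 --> aff_rows (Lb b0).
Proof.
apply: (@cvg_mx _ (nbhs b0)) => i j.
have cc l : (fun b : 'rV[C]_k => b 0 l) @ b0 --> b0 0 l by exact: coord_continuous.
case: (splitP j) => l jl.
  have -> : j = lshift _ l by exact: val_inj.
  have e b : aff_rows (Lb b) i (lshift (m + m) l) = (1%:M : 'M[R]_1) 0 l by rewrite mxE row_mxEl.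
  by rewrite e; under eq_fun do rewrite e; exact: cvg_cst.
have -> : j = rshift _ l by exact: val_inj.
case: (splitP l) => h lh.
  have -> : l = lshift _ h by exact: val_inj.
  have e b : aff_rows (Lb b) i (rshift 1 (lshift m h)) = complex.Re (b 0 (mxvec_index i h)).
    by rewrite mxE row_mxEr row_mxEl mxE LbE.
  rewrite e; under eq_fun do rewrite e.
  exact: (@continuous_comp _ _ _ (fun b : 'rV[C]_k => b 0 (mxvec_index i h)) (@complex.Re R) b0 (cc _) (@continuous_Re R _)).
have -> : l = rshift _ h by exact: val_inj.
have e b : aff_rows (Lb b) i (rshift 1 (rshift m h)) = complex.Im (b 0 (mxvec_index i h)).
  by rewrite mxE row_mxEr row_mxEr mxE LbE.
rewrite e; under eq_fun do rewrite e.
exact: (@continuous_comp _ _ _ (fun b : 'rV[C]_k => b 0 (mxvec_index i h)) (@complex.Im R) b0 (cc _) (@continuous_Im R _)).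
Qed.

Lemma common_denominator (I : finType) (r : I -> rat) :
  exists2 N : int, N != 0 & forall i, exists a : int, ratr (r i) * N%:~R = a%:~R :> R.
Proof.
exists (\prod_i denq (r i)); first by apply/prodf_neq0 => i _; exact: denq_neq0.
move=> i; exists (numq (r i) * \prod_(j | j != i) denq (r j)).
rewrite (bigD1 i) //= !intrM mulrA /ratr; congr (_ * _); rewrite divfK //.
by rewrite intr_eq0 denq_neq0.
Qed.

(** Multiplication by a common denominator makes the real and imaginary parts integral. *)
Lemma gauss_condition_K (q : 'rV[rat * rat]_k) : condition_K (Lb (gauss q : 'rV[C]_k)).
Proof.
have [N N0 NP] := common_denominator (fun p : 'I_k * bool => if p.2 then (q 0 p.1).1 else (q 0 p.1).2).
exists (N%:~R%:M), 0; split=> [|i j].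
  by rewrite unitmxE det_scalar unitfE expf_neq0 // intr_eq0.
rewrite addr0 mul_mx_scalar mxE mulrC /realvec; case: (splitP j) => l jl.
  have -> : j = lshift _ l by exact: val_inj.
  by rewrite row_mxEl mxE LbE mxE /=; have := NP (mxvec_index i l, true).
have -> : j = rshift _ l by exact: val_inj.
by rewrite row_mxEr mxE LbE mxE /=; have := NP (mxvec_index i l, false).
Qed.

(** Take a polydisc of parameters with uniform constants.  Any neighbourhood of its
    centre contains Gaussian rational parameters, whose fibres are LVMB manifolds
    satisfying (K). *)
Lemma LVMB_small_deformation (L : 'I_n.+1 -> 'rV[C]_m) (E : {set {set 'I_n.+1}}) :
  is_LVMB L E -> small_deformation_of (is_intermediate_GIT_quotient m n) (LVMB_manifold L E).
Proof.
move=> lv; have [dat _ comp] := lv; have [_ _ [A AE] card] := dat.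
have E_ne : exists A, A \in E by exists A.
have E_set A' : A' \in E -> exists i, i \in A'.
  by move=> /card cA; apply/set0Pn; rewrite -card_gt0 cA.
pose b0 : 'rV[C]_k := mxvec (\matrix_i L i).
have LE : Lb b0 = L by exact: Lb_mxvec.
have g0 : geo_config (aff_rows (Lb b0) : 'M[R]_(n.+1, 1 + (m + m))) E by rewrite LE; exact: lvmb_geo.
have [K K0 NK] := near_unif_config (aff_rows_continuous (b0 := b0)) g0.
have /nbhs_polybox[e e0 eK] := NK.
pose B : set (affine R k) := polybox b0 e.
have oB : open B by exact: open_polybox.
have B0 : B b0 by exact: polybox_center.
have unif b : B b -> unif_config K (aff_rows (Lb b) : 'M[R]_(n.+1, 1 + (m + m))) E by exact: eK.
exists k, B, (@family_space R m n E B), (@base_of R m n E B), b0; split=> //.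
- exact: (family_complex_family oB B0 E_ne K0 unif comp (@connected_polybox R _ b0 e)).
- have := LVMB_fibre oB B0 E_ne E_set K0 unif B0; by rewrite LE.
move=> V b0V.
have : nbhs (b0 : 'rV[C]_k) (V `&` B).
  by apply: filterI => //; exact: (@open_nbhs_nbhs (affine R k) b0 B (conj oB B0)).
move=> /nbhs_polybox[e' e'0 sub]; have [q qb] := gauss_dense b0 e'0.
have [Vq Bq] := sub _ qb.
exists (gauss q); split=> //; exists (LVMB_manifold (Lb (gauss q)) E).
  apply: condition_K_GIT; last exact: gauss_condition_K.
  by apply: geo_lvmb => //; exact: (unif_cfg (unif _ Bq)).
exact: (LVMB_fibre oB B0 E_ne E_set K0 unif Bq).
Qed.

End Density.

Theorem theorem2p1 (R : realType) (m n : nat) :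
  (forall (L : 'I_n.+1 -> 'rV[Cx R]_m) (E : {set {set 'I_n.+1}}),
     is_LVMB L E -> condition_K L ->
     is_intermediate_GIT_quotient m n (LVMB_manifold L E)) /\
  (forall (L : 'I_n.+1 -> 'rV[Cx R]_m) (E : {set {set 'I_n.+1}}),
     is_LVMB L E ->
     small_deformation_of (is_intermediate_GIT_quotient m n) (LVMB_manifold L E)).
Proof.
split=> [L E lv K|L E lv]; first exact: condition_K_GIT.
exact: LVMB_small_deformation.
Qed.
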